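(* $$\dim_H(\mathbf{DI}_2\setminus\mathbf{DI}_1)=\dim_H(\mathbf{DI}_1\setminus\mathbf{DI}_2)=1.$$
   Context: $\dim_H$ denotes Hausdorff dimension. For $p\in[1,\infty)$ let $F^{[p]}(x,y)=(|x|^p+|y|^p)^{1/p}$ on $\mathbb R^2$, let $\mathcal B_p=\{F^{[p]}\le1\}$, and let $\Delta_p=\inf\det\Lambda$, the infimum over (full rank) lattices $\Lambda\subset\mathbb R^2$ having no nonzero point in the interior of $\mathcal B_p$ (the critical determinant). For $\alpha\in\mathbb R$ and $t\ge1$ let $$\Lambda_\alpha(t)=\{(t^{-1}q,\ t(m-q\alpha)):\ q,m\in\mathbb Z\},\qquad \lambda_1(t)=\min\{F^{[p]}(z):0\ne z\in\Lambda_\alpha(t)\},\qquad d^{[p]}(\alpha)=\limsup_{t\to\infty}\lambda_1(t).$$ One always has $d^{[p]}(\alpha)\le\Delta_p^{-1/2}$. $\mathbf{DI}_p$ is the set of $p$-Dirichlet improvable numbers, i.e. of $\alpha\in\mathbb R$ with $d^{[p]}(\alpha)<\Delta_p^{-1/2}$. *)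

(* Defs.v *)
From mathcomp Require Import all_boot all_order all_algebra.
From mathcomp Require Import all_classical all_reals all_analysis.

Set Implicit Arguments.
Unset Strict Implicit.
Unset Printing Implicit Defensive.

Import Order.TTheory GRing.Theory Num.Theory.
Import numFieldNormedType.Exports.

Local Open Scope classical_set_scope.
Local Open Scope ring_scope.

Section HausdorffDimension.
Context {R : realType}.
Implicit Types (A U : set R) (s delta : R).

(* For [U = set0] this supremum is [-oo]; such [U] never contribute below. *)
Definition diam U : \bar R :=
  ereal_sup [set `|x - y|%:E | x in U & y in U].

(* Empty members of a cover are skipped in the sum, so that they cost 0 also
   when [s = 0], although [0 `^ 0 = 1]; finite covers are thus included. *)
Definition hausdorff_content s delta A : \bar R :=
  ereal_inf [set (\sum_(i <oo | U i != set0) (diam (U i) `^ s))%E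
            | U in [set U : (set R)^nat |
                     A `<=` \bigcup_i U i /\
                     forall i, (diam (U i) <= delta%:E)%E]].

Definition hausdorff_measure s A : \bar R :=
  ereal_sup [set hausdorff_content s delta A | delta in [set delta | 0 < delta]].

Definition hausdorff_dim A : \bar R :=
  ereal_inf [set s%:E | s in [set s | 0 <= s /\ hausdorff_measure s A = 0%E]].

End HausdorffDimension.

Section DirichletImprovable.
Context {R : realType}.
Implicit Types (p t alpha : R) (u v z : R * R) (L : set (R * R)).

Definition pnorm p z : R := (`|z.1| `^ p + `|z.2| `^ p) `^ p^-1.

Definition pball p : set (R * R) := [set z | pnorm p z <= 1].

Definition det2 u v : R := u.1 * v.2 - u.2 * v.1.

Definition lattice u v : set (R * R) :=
  [set z | exists m n : int, z = u *~ m + v *~ n].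

Definition admissible p L : Prop :=
  forall z, L z -> z != 0 -> ~ (interior (pball p)) z.

(* A full rank lattice is given by a basis [u, v]; its determinant
   [`|det2 u v|] does not depend on the basis. *)
Definition critical_det p : R :=
  inf [set d | exists u v, [/\ det2 u v != 0, admissible p (lattice u v)
                             & d = `|det2 u v|]].

Definition Lambda alpha t : set (R * R) :=
  [set z | exists q m : int,
     z = (t^-1 * q%:~R, t * (m%:~R - q%:~R * alpha))].

(* The infimum is a minimum for [0 < t], [Lambda alpha t] being discrete. *)
Definition lambda1 p alpha t : R :=
  inf [set pnorm p z | z in [set z | Lambda alpha t z /\ z != 0]].

Definition dirichlet_d p alpha : \bar R :=
  limf_esup (fun t => (lambda1 p alpha t)%:E) (pinfty_nbhs R).

Definition DI p : set R :=
  [set alpha | (dirichlet_d p alpha < (critical_det p `^ (- 2^-1))%:E)%E].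

End DirichletImprovable.

(* Main.v *)
Require Import Defs.
From mathcomp Require Import all_boot all_order all_algebra.
From mathcomp Require Import all_classical all_reals all_analysis.
From mathcomp Require Import ring lra zify.

Set Implicit Arguments.
Unset Strict Implicit.
Unset Printing Implicit Defensive.

Import Order.TTheory GRing.Theory Num.Theory.
Import numFieldNormedType.Exports.

(** Whether [alpha] lies in [DI 1] or [DI 2] is decided by integral binary
    quadratic forms [(a, b, c)], through [psi a b x = 2 a x + b]. The Euclidean
    minimum of [Lambda_alpha(t)] is nearly extremal exactly when the lattice is
    nearly hexagonal, i.e. when some form with [b^2 - 4 a c = -3] has its
    critical point near [alpha]: [psi a b alpha] near 0. The taxicab minimum is
    nearly extremal exactly when a lattice vector lies near the midpoint of a
    side of the extremal square, i.e. when for a form [(q x - p)^2] with [p, q]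
    coprime [psi a b alpha] is near [1] or [-1]. So [alpha] belongs to the difference
    of the two sets when it stays away, at relative scale [1 / a], from one
    family of targets and comes close to infinitely many targets of the other.

    Targets of a family are spaced, so the numbers that stay away from it carry
    a Cantor construction of dimension close to 1. To approach the other family
    as well, at sparse levels one inserts a prescribed pattern: around a
    rational [p / q] seen at the current scale, [alpha] is moved near
    [g theta], where [g] is unimodular and [theta] is a seed that avoids the
    first family but approaches the second one ([sqrt 3], resp. a number close
    to [sqrt 2 - 1] given by a Pell equation). Unimodular substitutions preserve
    both families and change [psi] only by a sign and a small error. Such
    insertions lose arbitrarily many levels, but not the dimension, because
    against a cover of small [s]-mass one first descends through generic levels
    until the mass of the cover in the current interval is negligible. *)

Local Open Scope ring_scope.

(** * Values of binary quadratic forms at quadratic irrationals *)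

(** The difficulty is to come near a target of one family without coming too near one of the other.
    Around a cusp [p / q] the substitution sends the seed to [p / q - 1 / (q ^ 2 z)]. Forms with [a]
    above [64 q ^ 2] see the seed up to an error [O(1 / z)], forms below the current height are
    controlled by induction, and the forms in between fill a number of dyadic ranges that does not
    depend on the level, so an integer shift of the seed can miss them all. For [q ^ 2] to be
    comparable with the current height the construction must keep away from rationals: square forms
    with [psi] near 0 are avoided in both halves of the theorem. A fixed quadratic irrational serves
    as seed for the hexagonal targets. It cannot serve for the targets [1] and [-1]: at a quadratic
    irrational of discriminant [D] the values of [psi] on square forms of growing height accumulate
    only at irrational numbers [2 k / sqrt D]. Hence the second seed depends on the required
    precision, and passes close to a target just once. *)

Definition square_form (a b c : int) : Prop :=
  exists q p : int, [/\ exists u v : int, u * q + v * p = 1,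
    a = q ^+ 2, b = - 2 * (q * p) & c = p ^+ 2].

Definition hex_form (a b c : int) : Prop := 0 < a /\ b ^+ 2 - 4 * a * c = - 3.

(** The derivative of [a x ^ 2 + b x + c]. It equals [t] at [(t - b) / (2 a)], so [psi - t] is [2 a]
    times the signed distance from [x] to that target. *)
Definition psi {R : numDomainType} (a b : int) (x : R) : R :=
  2 * a%:~R * x + b%:~R.

Lemma intr_ge1 (R : numDomainType) (k : int) : 0 < k -> 1 <= k%:~R :> R.
Proof. by move=> k0; rewrite ler1z -gtz0_ge1. Qed.

Lemma normr_or (R : realDomainType) (y : R) : `|y| = y \/ `|y| = - y.
Proof. by case: (ler0P y); [right|left]. Qed.

Lemma sqrt3P (R : rcfType) :
  [/\ 173 / 100 < Num.sqrt (3 : R), Num.sqrt (3 : R) < 1733 / 1000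
    & Num.sqrt (3 : R) ^+ 2 = 3].
Proof.
have h : Num.sqrt (3 : R) ^+ 2 = 3 by rewrite sqr_sqrtr //; lra.
have h0 : 0 <= Num.sqrt (3 : R) by rewrite sqrtr_ge0.
by split=> //; nra.
Qed.

Lemma sqrt2P (R : rcfType) :
  [/\ 1414 / 1000 < Num.sqrt (2 : R), Num.sqrt (2 : R) < 1415 / 1000
    & Num.sqrt (2 : R) ^+ 2 = 2].
Proof.
have h : Num.sqrt (2 : R) ^+ 2 = 2 by rewrite sqr_sqrtr //; lra.
have h0 : 0 <= Num.sqrt (2 : R) by rewrite sqrtr_ge0.
by split=> //; nra.
Qed.

Lemma sqr_prime_mul_sqr (d : nat) (p q : int) :
  prime d -> p ^+ 2 = d%:Z * q ^+ 2 -> q = 0.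
Proof.
move=> dp h; apply/eqP; rewrite -absz_eq0 -leqn0 leqNgt; apply/negP => q0.
have h' : (`|p| ^ 2 = d * `|q| ^ 2)%N by rewrite -!abszX h abszM absz_nat.
have d0 := prime_gt0 dp.
have := congr1 (logn d) h'; rewrite lognM ?expn_gt0 ?q0 // !lognX (logn_prime d dp) eqxx.
by move/(congr1 odd); rewrite oddD !oddM /=.
Qed.

(* Here [Q = q], [e = q sqrt 3 - p] and [k = p ^ 2 - 3 q ^ 2]. *)
Lemma sqrt3_quotient (R : realFieldType) (r Q y e : R) (k : int) :
  173 / 100 < r -> r < 1733 / 1000 -> 2 <= Q -> k != 0 ->
  y = 2 * Q * e -> y * (2 * Q * r - e) = - 2 * Q * k%:~R ->
  `|y| <= 105 / 100 -> 55 / 100 <= `|y| <= 61 / 100.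
Proof.
move=> r1 r2 Q2 k0 ye Hy y1.
have Q0 : 0 < Q by clear -Q2; lra.
have He : `|e| * Q <= 53 / 100.
  by move: y1; rewrite ye !normrM (gtr0_norm Q0) gtr0_norm //; clear; lra.
have e27 : `|e| <= 27 / 100.
  by clear -He Q2; have := normr_ge0 e; nra.
move: e27; rewrite ler_norml => /andP[e1 e2].
set D := _ - e in Hy.
have D1 : D <= 361 / 100 * Q by rewrite /D; clear -r2 e1 Q2; nra.
have D2 : 332 / 100 * Q <= D by rewrite /D; clear -r1 e2 Q2; nra.
have D0 : 0 < D by clear -D2 Q0; lra.
have Hy' : `|y| * D = 2 * Q * `|k%:~R|.
  by rewrite -{1}(gtr0_norm D0) -normrM Hy !normrM normrN (gtr0_norm Q0) (gtr0_norm (_ : 0 < 2)).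
clear Hy He ye; move: (`|y|) (normr_ge0 y) y1 Hy' => z z0 z1 Hz.
have y1 : 2 * `|k%:~R| <= z * (361/100) by clear -Hz z0 D1 Q0; nra.
have y2 : z * (332/100) <= 2 * `|k%:~R| by clear -Hz z0 D2 Q0; nra.
have kk : `|k| = 1 \/ 2 <= `|k| by clear -k0; lia.
have ky : `|k%:~R : R| = (`|k|)%:~R by rewrite intr_norm.
rewrite ky in y1 y2; case: kk => [k1|k2].
- by rewrite k1 in y1 y2; clear -y1 y2; lra.
- have kR : 2%:~R <= `|k|%:~R :> R by rewrite ler_int.
  by clear -kR y1 z1; lra.
Qed.

(** With the nonzero integer [k = p ^ 2 - 3 q ^ 2], [|psi|] is about [2 |k| / (2 sqrt 3)]: near 0.58
    when [|k| = 1], near 1.15 or more otherwise, hence away from 0 and 1. *)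
Lemma sqrt3_square_form (R : rcfType) (a b c t : int) :
  square_form a b c -> 0 < a -> `|t| <= 1 ->
  1 / 20 <= `|psi a b (Num.sqrt (3 : R)) - t%:~R|.
Proof.
move=> [q0 [p0 [_ -> -> _]]] q2 t1.
have [q [p [qgt0 ->]]] : exists q p : int, 0 < q /\
    psi (q0 ^+ 2) (- 2 * (q0 * p0)) (Num.sqrt (3 : R)) =
    2 * q%:~R * (q%:~R * Num.sqrt 3 - p%:~R).
  have [qp|qn|qe] := ltgtP q0 0.
  - by exists (- q0), (- p0); split; [lia|rewrite /psi; ring].
  - by exists q0, p0; split; [lia|rewrite /psi; ring].
  - by rewrite qe in q2.
have [r1 r2 r3] := sqrt3P R; set r := Num.sqrt 3 in r1 r2 r3 *.
have He : 2 * q%:~R * (q%:~R * r - p%:~R) * (2 * q%:~R * r - (q%:~R * r - p%:~R)) =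
    - 2 * q%:~R * (p ^+ 2 - 3 * q ^+ 2)%:~R :> R by ring: r3.
have k0 : p ^+ 2 - 3 * q ^+ 2 != 0.
  apply/eqP => /eqP; rewrite subr_eq0 => /eqP kk.
  by have := @sqr_prime_mul_sqr 3 p q isT kk; clear -qgt0; lia.
rewrite leNgt; apply/negP => H.
have t' : `|t%:~R : R| = 0 \/ `|t%:~R : R| = 1.
  have : t = 0 \/ t = 1 \/ t = -1 by clear -t1; lia.
  by move=> [->|[->|->]]; rewrite ?normr0 ?normr1 ?normrN1; [left|right|right].
have D1 := ler_dist_dist (2 * q%:~R * (q%:~R * r - p%:~R)) (t%:~R : R).
have D2 := le_lt_trans D1 H.
have D3 : `|2 * q%:~R * (q%:~R * r - p%:~R)| <= 105 / 100.
  move: D2; clear -t'; rewrite ltr_norml => /andP[_ h].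
  by case: t' h => ->; clear; lra.
(* The quotient estimate needs [q >= 2]. For [q = 1] the bound on [psi] leaves only [p = 2], where
   [psi = 2 (sqrt 3 - 2)]. *)
have [q1|qn1] := eqVneq q 1.
  rewrite q1 in D2 D3; clear He H D1.
  have p2 : p = 2.
    move: D3; rewrite ler_norml => /andP[h1 h2].
    have p1 : (p%:~R : R) < 3%:~R by clear -h1 r2; lra.
    have p3 : (1%:~R : R) < (p%:~R : R) by clear -h2 r1; lra.
    by move: p1 p3; rewrite !ltr_int; clear; lia.
  rewrite p2 in D2; move: D2; rewrite (ltr0_norm (_ : 2 * 1%:~R * (1%:~R * r - 2%:~R) < 0)); last first.
    by clear -r2; lra.
  rewrite ltr_norml => /andP[h1 h2].
  by case: t' h1 h2 => ->; clear -r1 r2; lra.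
have q2R : 2 <= q%:~R :> R by rewrite (ler_int _ 2); clear -qgt0 qn1; lia.
have /andP[] := sqrt3_quotient r1 r2 q2R k0 erefl He D3.
clear -t' D2.
move: D2; rewrite ltr_norml => /andP[h1 h2].
by case: t' h1 h2 => ->; clear; lra.
Qed.

(** * Action of unimodular substitutions on forms *)

Definition form_at {R : pzRingType} (a b c : int) (x : R) : R :=
  a%:~R * x ^+ 2 + b%:~R * x + c%:~R.

(** Coefficients of the form composed with [x -> (P x + P') / (Q x + Q')]: the outer ones are [actA]
    at [(P, Q)] and at [(P', Q')], the middle one is [actB]. *)
Definition actA (a b c P Q : int) : int := a * P ^+ 2 + b * (P * Q) + c * Q ^+ 2.
Definition actB (a b c P P' Q Q' : int) : int :=
  2 * a * (P * P') + b * (P * Q' + P' * Q) + 2 * c * (Q * Q').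

(** This is the derivative in [x] of the identity [form'(x) = s ^ 2 form(y)], as the derivative of
    [y] is the determinant divided by [s ^ 2]. *)
Lemma psi_act (R : numFieldType) (a b c P P' Q Q' : int) (x : R) :
  let s := Q%:~R * x + Q'%:~R in let y := (P%:~R * x + P'%:~R) / s in
  s != 0 ->
  psi (actA a b c P Q) (actB a b c P P' Q Q') x =
    (P * Q' - P' * Q)%:~R * psi a b y + 2 * Q%:~R * s * form_at a b c y.
Proof. by move=> s y s0; rewrite /psi /actA /actB /form_at /y; move: s0; rewrite /s => s0; field. Qed.

Lemma form_at_act (R : numFieldType) (a b c P P' Q Q' : int) (x : R) :
  let s := Q%:~R * x + Q'%:~R in let y := (P%:~R * x + P'%:~R) / s in
  s != 0 ->
  form_at (actA a b c P Q) (actB a b c P P' Q Q') (actA a b c P' Q') x =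
    s ^+ 2 * form_at a b c y.
Proof. by move=> s y s0; rewrite /actA /actB /form_at /y; move: s0; rewrite /s => s0; field. Qed.

Lemma psi_disc (R : comPzRingType) (a b c : int) (x : R) :
  4 * a%:~R * form_at a b c x =
  (2 * a%:~R * x + b%:~R) ^+ 2 - (b ^+ 2 - 4 * a * c)%:~R.
Proof. by rewrite /form_at; ring. Qed.

Lemma square_form_act (a b c P P' Q Q' : int) :
  (P * Q' - P' * Q) ^+ 2 = 1 -> square_form a b c ->
  square_form (actA a b c P Q) (actB a b c P P' Q Q') (actA a b c P' Q').
Proof.
move=> d [q [p [[u [v uv]] -> -> ->]]].
exists (q * P - p * Q), (p * Q' - q * P'); rewrite /actA /actB; split; try ring.
exists ((P * Q' - P' * Q) * (u * Q' + v * P')), ((P * Q' - P' * Q) * (u * Q + v * P)).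
transitivity ((P * Q' - P' * Q) ^+ 2 * (u * q + v * p)); first by ring.
by rewrite d uv mulr1.
Qed.

Lemma hex_form_act (a b c P P' Q Q' : int) :
  (P * Q' - P' * Q) ^+ 2 = 1 -> hex_form a b c ->
  hex_form (actA a b c P Q) (actB a b c P P' Q Q') (actA a b c P' Q').
Proof.
move=> d [a0 disc]; split; last first.
  transitivity ((P * Q' - P' * Q) ^+ 2 * (b ^+ 2 - 4 * a * c)).
    by rewrite /actA /actB; ring.
  by rewrite d disc mul1r.
have h : 4 * a * actA a b c P Q = (2 * a * P + b * Q) ^+ 2 + 3 * Q ^+ 2.
  rewrite -[3]opprK -disc /actA; ring.
have PQ : 0 < (2 * a * P + b * Q) ^+ 2 + 3 * Q ^+ 2.
  have [Q0|Q0] := eqVneq Q 0.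
    have P0 : P != 0 by apply/eqP => P0; rewrite Q0 P0 in d; move: d; clear; lia.
    have -> : (2 * a * P + b * Q) ^+ 2 + 3 * Q ^+ 2 = (2 * a * P) ^+ 2 by rewrite Q0; ring.
    rewrite exprn_even_gt0 //=.
    by rewrite mulf_eq0 negb_or P0 mulf_eq0 negb_or /= gt_eqF.
  by rewrite ltr_wpDl ?sqr_ge0 // mulr_gt0 // exprn_even_gt0.
rewrite -h in PQ; rewrite -(pmulr_rgt0 _ (_ : 0 < 4 * a)) //; clear -a0; lia.
Qed.

(** * Pell equations and the two seeds *)

Lemma pell3 (m : nat) : exists a b : int,
  [/\ 0 < b, m%:Z < a & 4 * a ^+ 2 - 3 * b ^+ 2 = 1].
Proof.
elim: m => [|m [a [b [b0 ma e]]]]; first by exists 1, 1.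
(* Multiplication of [2 a + b sqrt 3] by the unit [7 + 4 sqrt 3]. *)
exists (7 * a + 6 * b), (8 * a + 7 * b); split.
- by clear -b0 ma; lia.
- by clear -b0 ma; lia.
- by rewrite -[RHS]e; ring.
Qed.

Lemma sqrt3_hex_form (R : rcfType) (m : nat) : exists a b c : int,
  [/\ hex_form a b c, m%:Z < a & `|psi a b (Num.sqrt (3 : R))| * m.+1%:R <= 1].
Proof.
have [a [b [b0 ma e]]] := pell3 m.
have [r1 r2 r3] := sqrt3P R; set r := Num.sqrt 3 in r1 r2 r3 *.
(* The Pell equation is the discriminant condition for this form, and makes the product of
   [psi = 2 a sqrt 3 - 3 b] with its conjugate equal to 3. *)
exists a, (- 3 * b), (3 * a); split => //.
  split; first by clear -ma; lia.
  transitivity (- 3 * (4 * a ^+ 2 - 3 * b ^+ 2)); first by ring.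
  by rewrite e mulr1.
have h : psi a (- 3 * b) r * (2 * a%:~R * r + 3 * b%:~R) = 3.
  transitivity (3 * (4 * a ^+ 2 - 3 * b ^+ 2)%:~R : R); last by rewrite e; ring.
  by rewrite /psi; ring: r3.
have bR := intr_ge1 R b0.
have aR : m.+1%:R <= a%:~R :> R.
  by rewrite -[m.+1%:R]/(m.+1%:Z%:~R) ler_int; clear -ma; lia.
have m0 : 1 <= m.+1%:R :> R by rewrite ler1n.
move: (psi _ _ _) h => y h.
have D : 3 * m.+1%:R <= 2 * a%:~R * r + 3 * b%:~R by clear -r1 bR aR m0; nra.
have y0 : 0 < y.
  by rewrite -(pmulr_lgt0 _ (_ : 0 < 2 * a%:~R * r + 3 * b%:~R)) ?h //; clear -D m0; lra.
by rewrite gtr0_norm //; clear -D y0 h; nra.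
Qed.

(** Consecutive Pell numbers: each step multiplies [(q - p) + p sqrt 2], of norm [1] or [-1], by
    [1 + sqrt 2]. Starting at [(12, 29)] leaves room for the later numerical estimates. *)
Lemma pell2 (m : nat) : exists p q : int,
  [/\ 12 <= p, m%:Z < p, 2 * p <= q & `|q ^+ 2 - 2 * q * p - p ^+ 2| = 1].
Proof.
elim: m => [|m [p [q [p12 mp pq e]]]]; first by exists 12, 29.
exists q, (2 * q + p); split.
- by clear -p12 pq; lia.
- by clear -p12 pq mp; lia.
- by clear -p12 pq; lia.
- by rewrite -[RHS]e -[RHS]normrN; congr `| _ |; ring.
Qed.

(** Up to a factor, [a + c - sqrt 2 b] is the polar pairing of the form with
    [x ^ 2 + 2 sqrt 2 x + 1], whose roots are [1 - sqrt 2] and [-1 - sqrt 2]. Its product with the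
    conjugate is [A ^ 2 - B ^ 2], nonzero because [sqrt 2] is irrational. *)
Lemma sqrt2_square_form (R : rcfType) (a b c : int) : square_form a b c ->
  2 / 5 <= `|a%:~R + c%:~R - Num.sqrt (2 : R) * b%:~R|.
Proof.
move=> [q [p [[u [v uv]] -> -> ->]]].
have [r1 r2 r3] := sqrt2P R; set r := Num.sqrt 2 in r1 r2 r3 *.
pose A := q ^+ 2 - p ^+ 2; pose B := 2 * q * p.
have AB : `|A| != `|B|.
  apply/eqP => /eqP; rewrite eqr_norm2 => h.
  have [z1 z2] : q = 0 /\ p = 0.
    case/orP: h => /eqP h.
      have e : (q - p) ^+ 2 = 2 * p ^+ 2 by rewrite /A /B in h; clear -h; lia.
      have p0 := @sqr_prime_mul_sqr 2 _ _ isT e.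
      by move: e; rewrite p0; split => //; clear -e; nia.
    have e : (q + p) ^+ 2 = 2 * p ^+ 2 by rewrite /A /B in h; clear -h; lia.
    have p0 := @sqr_prime_mul_sqr 2 _ _ isT e.
    by move: e; rewrite p0; split => //; clear -e; nia.
  by rewrite z1 z2 !mulr0 in uv.
set S : R := q%:~R ^+ 2 + p%:~R ^+ 2.
have -> : (q ^+ 2)%:~R + (p ^+ 2)%:~R - r * (- 2 * (q * p))%:~R = S + r * B%:~R.
  by rewrite /S /B; ring.
have hS : S ^+ 2 = `|A%:~R| ^+ 2 + `|B%:~R| ^+ 2.
  by rewrite !real_normK ?num_real // /S /A /B; ring.
have S0 : 0 <= S by rewrite addr_ge0 ?sqr_ge0.
have key : 2 / 5 <= `|S - r * `|B%:~R| |.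
  have d1 : 1 <= `| `|A%:~R| - `|B%:~R| | :> R.
    rewrite -!intr_norm -rmorphB /= -intr_norm intr_ge1 // normr_gt0 subr_eq0 //.
  have x0 := normr_ge0 (A%:~R : R); have y0 := normr_ge0 (B%:~R : R).
  move: (`|A%:~R| : R) (`|B%:~R| : R) x0 y0 hS d1 => x y x0 y0 hS d1.
  clearbody S; clear -d1 hS x0 y0 r1 r2 r3 S0.
  have xy : 1 <= x + y.
    by apply: le_trans d1 _; rewrite ler_norml; apply/andP; split; lra.
  have Sxy : S <= x + y by nra.
  have e : (S - r * y) * (S + r * y) = (x - y) * (x + y).
    by rewrite -[RHS]/((x - y) * (x + y)); ring: hS r3.
  have e' : `|S - r * y| * (S + r * y) = `|x - y| * (x + y).
    have S1 : 0 <= S + r * y by nra.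
    have S2 : 0 <= x + y by lra.
    by rewrite -{1}(ger0_norm S1) -{1}(ger0_norm S2) -!normrM e normrM (ger0_norm S2).
  move: (`|_|) (`|_|) (normr_ge0 (S - r * y)) d1 e' => z w z0 w1 e'.
  have b1 : S + r * y <= 5 / 2 * (x + y) by nra.
  have b2 : x + y <= z * (5 / 2 * (x + y)) by nra.
  have b3 : 0 < x + y by lra.
  by rewrite -(ler_pM2r b3); nra.
case: (lerP 0 (B%:~R : R)) => B0; last first.
  by move: key; rewrite (ltr0_norm B0) mulrN opprK.
move: key; rewrite (ger0_norm B0) => _.
have S1 : 1 <= S.
  have : 0 < q ^+ 2 + p ^+ 2.
    have [q0|q0] := eqVneq q 0.
      have p0 : p != 0 by apply/eqP => p0; rewrite q0 p0 !mulr0 in uv.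
      by rewrite q0 expr0n add0r exprn_even_gt0.
    by rewrite ltr_pwDl ?sqr_ge0 // exprn_even_gt0.
  by move/(intr_ge1 R); rewrite rmorphD /= !rmorphXn.
clearbody S; clear -S1 B0 r1.
by rewrite ger0_norm; nra.
Qed.

Lemma hex_form_odd (a b c : int) : hex_form a b c ->
  [/\ exists k, a = 2 * k + 1, exists k, b = 2 * k + 1 & exists k, c = 2 * k + 1].
Proof.
move=> [_ disc].
have [k hk] : exists k, b = 2 * k + 1.
  exists ((b - 1) %/ 2)%Z; have : (b %% 2 = 1)%Z by clear -disc; nia.
  by clear; lia.
have h2 : 4 * (a * c) = (2 * k + 1) ^+ 2 + 3 by rewrite -hk; clear -disc; lia.
have e1 : a * c = k * (k + 1) + 1 by clear -h2; lia.
have e2 : exists j, k * (k + 1) = 2 * j.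
  have [k' [->|->]] : exists k', k = 2 * k' \/ k = 2 * k' + 1.
    by exists (k %/ 2)%Z; clear; lia.
  - by exists (k' * (2 * k' + 1)); ring.
  - by exists ((2 * k' + 1) * (k' + 1)); ring.
have [a' Ha] : exists a', a = 2 * a' \/ a = 2 * a' + 1.
  by exists (a %/ 2)%Z; clear; lia.
have [c' Hc] : exists c', c = 2 * c' \/ c = 2 * c' + 1.
  by exists (c %/ 2)%Z; clear; lia.
case: e2 e1 => j -> e1.
have {}Ha : a = 2 * a' + 1 by case: Ha => // Ha; rewrite Ha in e1; clear -e1; lia.
have {}Hc : c = 2 * c' + 1 by case: Hc => // Hc; rewrite Hc in e1; clear -e1; lia.
by split; [exists a'|exists k|exists c'].
Qed.

(** The critical point of the form stays off the geodesic from [1 - sqrt 2] to [-1 - sqrt 2]. The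
    product with the conjugate is [(a - c) ^ 2 - b ^ 2 + 3]; since [a - c] is even and [b] odd,
    [|a - c|] differs from [b] by at least 1, which makes this product at least of the order of
    [b]. *)
Lemma sqrt2_hex_form (R : rcfType) (a b c : int) : hex_form a b c ->
  1 / 5 <= `|a%:~R + c%:~R - Num.sqrt (2 : R) * b%:~R|.
Proof.
move=> [a0 disc].
have [r1 r2 r3] := sqrt2P R; set r := Num.sqrt 2 in r1 r2 r3 *.
have c0 : 0 < c by clear -a0 disc; nia.
have aR := intr_ge1 R a0; have cR := intr_ge1 R c0.
have [b0|b0] := lerP b 0.
  have bR : b%:~R <= 0 :> R by rewrite lerz0.
  by clear -aR cR bR r1; rewrite ger0_norm; nra.
have [a_odd b_odd c_odd] := hex_form_odd (conj a0 disc).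
set S : R := a%:~R + c%:~R.
have hS : S ^+ 2 = (a - c)%:~R ^+ 2 + b%:~R ^+ 2 + 3.
  transitivity (((a - c) ^+ 2 + b ^+ 2 - (b ^+ 2 - 4 * a * c))%:~R : R).
    by rewrite /S; ring.
  by rewrite disc; ring.
have D : b + 1 <= `|a - c| \/ `|a - c| <= b - 1.
  have ne : `|a - c| != b.
    apply/eqP => h; case: a_odd b_odd c_odd => k hk [l hl] [n hn].
    by move: h; rewrite hk hl hn; clear; lia.
  by clear -ne; lia.
have S0 : 2 <= S by rewrite /S; clear -aR cR; lra.
have [b1|b1] := eqVneq b 1.
  have -> : S = 2.
    rewrite b1 in disc.
    have a1 : a = 1 by clear -a0 c0 disc; nia.
    have c1 : c = 1 by clear -a0 c0 disc; nia.
    by rewrite /S a1 c1.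
  by rewrite b1 ger0_norm; clear -r1 r2; lra.
have b3 : 3 <= b%:~R :> R.
  by rewrite (ler_int _ 3); case: b_odd => k hk; clear -b0 b1 hk; lia.
have hd : (a - c)%:~R ^+ 2 = (`|a - c|)%:~R ^+ 2 :> R by rewrite intr_norm real_normK ?num_real.
rewrite hd in hS.
have e : (S - r * b%:~R) * (S + r * b%:~R) =
   `|a - c|%:~R ^+ 2 - b%:~R ^+ 2 + 3 by ring: hS r3.
have dR : 0 <= `|a - c|%:~R :> R by rewrite ler0z.
have DR : b%:~R + 1 <= `|a - c|%:~R :> R \/ `|a - c|%:~R <= b%:~R - 1 :> R.
  case: D => D; [left|right]; move: D; rewrite -(ler_int R).
    by rewrite rmorphD.
  by rewrite rmorphB.
move: (b%:~R : R) (`|a - c|%:~R : R) b3 e dR DR hS => y d b3 e dR DR hS.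
clearbody S r; clear -r1 r2 r3 S0 b3 e dR DR.
rewrite leNgt; apply/negP; rewrite ltr_norml => /andP[h1 h2].
have S1 : S + r * y <= 283 / 100 * y + 1 / 5 by nra.
have S2 : 0 < S + r * y by nra.
case: DR => DR.
  have e1 : 2 * y + 4 <= d ^+ 2 - y ^+ 2 + 3 by nra.
  rewrite -e in e1.
  have : (S - r * y) * (S + r * y) <= 1 / 5 * (S + r * y) by rewrite ler_pM2r // ltW.
  lra.
have e1 : d ^+ 2 - y ^+ 2 + 3 <= - (2 * y - 4) by nra.
rewrite -e in e1.
have : - (1 / 5) * (S + r * y) < (S - r * y) * (S + r * y) by rewrite ltr_pM2r.
lra.
Qed.

Lemma square_form_disc (a b c : int) : square_form a b c -> b ^+ 2 - 4 * a * c = 0.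
Proof. by move=> [q [p [_ -> -> ->]]]; ring. Qed.

(** For small [a] the value of the form at the seed is not negligible, and a direct check replaces
    the general argument. Oddness matters: for [a = 6] the number [2 a x] may equal 5. *)
Lemma small_odd_far (R : realFieldType) (a b : int) (x : R) :
  (exists k, a = 2 * k + 1) -> 0 < a -> a < 10 ->
  41 / 100 <= x -> x <= 42 / 100 -> 1 / 10 <= `|psi a b x|.
Proof.
move=> [k ha] a0 a10 x1 x2; rewrite leNgt; apply/negP.
rewrite /psi ltr_norml => /andP[h1 h2].
have nb (z : int) : (z%:~R : R) < b%:~R -> (b%:~R : R) < (z + 1)%:~R -> False.
  by rewrite !ltr_int; clear; lia.
have : a = 1 \/ a = 3 \/ a = 5 \/ a = 7 \/ a = 9 by clear -ha a0 a10; lia.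
move=> [|[|[|[|]]]] ea; rewrite ea in h1 h2.
- by apply: (nb (-1)); clear -h1 h2 x1 x2; lra.
- by apply: (nb (-3)); clear -h1 h2 x1 x2; lra.
- by apply: (nb (-5)); clear -h1 h2 x1 x2; lra.
- by apply: (nb (-6)); clear -h1 h2 x1 x2; lra.
- by apply: (nb (-8)); clear -h1 h2 x1 x2; lra.
Qed.

(* [1 - sqrt 2] and [-1 - sqrt 2] are the endpoints of the geodesic along which
   the l1-critical lattice of parameter [sqrt 2] flows. *)
Lemma heteroclinic_psi (R : rcfType) (p q a b c : int) :
  let r := Num.sqrt (2 : R) in let x := 1 - r in
  let s := p%:~R * x + q%:~R in
  let y := ((q - 2 * p)%:~R * x + p%:~R) / s in
  let a' := actA a b c (q - 2 * p) p in
  let b' := actB a b c (q - 2 * p) p p q in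
  let c' := actA a b c p q in
  s != 0 ->
  (q ^+ 2 - 2 * q * p - p ^+ 2)%:~R * psi a b y =
  - (a'%:~R + c'%:~R - r * b'%:~R) + s * (s - 2 * p%:~R) * form_at a b c y.
Proof.
move=> r x s y a' b' c' s0.
have [_ _ r3] := sqrt2P R; rewrite -/r in r3.
have h1 := psi_act a b c (q - 2 * p) p s0.
have h2 := form_at_act a b c (q - 2 * p) p s0.
have h3 : psi a' b' x - form_at a' b' c' x = - (a'%:~R + c'%:~R - r * b'%:~R).
  by rewrite /psi /form_at /x; ring: r3.
rewrite -h3 h1 h2 -/y.
have -> : (q - 2 * p) * q - p * p = q ^+ 2 - 2 * q * p - p ^+ 2 by ring.
move: (psi a b y) (form_at a b c y) => u v; rewrite -/s; clearbody s; ring.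
Qed.

(** [s - 2 p] is the conjugate [(q - p) - p sqrt 2] of a unit of size comparable with [s], so it is
    of order [1 / s]. *)
Lemma pell2_real (R : rcfType) (p q : int) :
  let r := Num.sqrt (2 : R) in
  let s := p%:~R * (1 - r) + q%:~R in
  12 <= p -> 2 * p <= q -> `|q ^+ 2 - 2 * q * p - p ^+ 2| = 1 ->
  [/\ (158 / 100) * p%:~R <= s, `|s * (s - 2 * p%:~R)| <= 1 & `|s - 2 * p%:~R| <= 1].
Proof.
move=> r s p12 pq e.
have [r1 r2 r3] := sqrt2P R; rewrite -/r in r1 r2 r3.
have pR : 12 <= p%:~R :> R by rewrite (ler_int _ 12).
have qR : 2 * p%:~R <= q%:~R :> R by rewrite -(intrM _ 2) ler_int.
have s1 : 158 / 100 * p%:~R <= s by rewrite /s; clear -pR qR r2; nra.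
have h : (s - 2 * p%:~R) * (q%:~R + (r - 1) * p%:~R) =
   (q ^+ 2 - 2 * q * p - p ^+ 2)%:~R by rewrite /s; ring: r3.
have sq : s <= q%:~R + (r - 1) * p%:~R by rewrite /s; clear -pR r1; nra.
have h' : `|s - 2 * p%:~R| * (q%:~R + (r - 1) * p%:~R) = 1.
  have T0 : 0 < q%:~R + (r - 1) * p%:~R by clear -sq s1 pR; lra.
  by rewrite -{1}(gtr0_norm T0) -normrM h -intr_norm e.
have s0 : 0 < s by clear -s1 pR; lra.
split => //.
  have := ler_wpM2l (normr_ge0 (s - 2 * p%:~R)) sq.
  by rewrite h' normrM (gtr0_norm s0) mulrC.
move: (normr_ge0 (s - 2 * p%:~R)) h'; move: (`|_|) => z z0 h'.
by clear -z0 h' sq s1 pR; nra.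
Qed.

(** The seed is the image of [1 - sqrt 2] under the matrix with rows [(q - 2 p, p)] and [(p, q)]. By
    the heteroclinic identity, the polar pairing of the transformed form is at most [|psi| + |form|]
    at the seed; where [psi] is small so is the form, once [a] is large, and the lower bounds on the
    pairing apply. The approached target comes from the square form that vanishes at the image of
    infinity: there [|psi| = 2 p / s], with [s] close to [2 p]. *)
Lemma sqrt2_theta (R : rcfType) (m : nat) : exists x : R,
  [/\ 41 / 100 <= x <= 42 / 100,
    forall a b c : int, hex_form a b c -> 1 / 10 <= `|psi a b x|,
    forall a b c : int, square_form a b c -> 0 < a -> 1 / 10 <= `|psi a b x| &
    exists a b c t : int, [/\ square_form a b c, m%:Z < a, `|t| = 1 &
      `|psi a b x - t%:~R| * m.+1%:R <= 1]].
Proof.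
have [p [q [p12 mp pq e]]] := pell2 m.
have [s1 s2 s3] := pell2_real R p12 pq e.
have [r1 r2 r3] := sqrt2P R.
set r := Num.sqrt 2 in s1 s2 s3 r1 r2 r3.
set s := _ + _ in s1 s2 s3.
have pR : 12 <= p%:~R :> R by rewrite (ler_int _ 12).
have qR : 2 * p%:~R <= q%:~R :> R by rewrite -(intrM _ 2) ler_int.
have s0 : s != 0 by apply/eqP => z; rewrite z in s1; clear -s1 pR; lra.
have sp : 0 < s by clear -s1 pR; lra.
pose y := ((q - 2 * p)%:~R * (1 - r) + p%:~R) / s.
have key a b c := @heteroclinic_psi R p q a b c s0.
have det2 : ((q - 2 * p) * q - p * p) ^+ 2 = 1.
  have -> : (q - 2 * p) * q - p * p = q ^+ 2 - 2 * q * p - p ^+ 2 by ring.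
  by rewrite -[LHS]real_normK ?num_real // e expr1n.
have key' a b c : `|psi a b y| =
   `| - ((actA a b c (q - 2 * p) p)%:~R + (actA a b c p q)%:~R
      - r * (actB a b c (q - 2 * p) p p q)%:~R) +
     s * (s - 2 * p%:~R) * form_at a b c y|.
  by rewrite -key normrM -intr_norm e mul1r.
have far a b c : `|(actA a b c (q - 2 * p) p)%:~R + (actA a b c p q)%:~R
      - r * (actB a b c (q - 2 * p) p p q)%:~R| <= `|psi a b y| + `|form_at a b c y|.
  rewrite (key' a b c); move: (_ - _ * _) => E.
  apply: (@le_trans _ _ (`|- E + s * (s - 2 * p%:~R) * form_at a b c y| +
     `|s * (s - 2 * p%:~R) * form_at a b c y|)).
    have := ler_normB (- E + s * (s - 2 * p%:~R) * form_at a b c y)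
      (s * (s - 2 * p%:~R) * form_at a b c y).
    by rewrite addrK normrN.
  by rewrite lerD2l [leLHS]normrM ler_piMl.
have y_rng : 41 / 100 <= y <= 42 / 100.
  have rng : `|y - (r - 1)| <= 3 / 1000.
    have e1 : (y - (r - 1)) * (s * (p%:~R * (r - 1) + q%:~R)) =
       - 2 * (r - 1) * (q ^+ 2 - 2 * q * p - p ^+ 2)%:~R.
      rewrite /y mulrA mulrBl divfK //; rewrite /s; ring: r3.
    have T0 : 158 / 100 * 12 * 24 <= s * (p%:~R * (r - 1) + q%:~R).
      clear -s1 pR qR r1; have : 18 <= s by lra.
      have : 24 <= p%:~R * (r - 1) + q%:~R by nra.
      nra.
    have T1 : 0 < s * (p%:~R * (r - 1) + q%:~R) by clear -T0; lra.
    have r10 : 0 < r - 1 by clear -r1; lra.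
    have e2 : `|y - (r - 1)| * (s * (p%:~R * (r - 1) + q%:~R)) = 2 * (r - 1).
      rewrite -{1}(gtr0_norm T1) -normrM e1 !normrM normrN -intr_norm e mulr1.
      by rewrite (gtr0_norm r10) gtr0_norm.
    move: (normr_ge0 (y - (r - 1))) e2; move: (`|_|) => z z0 e2.
    by clear -z0 e2 T0 r2; nra.
  move: rng; rewrite ler_norml; clear -r1 r2 => /andP[h1 h2].
  by apply/andP; split; lra.
exists y; split => //.
- move=> a b c hf; rewrite leNgt; apply/negP => small.
  have := sqrt2_hex_form R (hex_form_act det2 hf); rewrite -/r => H.
  have {}H := le_trans H (far a b c).
  have [a_odd _ _] := hex_form_odd hf; have [a0 disc] := hf.
  (* From [a = 10] on, a [psi] below [1 / 10] makes the form at most [(1 / 100 + 3) / 40], which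
     leaves more than [1 / 10] of the bound [1 / 5]. *)
  have [a10|a10] := ltP a 10.
    suff : 1 / 10 <= `|psi a b y| by rewrite leNgt small.
    case/andP: y_rng => y1 y2.
    exact: small_odd_far.
  have := psi_disc a b c y; rewrite disc -/(psi a b y) => D.
  have aR : 10 <= a%:~R :> R by rewrite (ler_int _ 10).
  have D2 : psi a b y ^+ 2 = `|psi a b y| ^+ 2 by rewrite real_normK ?num_real.
  rewrite D2 {D2} in D.
  move: (`|psi a b y|) (normr_ge0 (psi a b y)) small H D => u u0 small H D.
  move: (form_at a b c y) H D => v H D.
  have v0 : 0 <= v.
    rewrite -(pmulr_rge0 _ (_ : 0 < 4 * a%:~R)) ?D; clear -aR u0; nra.
  rewrite (ger0_norm v0) in H; clear -u0 small H D aR v0; nra.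
- move=> a b c hf a0; rewrite leNgt; apply/negP => small.
  have := sqrt2_square_form R (square_form_act det2 hf); rewrite -/r => H.
  have {}H := le_trans H (far a b c).
  have disc := square_form_disc hf.
  have := psi_disc a b c y; rewrite disc -/(psi a b y) => D.
  have aR := intr_ge1 R a0.
  have D2 : psi a b y ^+ 2 = `|psi a b y| ^+ 2 by rewrite real_normK ?num_real.
  rewrite D2 {D2} in D.
  move: (`|psi a b y|) (normr_ge0 (psi a b y)) small H D => u u0 small H D.
  move: (form_at a b c y) H D => v H D.
  have v0 : 0 <= v.
    rewrite -(pmulr_rge0 _ (_ : 0 < 4 * a%:~R)) ?D; clear -aR u0; nra.
  rewrite (ger0_norm v0) in H; clear -u0 small H D aR v0; nra.
- pose sg := q ^+ 2 - 2 * q * p - p ^+ 2.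
  have sg2 : sg ^+ 2 = 1 by rewrite -[LHS]real_normK ?num_real // e expr1n.
  exists (p ^+ 2), (- 2 * (p * (q - 2 * p))), ((q - 2 * p) ^+ 2), (- sg); split.
  + exists p, (q - 2 * p); split => //; exists (- sg * p), (sg * q).
    by rewrite -[RHS]sg2 /sg; ring.
  + by clear -p12 mp; nia.
  + by rewrite normrN.
  + have -> : psi (p ^+ 2) (- 2 * (p * (q - 2 * p))) y = - 2 * p%:~R * sg%:~R / s.
      by rewrite /psi /y /sg; move: s0; rewrite /s => s0; field.
    have -> : - 2 * p%:~R * sg%:~R / s - (- sg)%:~R = sg%:~R * (s - 2 * p%:~R) / s.
      by field.
    rewrite !normrM -intr_norm e mul1r normfV (gtr0_norm sp).
    rewrite mulrAC ler_pdivrMr // mul1r.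
    have mR : m.+1%:R <= p%:~R :> R.
      by rewrite -[m.+1%:R]/(m.+1%:Z%:~R) ler_int; clear -mp; lia.
    have m0 : 0 <= m.+1%:R :> R by rewrite ler0n.
    move: (`|_|) (normr_ge0 (s - 2 * p%:~R)) s3 => z z0 z1.
    by clear -z0 z1 mR m0 s1 pR; nra.
Qed.

(** * Spacing of the targets, and transfer under unimodular substitutions *)

(** What the transfer lemmas use of either family. With the sign of the discriminant, the last
    clause leaves the constant form 1, the square form attached to infinity, as the only member with
    [a = 0]. *)
Definition form_family (F : int -> int -> int -> Prop) : Prop :=
  [/\ forall a b c, F a b c -> [/\ 0 <= a, - 3 <= b ^+ 2 - 4 * a * c
        & b ^+ 2 - 4 * a * c <= 0],
      forall a b c P P' Q Q', (P * Q' - P' * Q) ^+ 2 = 1 -> F a b c ->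
        F (actA a b c P Q) (actB a b c P P' Q Q') (actA a b c P' Q')
    & forall b c, F 0 b c -> c = 1].

Lemma square_form_family : form_family square_form.
Proof.
split.
- move=> a b c h; rewrite (square_form_disc h); split => //.
  by case: h => q [p [_ -> _ _]]; apply: sqr_ge0.
- by move=> *; apply: square_form_act.
- move=> b c [q [p [[u [v uv]] q0 _ ->]]].
  have {}q0 : q = 0 by apply/eqP; rewrite -sqrf_eq0 -q0.
  have /(congr1 absz) : v * p = 1 by rewrite -uv q0 mulr0 add0r.
  rewrite abszM => /eqP; rewrite muln_eq1 => /andP[_ /eqP p1].
  by have [->|->] : p = 1 \/ p = -1 by clear -p1; lia.
Qed.

Lemma hex_form_family : form_family hex_form.
Proof.
split; last by move=> b c [].
- by move=> a b c [a0 ->]; split => //; apply: ltW.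
- by move=> *; apply: hex_form_act.
Qed.

Definition separated_family (R : realFieldType) (F : int -> int -> int -> Prop) (t : int) :=
  forall (A : R) (a b c a' b' c' : int), 0 < A -> F a b c -> F a' b' c' ->
  A < a%:~R -> a%:~R <= 2 * A -> A < a'%:~R -> a'%:~R <= 2 * A ->
  (a = a' /\ b = b') \/
  1 / (4 * A) <= `|(t%:~R - b%:~R) / (2 * a%:~R) - (t%:~R - b'%:~R) / (2 * a'%:~R)|.

(** [k / 3] is the hyperbolic cosine of the distance between the critical points of the two forms.
    The integer [k] is odd and at least 3, with equality only for equal forms, so distinct forms
    have [k >= 5]; this gap in distance gives the gap between the real parts. *)
Lemma hex_form_separated (R : realFieldType) : separated_family R hex_form 0.
Proof.
move=> A a b c a' b' c' A0 [a0 d] [a0' d'] h1 h2 h3 h4.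
pose k := 2 * a * c' + 2 * a' * c - b * b'.
have key : (a * b' - a' * b) ^+ 2 = 2 * (a * a') * k - 3 * a ^+ 2 - 3 * a' ^+ 2.
  transitivity (2 * (a * a') * k + a ^+ 2 * (b' ^+ 2 - 4 * a' * c')
      + a' ^+ 2 * (b ^+ 2 - 4 * a * c)); first by rewrite /k; ring.
  by rewrite d d'; ring.
have k3 : 3 <= k.
  have : 6 * (a * a') <= 2 * (a * a') * k.
    have := sqr_ge0 (a * b' - a' * b); have := sqr_ge0 (a - a'); rewrite key sqrrB.
    by clear; lia.
  have : 0 < a * a' by apply: mulr_gt0.
  by clear; nia.
have k_odd : exists j, k = 2 * j + 1.
  have [_ [i hi] _] := hex_form_odd (conj a0 d).
  have [_ [j hj] _] := hex_form_odd (conj a0' d').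
  exists (a * c' + a' * c - 2 * i * j - i - j - 1).
  by rewrite /k hi hj; ring.
have [ek|nk] := eqVneq k 3.
  left; move: key; rewrite ek => key.
  have e : a - a' = 0.
    apply/eqP; rewrite -sqrf_eq0 eq_le sqr_ge0 andbT.
    have := sqr_ge0 (a * b' - a' * b); rewrite key sqrrB; clear; lia.
  have {}e : a' = a by clear -e; lia.
  split => //; move: key; rewrite e => key.
  have : (a * (b' - b)) ^+ 2 = 0 by rewrite mulrBr key; ring.
  by move/eqP; rewrite sqrf_eq0 mulf_eq0 subr_eq0 gt_eqF //= => /eqP.
right.
have k5 : 5 <= k by case: k_odd => j hj; clear -k3 nk hj; lia.
have h10 : 10 * (a * a') - 3 * a ^+ 2 - 3 * a' ^+ 2 <= (a * b' - a' * b) ^+ 2.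
  have := mulr_gt0 a0 a0'; rewrite key; clear -k5; nia.
have aR : 0 < a%:~R :> R by rewrite ltr0z.
have aR' : 0 < a'%:~R :> R by rewrite ltr0z.
have {}h10 : 10 * (a%:~R * a'%:~R) - 3 * a%:~R ^+ 2 - 3 * a'%:~R ^+ 2 <=
     (a%:~R * b'%:~R - a'%:~R * b%:~R) ^+ 2 :> R.
  by move: h10; rewrite -(ler_int R); rewrite !(rmorphB, rmorphM, rmorphXn).
rewrite !sub0r.
have -> : - b%:~R / (2 * a%:~R) - - b'%:~R / (2 * a'%:~R) =
   (a%:~R * b'%:~R - a'%:~R * b%:~R) / (2 * (a%:~R * a'%:~R)) :> R.
  by field; rewrite !gt_eqF.
move: (a%:~R * b'%:~R - a'%:~R * b%:~R) h10 => D h10.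
rewrite -(ler_pXn2r (_ : (0 < 2)%N)) ?nnegrE ?normr_ge0 //; last by rewrite divr_ge0 // mulr_ge0 // ltW.
rewrite real_normK ?num_real // !expr_div_n expr1n.
rewrite ler_pdivlMr; last by rewrite exprn_gt0 // !mulr_gt0.
move: (a%:~R : R) (a'%:~R : R) aR aR' h10 h1 h2 h3 h4 => x y x0 y0 h10 h1 h2 h3 h4.
clear -A0 x0 y0 h10 h1 h2 h3 h4.
(* Within a dyadic range [u <= v <= 2 u], and [(v - u) (2 u - v) >= 0] gives
   [10 u v - 3 u ^ 2 - 3 v ^ 2 >= u ^ 2]. *)
have quad (u v : R) : 0 < u -> u <= v -> v <= 2 * A -> A < u ->
    4 * (u * v) ^+ 2 <= (4 * A) ^+ 2 * (10 * (u * v) - 3 * u ^+ 2 - 3 * v ^+ 2).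
  clear -A0 => u0 uv vA Au.
  have v2u : v <= 2 * u by lra.
  have D : u ^+ 2 <= 10 * (u * v) - 3 * u ^+ 2 - 3 * v ^+ 2.
    have : 0 <= (v - u) * (2 * u - v) by rewrite mulr_ge0 // subr_ge0.
    have : 0 <= u * v by rewrite mulr_ge0 //; lra.
    have := sqr_ge0 u; nra.
  have V : v ^+ 2 <= (2 * A) ^+ 2 by rewrite ler_pXn2r // nnegrE; lra.
  apply: (@le_trans _ _ ((4 * A) ^+ 2 * u ^+ 2)); last first.
    by rewrite ler_wpM2l ?sqr_ge0.
  by have := ler_wpM2r (sqr_ge0 u) V; clear; nra.
have H : 4 * (x * y) ^+ 2 <= (4 * A) ^+ 2 * (10 * (x * y) - 3 * x ^+ 2 - 3 * y ^+ 2).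
  case: (lerP x y) => xy; first by apply: quad; rewrite // ltW.
  have := quad y x y0 (ltW xy) h2 h3.
  by rewrite (mulrC y x) -!addrA [- _ - _]addrC.
rewrite mulrAC mul1r ler_pdivrMr ?exprn_gt0 ?mulr_gt0 //.
rewrite [X in X <= _]exprMn (_ : 2 ^+ 2 = 4); last by ring.
apply: (le_trans H); rewrite mulrC ler_wpM2r ?sqr_ge0 //.
Qed.

Lemma square_form_pos (a b c : int) : square_form a b c -> 0 < a ->
  exists q p : int, [/\ 0 < q, exists u v : int, u * q + v * p = 1,
    a = q ^+ 2, b = - 2 * (q * p) & c = p ^+ 2].
Proof.
move=> [q [p [[u [v uv]] -> -> ->]]] q2; have [qp|qn|qe] := ltgtP q 0.
- exists (- q), (- p); split; [clear -qp; lia| |ring|ring|ring].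
  by exists (- u), (- v); rewrite -uv; ring.
- by exists q, p; split => //; exists u, v.
- by rewrite qe expr0n /= ltxx in q2.
Qed.

(** The targets are [p / q + t / (2 q ^ 2)]. Distinct fractions differ by at least [1 / (q q')], and
    the corrections differ by at most half of [|1 / q ^ 2 - 1 / q' ^ 2|], which is small enough
    within one dyadic range. *)
Lemma square_form_separated (R : realFieldType) (t : int) :
  `|t| <= 1 -> separated_family R square_form t.
Proof.
move=> t1 A a b c a' b' c' A0 sf sf' h1 h2 h3 h4.
have a_gt0 : 0 < a by rewrite -(ltr0z R) (lt_trans A0).
have a_gt0' : 0 < a' by rewrite -(ltr0z R) (lt_trans A0).
have [q [p [q_gt0 bz eq2 eqp _]]] := square_form_pos sf a_gt0.
have [q' [p' [q_gt0' bz' eq2' eqp' _]]] := square_form_pos sf' a_gt0'.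
rewrite eq2 eq2' eqp eqp' in h1 h2 h3 h4 * => {eq2 eq2' eqp eqp' sf sf' a_gt0 a_gt0'}.
have [e|ne] := eqVneq (p * q') (p' * q).
  left; have [u [v uv]] := bz; have [u' [v' uv']] := bz'.
  have e1 : q' = q * (u * q' + v * p').
    transitivity (q' * (u * q + v * p)); first by rewrite uv mulr1.
    by transitivity (q * (u * q') + v * (p * q')); [ring|rewrite e; ring].
  have e2 : q = q' * (u' * q + v' * p).
    transitivity (q * (u' * q' + v' * p')); first by rewrite uv' mulr1.
    by transitivity (q' * (u' * q) + v' * (p' * q)); [ring|rewrite -e; ring].
  have le_mul (x y z : int) : 0 < x -> 0 < y -> y = x * z -> x <= y.
    by move=> x0 y0 yz; rewrite yz ler_peMr ?(ltW x0) // -gtz0_ge1 -(pmulr_rgt0 _ x0) -yz.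
  have eq : q = q'.
    by apply/eqP; rewrite eq_le (le_mul _ _ _ _ _ e1) // (le_mul _ _ _ _ _ e2).
  split; first by rewrite eq.
  congr (_ * _); rewrite eq in e *; congr (_ * _).
  by apply: (mulIf (_ : q' != 0)) => //; rewrite gt_eqF.
right.
have qR := intr_ge1 R q_gt0; have qR' := intr_ge1 R q_gt0'.
have dR : 1 <= `|(p * q' - p' * q)%:~R : R|.
  by rewrite -intr_norm intr_ge1 // normr_gt0 subr_eq0.
have tR : `|t%:~R : R| <= 1 by rewrite -intr_norm lerz1.
rewrite !rmorphXn /= in h1 h2 h3 h4 *.
set x := (q%:~R : R)^-1; set y := (q'%:~R : R)^-1.
have -> : (t%:~R - (- 2 * (q * p))%:~R) / (2 * q%:~R ^+ 2) -
    (t%:~R - (- 2 * (q' * p'))%:~R) / (2 * q'%:~R ^+ 2) =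
   (p * q' - p' * q)%:~R * (x * y) + t%:~R * ((x ^+ 2 - y ^+ 2) / 2) :> R.
  by rewrite /x /y; field; rewrite !gt_eqF // (lt_le_trans _ qR, lt_le_trans _ qR').
have X0 : 0 < x by rewrite invr_gt0 (lt_le_trans _ qR).
have Y0 : 0 < y by rewrite invr_gt0 (lt_le_trans _ qR').
pose B := A^-1; have B0 : 0 < B by rewrite invr_gt0.
have x1 : x ^+ 2 <= B.
  by rewrite exprVn lef_pV2 ?posrE ?ltW // exprn_gt0 // (lt_le_trans _ qR).
have y1 : y ^+ 2 <= B.
  by rewrite exprVn lef_pV2 ?posrE ?ltW // exprn_gt0 // (lt_le_trans _ qR').
have x2 : B / 2 <= x ^+ 2.
  by rewrite -invfM mulrC exprVn lef_pV2 ?posrE ?mulr_gt0 ?exprn_gt0 // (lt_le_trans _ qR).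
have y2 : B / 2 <= y ^+ 2.
  by rewrite -invfM mulrC exprVn lef_pV2 ?posrE ?mulr_gt0 ?exprn_gt0 // (lt_le_trans _ qR').
have -> : 1 / (4 * A) = B / 4 by rewrite /B; field; rewrite gt_eqF.
have low : B / 4 <= x * y - `|(x ^+ 2 - y ^+ 2) / 2|.
  clear -X0 Y0 x1 y1 x2 y2 B0.
  have w (u v : R) : 0 < v -> v <= u -> u ^+ 2 <= B -> B / 2 <= v ^+ 2 ->
     B / 4 <= u * v - (u ^+ 2 - v ^+ 2) / 2.
    move=> v0 vu h1 h2.
    have : v ^+ 2 <= u * v by rewrite expr2 ler_wpM2r // ltW.
    by lra.
  case: (lerP y x) => xy.
    rewrite ger0_norm; first exact: w.
    by rewrite divr_ge0 // subr_ge0 ler_pXn2r // nnegrE ltW.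
  rewrite ler0_norm; last first.
    have : x ^+ 2 <= y ^+ 2 by rewrite ler_pXn2r ?nnegrE ?ltW.
    by clear; lra.
  by have := w y x X0 (ltW xy) y1 x2; rewrite (mulrC y x); clear; lra.
apply: (le_trans low).
move: (_ / 2) => z.
have a1 : x * y <= `|(p * q' - p' * q)%:~R * (x * y)|.
  by rewrite normrM (gtr0_norm (mulr_gt0 X0 Y0)) ler_peMl // ltW // mulr_gt0.
have a2 : `|t%:~R * z| <= `|z| by rewrite normrM ler_piMl.
have := lerB_normD ((p * q' - p' * q)%:~R * (x * y)) (t%:~R * z).
move: (_ * (x * y)) (_ * z) a1 a2 => w1 w2 a1 a2.
by clear -a1 a2; lra.
Qed.

Lemma form_family_real (R : realFieldType) F (a b c : int) (x : R) :
  form_family F -> F a b c -> 0 < a ->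
  [/\ 1 <= a%:~R :> R, 4 * a%:~R * form_at a b c x <= psi a b x ^+ 2 + 3,
    psi a b x ^+ 2 <= 4 * a%:~R * form_at a b c x & 0 <= form_at a b c x].
Proof.
move=> [Fd _ _] hf a0; have [_ d1 d2] := Fd _ _ _ hf.
have aR := intr_ge1 R a0.
have dR1 : - 3 <= (b ^+ 2 - 4 * a * c)%:~R :> R by rewrite (ler_int _ (- 3)).
have dR2 : (b ^+ 2 - 4 * a * c)%:~R <= 0 :> R by rewrite (ler_int _ _ 0).
have := psi_disc a b c x; rewrite -/(psi a b x) => D.
have h1 : 4 * a%:~R * form_at a b c x <= psi a b x ^+ 2 + 3 by rewrite D; clear -dR1; lra.
have h2 : psi a b x ^+ 2 <= 4 * a%:~R * form_at a b c x by rewrite D; clear -dR2; lra.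
split => //; rewrite -(pmulr_rge0 _ (_ : 0 < 4 * a%:~R)); last by clear -aR; lra.
by apply: le_trans h2; rewrite sqr_ge0.
Qed.

(** Here [v], [phi] are the values of [psi] and of the form at the image, [u], [f] those of the
    transformed form at the seed. The error is [w = 2 f / z], so it suffices that [f <= 4]. This is
    a bootstrap: [4 f <= u ^ 2 + 3] bounds [f] through [u], while [a > 64 Q ^ 2] gives
    [w ^ 2 <= f / 8], so that [u] grows too slowly for a large [f]. *)
Lemma transfer_real (R : realFieldType) (d u v f phi z s Q a : R) :
  0 < d -> d <= 1 -> 16 / d <= z -> 0 < Q -> s = Q * z ->
  `|v| <= 3 / 2 -> 4 * a * phi <= v ^+ 2 + 3 -> 0 <= phi -> 64 * Q ^+ 2 < a ->
  f = s ^+ 2 * phi -> 4 * f <= u ^+ 2 + 3 ->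
  forall sg : R, `|sg| = 1 -> u = sg * v + 2 * Q * s * phi ->
  `|u - sg * v| <= d / 2.
Proof.
move=> d0 d1 dz Q0 sE v2 h1 phi0 aQ fE h2 sg sg1 uE.
have z16 : 16 <= z.
  by apply: le_trans dz; rewrite ler_pdivlMr // ler_piMr.
have z0 : 0 < z by clear -z16; lra.
have vv : v ^+ 2 <= 9 / 4.
  by rewrite -[v ^+ 2]real_normK ?num_real //; have := normr_ge0 v; move: (`|v|) v2; clear => w; nra.
have phiQ : Q ^+ 2 * phi <= 1 / 32.
  have : 64 * Q ^+ 2 * phi <= a * phi by rewrite ler_wpM2r // ltW.
  by clear -h1 vv; lra.
have f0 : 0 <= f by rewrite fE mulr_ge0 // sqr_ge0.
set w := 2 * Q * s * phi in uE.
have wE : w = 2 * (Q ^+ 2 * phi) * z by rewrite /w sE; ring.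
have fE' : f = (Q ^+ 2 * phi) * z ^+ 2 by rewrite fE sE; ring.
have Qphi0 : 0 <= Q ^+ 2 * phi by rewrite mulr_ge0 // sqr_ge0.
have w0 : 0 <= w by rewrite wE !mulr_ge0 // ltW.
have uw : `|u - sg * v| = w by rewrite uE addrAC subrr add0r ger0_norm.
rewrite uw.
have wf : w ^+ 2 <= f / 8.
  rewrite wE fE'; move: (Q ^+ 2 * phi) Qphi0 phiQ => x x0 x1.
  have -> : (2 * x * z) ^+ 2 = 4 * x * (x * z ^+ 2) by ring.
  have : 0 <= x * z ^+ 2 by rewrite mulr_ge0 // sqr_ge0.
  by move: (x * z ^+ 2) => y y0; clear -x0 x1 y0; nra.
have sv : `|sg * v| <= 3 / 2 by rewrite normrM sg1 mul1r.
have f4 : f <= 4.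
  rewrite leNgt; apply/negP => f4.
  have : `|u| <= 3 / 2 + w.
    by rewrite uE; apply: le_trans (ler_normD _ _) _; rewrite (ger0_norm w0) lerD2r.
  have : u ^+ 2 = `|u| ^+ 2 by rewrite real_normK ?num_real.
  move: (`|u|) (normr_ge0 u) => y y0 uy yw.
  rewrite uy in h2; clear -f4 w0 wf h2 y0 yw.
  have : y ^+ 2 <= (3 / 2 + w) ^+ 2 by rewrite ler_pXn2r // nnegrE; lra.
  by nra.
have wz : w * z = 2 * f by rewrite wE fE'; ring.
rewrite -(ler_pM2r z0) wz.
have dz' : 16 <= d * z by move: dz; rewrite ler_pdivrMr // mulrC.
by clear -dz' f4; lra.
Qed.

Lemma actA_inv (a b c P P' Q Q' : int) :
  actA (actA a b c P Q) (actB a b c P P' Q Q') (actA a b c P' Q') Q' (- Q) =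
  (P * Q' - P' * Q) ^+ 2 * a.
Proof. rewrite /actA /actB; ring. Qed.

Lemma det_sign (R : realFieldType) (n : int) : n ^+ 2 = 1 -> `|n%:~R : R| = 1 /\ `|n| = 1.
Proof.
move=> h; have e : `|n| = 1 by nia.
by rewrite -intr_norm e.
Qed.

(* In the coordinates given by the unimodular matrix, a form whose leading
   coefficient is large compared with [Q ^ 2] takes a small value at [x],
   so that the two values of [psi] agree up to sign and [O(1 / z)]. *)
Lemma transfer_avoid (R : realFieldType) F (t : int) (d x : R) (P P' Q Q' : int) :
  let z := x + Q'%:~R / Q%:~R in
  let y := (P%:~R * x + P'%:~R) / (Q%:~R * x + Q'%:~R) in
  form_family F -> `|t| <= 1 -> 0 < d -> d <= 1 ->
  (forall a b c t', F a b c -> 0 < a -> `|t'| = `|t| -> d <= `|psi a b x - t'%:~R|) ->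
  0 < Q -> (P * Q' - P' * Q) ^+ 2 = 1 -> 16 / d <= z ->
  forall a b c t', F a b c -> 64 * Q%:~R ^+ 2 < a%:~R :> R -> `|t'| = `|t| ->
  d / 2 <= `|psi a b y - t'%:~R|.
Proof.
move=> z y FF t1 d0 d1 avoid Q0 det2 dz a b c t' hf aQ tt'.
have QR := intr_ge1 R Q0; have QR0 : 0 < Q%:~R :> R by rewrite (lt_le_trans _ QR).
have z0 : 0 < z by apply: lt_le_trans dz; rewrite divr_gt0.
have sE : Q%:~R * x + Q'%:~R = Q%:~R * z by rewrite /z; field; rewrite gt_eqF.
have s0 : Q%:~R * x + Q'%:~R != 0 by rewrite sE gt_eqF // mulr_gt0.
have a0 : 0 < a.
  by rewrite -(ltr0z R); apply: le_lt_trans aQ; rewrite mulr_ge0 // sqr_ge0.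
have [aR h1 h2 phi0] := form_family_real y FF hf a0.
have := psi_act a b c P P' s0; have := form_at_act a b c P P' s0; rewrite /= -/y.
have [Fd Fact F0] := FF.
have hf' := Fact _ _ _ _ _ _ _ det2 hf.
have := actA_inv a b c P P' Q Q'; rewrite det2 mul1r.
move: hf'; set a' := actA a b c P Q; set b' := actB _ _ _ _ _ _ _; set c' := actA a b c P' Q'.
move=> hf' aE fE uE.
(* The excluded case is the square form that vanishes at the cusp [P / Q]; its leading coefficient
   is [Q ^ 2], too small for the hypothesis. *)
have a'0 : 0 < a'.
  have [a'ge0 _ dle] := Fd _ _ _ hf'.
  rewrite lt_neqAle a'ge0 andbT eq_sym; apply/eqP => a'0.
  rewrite a'0 in dle hf' aE; have c1 := F0 _ _ hf'.
  have b'0 : b' = 0 by apply/eqP; rewrite -sqrf_eq0 eq_le sqr_ge0 andbT; move: dle; clear; lia.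
  move: aQ; rewrite -aE c1 b'0 /actA; have : 0 <= Q%:~R ^+ 2 :> R by rewrite sqr_ge0.
  rewrite !mul0r !add0r mul1r sqrrN rmorphXn /=; clear; lra.
have [aR' h1' h2' phi0'] := form_family_real x FF hf' a'0.
rewrite leNgt; apply/negP => small.
have [sg1 sg2] := det_sign R det2.
have tR : `|t'%:~R : R| <= 1 by rewrite -intr_norm lerz1 tt'.
have v2 : `|psi a b y| <= 3 / 2.
  have := ler_dist_dist (psi a b y) (t'%:~R); move/le_lt_trans/(_ small).
  by rewrite ltr_norml => /andP[_]; move: tR d1; clear; lra.
have h4 : 4 * form_at a' b' c' x <= psi a' b' x ^+ 2 + 3.
  by apply: le_trans h1'; rewrite ler_wpM2r // ler_peMr.
have := transfer_real d0 d1 dz QR0 sE v2 h1 phi0 aQ fE h4 sg1 uE.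
have := avoid _ _ _ ((P * Q' - P' * Q) * t') hf' a'0.
rewrite normrM sg2 mul1r => /(_ tt'); rewrite rmorphM /=.
have {}small : `|(P * Q' - P' * Q)%:~R * psi a b y - (P * Q' - P' * Q)%:~R * t'%:~R| < d / 2.
  by rewrite -mulrBr normrM sg1 mul1r.
move=> lo hi.
have := ler_distD ((P * Q' - P' * Q)%:~R * psi a b y) (psi a' b' x) ((P * Q' - P' * Q)%:~R * t'%:~R).
move: small lo hi; clear; lra.
Qed.

(** The target near the seed is pulled to the image by the inverse substitution. To compare the
    heights, [psi ^ 2] minus the discriminant must be bounded below at both points, hence the
    alternative on the discriminant and [t]: then [a phi] and [a' f] are both of order 1, and
    [f = (Q z) ^ 2 phi]. *)
Lemma transfer_approach (R : realFieldType) F (t : int) (e x : R) (P P' Q Q' : int)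
    (a' b' c' : int) :
  let z := x + Q'%:~R / Q%:~R in
  let y := (P%:~R * x + P'%:~R) / (Q%:~R * x + Q'%:~R) in
  form_family F -> `|t| <= 1 -> 0 <= e -> e <= 1 / 4 ->
  F a' b' c' -> 0 < a' -> `|psi a' b' x - t%:~R| <= e ->
  (forall a b c, F a b c -> b ^+ 2 - 4 * a * c = - 3) \/ `|t| = 1 ->
  0 < Q -> (P * Q' - P' * Q) ^+ 2 = 1 -> 16 <= z ->
  exists a b c t', [/\ F a b c, a'%:~R <= a%:~R :> R,
    a%:~R <= 28 * (Q%:~R * z) ^+ 2 * a'%:~R, `|t'| = `|t| &
    `|psi a b y - t'%:~R| <= e + 1 / (4 * a'%:~R)].
Proof.
move=> z y FF t1 e0 e1 hf' a'0 near disc Q0 det2 z16.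
have [Fd Fact _] := FF.
have QR := intr_ge1 R Q0; have QR0 : 0 < Q%:~R :> R by rewrite (lt_le_trans _ QR).
have z0 : 0 < z by apply: lt_le_trans z16.
have sE : Q%:~R * x + Q'%:~R = Q%:~R * z by rewrite /z; field; rewrite gt_eqF.
have s0 : Q%:~R * x + Q'%:~R != 0 by rewrite sE gt_eqF // mulr_gt0.
have det2' : (Q' * P - - P' * - Q) ^+ 2 = 1 by rewrite -[RHS]det2; ring.
have hf := Fact _ _ _ _ _ _ _ det2' hf'.
set a := actA a' b' c' Q' (- Q) in hf.
set b := actB a' b' c' Q' (- P') (- Q) P in hf.
set c := actA a' b' c' (- P') P in hf.
have Ea : actA a b c P Q = a'.
  by rewrite -[RHS]mul1r -det2 /a /b /c /actA /actB; ring.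
have Eb : actB a b c P P' Q Q' = b'.
  by rewrite -[RHS]mul1r -det2 /a /b /c /actA /actB; ring.
have Ec : actA a b c P' Q' = c'.
  by rewrite -[RHS]mul1r -det2 /a /b /c /actA /actB; ring.
have := psi_act a b c P P' s0; have := form_at_act a b c P P' s0; rewrite /= -/y.
rewrite Ea Eb Ec => fE uE.
have [aR' h1' h2' phi0'] := form_family_real x FF hf' a'0.
have [sg1 sg2] := det_sign R det2.
set sg := (P * Q' - P' * Q) in sg1 sg2 uE.
have tR : `|t%:~R : R| <= 1 by rewrite -intr_norm lerz1.
have u2 : `|psi a' b' x| <= 5 / 4.
  have := ler_dist_dist (psi a' b' x) (t%:~R); move/le_trans/(_ near).
  by rewrite ler_norml => /andP[_]; move: tR e1; clear; lra.
have u2' : psi a' b' x ^+ 2 <= 25 / 16.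
  by rewrite -[_ ^+ 2]real_normK ?num_real //; have := normr_ge0 (psi a' b' x); move: (`|_|) u2; clear => w; nra.
set f := form_at a' b' c' x in fE h1' h2' phi0'.
set phi := form_at a b c y in fE uE.
have fa : a'%:~R * f <= 2 by move: h1' u2'; clear; lra.
have f2 : f <= 2 by apply: le_trans fa; rewrite ler_peMl.
have s20 : 0 < (Q%:~R * z) ^+ 2 by rewrite exprn_gt0 // mulr_gt0.
rewrite sE in fE uE.
have uv : psi a' b' x - sg%:~R * psi a b y = 2 * f / z.
  by rewrite uE fE addrAC subrr add0r; field; rewrite gt_eqF.
have wz : 2 * f / z <= 1 / (4 * a'%:~R).
  rewrite ler_pdivrMr // mulrAC ler_pdivlMr; last by rewrite mulr_gt0 // (lt_le_trans _ aR').
  have -> : 2 * f * (4 * a'%:~R) = 8 * (a'%:~R * f) by ring.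
  by move: fa z16; clear; lra.
have w0 : 0 <= 2 * f / z by rewrite divr_ge0 ?(ltW z0) // mulr_ge0.
have w4 : 1 / (4 * a'%:~R) <= 1 / 4 :> R.
  by rewrite ler_pM2l // lef_pV2 ?posrE ?mulr_gt0 ?ler_peMr // (lt_le_trans _ aR').
have near' : `|psi a b y - (sg * t)%:~R| <= e + 1 / (4 * a'%:~R).
  have -> : `|psi a b y - (sg * t)%:~R| = `|sg%:~R * psi a b y - t%:~R|.
    rewrite -[LHS]mul1r -[X in X * _]sg1 -normrM mulrBr rmorphM /= mulrA -expr2 -rmorphXn /=.
    by rewrite /sg det2 mul1r.
  have := ler_distD (psi a' b' x) (sg%:~R * psi a b y) t%:~R.
  rewrite (distrC (sg%:~R * psi a b y) (psi a' b' x)) uv (ger0_norm w0); move: near wz; clear; lra.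
have uw : `|sg%:~R * psi a b y| = `|psi a b y| by rewrite normrM sg1 mul1r.
have := psi_disc a' b' c' x; rewrite -/(psi a' b' x) -/f => D'.
have := psi_disc a b c y; rewrite -/(psi a b y) -/phi => D.
have big : 1 / 4 <= psi a b y ^+ 2 - (b ^+ 2 - 4 * a * c)%:~R /\
    1 / 4 <= psi a' b' x ^+ 2 - (b' ^+ 2 - 4 * a' * c')%:~R.
  have sq (w : R) : 1 / 2 <= `|w| -> 1 / 4 <= w ^+ 2.
    rewrite -[w ^+ 2]real_normK ?num_real //; have := normr_ge0 w.
    by move: (`|w|); clear => v; nra.
  case: disc => [disc|t2].
    rewrite (disc _ _ _ hf) (disc _ _ _ hf').
    have := sqr_ge0 (psi a b y); have := sqr_ge0 (psi a' b' x).
    by clear; split; lra.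
  have tR1 : `|t%:~R : R| = 1 by rewrite -intr_norm t2.
  have [_ dle _] := Fd _ _ _ hf; have [_ _ dle0] := Fd _ _ _ hf.
  have [_ _ dle0'] := Fd _ _ _ hf'.
  have dR : (b ^+ 2 - 4 * a * c)%:~R <= 0 :> R by rewrite lerz0.
  have dR' : (b' ^+ 2 - 4 * a' * c')%:~R <= 0 :> R by rewrite lerz0.
  have tR2 : `|(sg * t)%:~R : R| = 1 by rewrite rmorphM /= normrM sg1 mul1r.
  split.
    have /sq : 1 / 2 <= `|psi a b y|.
      have := ler_dist_dist (sg * t)%:~R (psi a b y); rewrite distrC => /le_trans/(_ near').
      by rewrite tR2 ler_norml => /andP[_]; move: e1 w4; clear; lra.
    by move: dR; clear; lra.
  have /sq : 1 / 2 <= `|psi a' b' x|.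
    have := ler_dist_dist t%:~R (psi a' b' x); rewrite distrC => /le_trans/(_ near).
    by rewrite tR1 ler_norml => /andP[_]; move: e1; clear; lra.
  by move: dR'; clear; lra.
rewrite -D -D' in big; case: big => big big'.
have phi0 : 0 <= phi.
  by rewrite -(pmulr_rge0 _ s20) -fE.
have [a_ge0 dlow _] := Fd _ _ _ hf.
have a0 : 0 < a.
  rewrite lt_neqAle a_ge0 andbT eq_sym; apply/eqP => a0.
  by move: big; rewrite a0 mulr0 mul0r; clear; lra.
have [aR _ _ _] := form_family_real y FF hf a0.
have v2 : `|psi a b y| <= 3 / 2.
  have := ler_dist_dist (psi a b y) (sg * t)%:~R => /le_trans/(_ near').
  have tR2 : `|(sg * t)%:~R : R| <= 1 by rewrite rmorphM /= normrM sg1 mul1r.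
  by rewrite ler_norml => /andP[_]; move: tR2 e1 w4; clear; lra.
have aphi : a%:~R * phi <= 7 / 4.
  have [_ h _ _] := form_family_real y FF hf a0; move: h; rewrite -/phi.
  rewrite -[_ ^+ 2]real_normK ?num_real //; have := normr_ge0 (psi a b y).
  move: v2; move: (`|_|) => w; clear => w1 w0; have : w ^+ 2 <= 9 / 4 by nra.
  lra.
exists a, b, c, (sg * t); split => //; last by rewrite normrM sg2 mul1r.
  have S : 256 <= (Q%:~R * z) ^+ 2.
    have : 16 <= Q%:~R * z by apply: le_trans z16 _; rewrite ler_peMl // ltW.
    by clear; nra.
  set S2 := (Q%:~R * z) ^+ 2 in s20 fE S.
  have h1 : S2 <= 16 * (a%:~R * f).
    by rewrite fE mulrCA -{1}[S2]mulr1; move: big; move: (phi) => p; clear -s20; nra.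
  have h2 : a'%:~R * S2 <= 32 * a%:~R.
    have : a'%:~R * S2 <= a'%:~R * (16 * (a%:~R * f)) by rewrite ler_wpM2l // (le_trans ler01).
    have -> : a'%:~R * (16 * (a%:~R * f)) = 16 * a%:~R * (a'%:~R * f) by ring.
    by move: fa; move: (a'%:~R * f) => p; clear -aR; nra.
  by move: h2 S aR'; clear; nra.
have h1 : a%:~R * f <= 7 / 4 * (Q%:~R * z) ^+ 2.
  by rewrite fE mulrCA mulrC ler_wpM2r // ltW.
have h2 : a%:~R <= 16 * a'%:~R * (a%:~R * f).
  have -> : 16 * a'%:~R * (a%:~R * f) = 4 * a%:~R * (4 * a'%:~R * f) by ring.
  by move: big'; move: (4 * a'%:~R * f) => p; clear -aR; nra.
have : 16 * a'%:~R * (a%:~R * f) <= 16 * a'%:~R * (7 / 4 * (Q%:~R * z) ^+ 2).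
  by rewrite ler_wpM2l // mulr_ge0 // (le_trans ler01).
move: h2; clear; lra.
Qed.

(** * Reduced bases for the Euclidean and the taxicab norm *)

Lemma int2_min (R : realDomainType) (f : int -> int -> R) :
  (forall B, exists K : nat, forall m n, f m n <= B -> (`|m| <= K)%N /\ (`|n| <= K)%N) ->
  exists m n, (m, n) != (0, 0) /\ forall m' n', (m', n') != (0, 0) -> f m n <= f m' n'.
Proof.
move=> /(_ (f 1 0))[K HK].
pose I : finType := ('I_(2 * K).+1 * 'I_(2 * K).+1)%type.
pose dec (i : 'I_(2 * K).+1) : int := (i : nat)%:Z - K%:Z.
pose P (z : I) := (dec z.1, dec z.2) != (0, 0).
have enc (m : int) : (`|m| <= K)%N -> exists i, dec i = m.
  move=> mK; have h : (absz (m + K%:Z)%R < (2 * K).+1)%N by clear -mK; lia.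
  by exists (Ordinal h); rewrite /dec /=; clear -mK; lia.
have [K1 K0] := HK 1 0 (lexx _).
have [i1 i1E] := enc _ K1; have [i0 i0E] := enc _ K0.
have P0 : P (i1, i0) by rewrite /P /= i1E i0E.
case: (@arg_minP _ R I (i1, i0) P (fun z => f (dec z.1) (dec z.2)) P0) => z Pz zmin.
exists (dec z.1), (dec z.2); split => // m n mn.
case: (lerP (f m n) (f 1 0)) => h; last first.
  by apply: le_trans (ltW h); have := zmin _ P0; rewrite /= i1E i0E.
have [mK nK] := HK _ _ h; have [i iE] := enc _ mK; have [j jE] := enc _ nK.
by have := zmin (i, j); rewrite /P /= iE jE; apply.
Qed.

Lemma int2_min_prim (R : realDomainType) (f : int -> int -> R) :
  (forall B, exists K : nat, forall m n, f m n <= B -> (`|m| <= K)%N /\ (`|n| <= K)%N) ->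
  (forall d m n, 1 < d -> (m, n) != (0, 0) -> f m n < f (d * m) (d * n)) ->
  exists m n, (exists u v, u * m + v * n = 1) /\
    forall m' n', (m', n') != (0, 0) -> f m n <= f m' n'.
Proof.
move=> HK Hd; have [m [n [mn min]]] := int2_min HK; exists m, n; split => //.
have [u [v uv]] := Bezoutz m n.
have g0 : 0 < gcdz m n.
  have g0 : 0 <= gcdz m n by [].
  rewrite lt_neqAle g0 andbT eq_sym gcdz_eq0.
  by apply: contra mn => /andP[/eqP -> /eqP ->].
have [g1|gn1] := eqVneq (gcdz m n) 1; first by exists u, v; rewrite uv.
have gm : m = gcdz m n * (m %/ gcdz m n)%Z by rewrite mulrC divzK // dvdz_gcdl.
have gn : n = gcdz m n * (n %/ gcdz m n)%Z by rewrite mulrC divzK // dvdz_gcdr.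
have nz : ((m %/ gcdz m n)%Z, (n %/ gcdz m n)%Z) != (0, 0).
  apply: contra mn => /eqP[h1 h2].
  have m0 : m = 0 by rewrite gm h1 mulr0.
  have n0 : n = 0 by rewrite gn h2 mulr0.
  by rewrite m0 n0.
have g2 : 1 < gcdz m n by clear -g0 gn1; lia.
have := Hd _ _ _ g2 nz; rewrite -gm -gn.
by move=> /(le_lt_trans (min _ _ nz)); rewrite ltxx.
Qed.

Definition lc {R : pzRingType} (x1 x2 : R) (m n : int) : R := m%:~R * x1 + n%:~R * x2.

Lemma coef_bound (R : archiRealFieldType) (D N e1 e2 : R) (m n : int) :
  0 < D -> `|m%:~R| * D <= N * e2 -> `|n%:~R| * D <= N * e1 ->
  (`|m| <= Num.truncn (N * e2 / D))%N /\ (`|n| <= Num.truncn (N * e1 / D))%N.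
Proof.
move=> D0 h1 h2.
have aux (k : int) (y : R) : `|k%:~R| * D <= y -> (`|k| <= Num.truncn (y / D))%N.
  move=> h; rewrite truncn_ge_nat; first by rewrite ler_pdivlMr // natr_absz intr_norm.
  by rewrite divr_ge0 ?(ltW D0) // (le_trans _ h) // mulr_ge0 // ltW.
by split; exact: aux.
Qed.

Lemma l2_bounded (R : archiRealFieldType) (x1 y1 x2 y2 : R) : x1 * y2 - x2 * y1 != 0 ->
  forall B, exists K : nat, forall m n,
    lc x1 x2 m n ^+ 2 + lc y1 y2 m n ^+ 2 <= B -> (`|m| <= K)%N /\ (`|n| <= K)%N.
Proof.
move=> D0 B.
pose D := (x1 * y2 - x2 * y1) ^+ 2; have Dp : 0 < D by rewrite exprn_even_gt0.
pose e := x1 ^+ 2 + y1 ^+ 2 + x2 ^+ 2 + y2 ^+ 2.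
have e0 : 0 <= e by rewrite !addr_ge0 ?sqr_ge0.
exists (Num.truncn (B * e / D)) => m n h.
have key (k : int) (u v u' v' : R) : (u * v' - u' * v) ^+ 2 = k%:~R ^+ 2 * D ->
   u ^+ 2 + v ^+ 2 <= B -> u' ^+ 2 + v' ^+ 2 <= e -> `|k%:~R| * D <= B * e.
  move=> h1 h2 h3.
  have k2 : `|k%:~R| <= k%:~R ^+ 2 :> R.
    rewrite -intr_norm -rmorphXn /= ler_int; clear; nia.
  apply: le_trans (_ : k%:~R ^+ 2 * D <= _); first by rewrite ler_wpM2r // ltW.
  rewrite -h1.
  apply: (@le_trans _ _ ((u ^+ 2 + v ^+ 2) * (u' ^+ 2 + v' ^+ 2))).
    by have := sqr_ge0 (u * u' + v * v'); clear; lra.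
  by apply: ler_pM; rewrite ?addr_ge0 ?sqr_ge0.
apply: coef_bound => //.
  apply: (key _ (lc x1 x2 m n) (lc y1 y2 m n) x2 y2) => //.
    by rewrite /lc /D; ring.
  by rewrite /e; have := sqr_ge0 x1; have := sqr_ge0 y1; clear; lra.
apply: (key _ (lc x1 x2 m n) (lc y1 y2 m n) x1 y1) => //.
  by rewrite /lc /D; ring.
by rewrite /e; have := sqr_ge0 x2; have := sqr_ge0 y2; clear; lra.
Qed.

Lemma l1_bounded (R : archiRealFieldType) (x1 y1 x2 y2 : R) : x1 * y2 - x2 * y1 != 0 ->
  forall B, exists K : nat, forall m n,
    `|lc x1 x2 m n| + `|lc y1 y2 m n| <= B -> (`|m| <= K)%N /\ (`|n| <= K)%N.
Proof.
move=> D0 B; have [K HK] := l2_bounded D0 (B ^+ 2); exists K => m n h; apply: HK.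
rewrite -(real_normK (num_real (lc x1 x2 m n))) -(real_normK (num_real (lc y1 y2 m n))).
move: (`|lc x1 x2 m n|) (`|lc y1 y2 m n|) h (normr_ge0 (lc x1 x2 m n)) (normr_ge0 (lc y1 y2 m n)).
by clear => x y h x0 y0; nra.
Qed.

Lemma lc_det_eq0 (R : realFieldType) (x1 y1 x2 y2 : R) m n : x1 * y2 - x2 * y1 != 0 ->
  lc x1 x2 m n = 0 -> lc y1 y2 m n = 0 -> (m, n) = (0, 0).
Proof.
move=> D0 h1 h2.
have e1 : m%:~R * (x1 * y2 - x2 * y1) = 0.
  by transitivity (lc x1 x2 m n * y2 - lc y1 y2 m n * x2); [rewrite /lc; ring|rewrite h1 h2; ring].
have e2 : n%:~R * (x1 * y2 - x2 * y1) = 0.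
  by transitivity (lc y1 y2 m n * x1 - lc x1 x2 m n * y1); [rewrite /lc; ring|rewrite h1 h2; ring].
move/eqP: e1; move/eqP: e2; rewrite !mulf_eq0 (negPf D0) !orbF !intr_eq0.
by move=> /eqP -> /eqP ->.
Qed.

(** A Gauss-reduced basis with the obtuse sign, so that a nearly hexagonal lattice always shows its
    basis at angle 120 degrees. *)
Lemma l2_reduced (R : archiRealFieldType) (x1 y1 x2 y2 : R) : x1 * y2 - x2 * y1 != 0 ->
  exists m n m' n' : int,
  let X1 := lc x1 x2 m n in let Y1 := lc y1 y2 m n in
  let X2 := lc x1 x2 m' n' in let Y2 := lc y1 y2 m' n' in
  let A := X1 ^+ 2 + Y1 ^+ 2 in
  [/\ `|m * n' - n * m'| = 1,
    forall k l, (k, l) != (0, 0) -> A <= lc x1 x2 k l ^+ 2 + lc y1 y2 k l ^+ 2,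
    0 < A, - A <= 2 * (X1 * X2 + Y1 * Y2) <= 0 & A <= X2 ^+ 2 + Y2 ^+ 2].
Proof.
move=> D0.
have pos m n : (m, n) != (0, 0) -> 0 < lc x1 x2 m n ^+ 2 + lc y1 y2 m n ^+ 2.
  move=> mn; rewrite lt_neqAle addr_ge0 ?sqr_ge0 // andbT eq_sym.
  rewrite paddr_eq0 ?sqr_ge0 // !sqrf_eq0.
  by apply: contra mn => /andP[/eqP h1 /eqP h2]; rewrite (lc_det_eq0 D0 h1 h2).
have [|m [n [[u [v uv]] min]]] := int2_min_prim (l2_bounded D0) _.
  move=> d m n d1 mn; have := pos _ _ mn.
  have -> : lc x1 x2 (d * m) (d * n) = d%:~R * lc x1 x2 m n by rewrite /lc; ring.
  have -> : lc y1 y2 (d * m) (d * n) = d%:~R * lc y1 y2 m n by rewrite /lc; ring.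
  move=> w0; rewrite !exprMn -mulrDr ltr_pMl // exprn_egt1 //.
  by rewrite ltr1z.
have mn : (m, n) != (0, 0).
  by apply/eqP => -[m0 n0]; move: uv; rewrite m0 n0 !mulr0.
have A0 := pos _ _ mn; set A := _ + _ in A0.
set X1 := lc x1 x2 m n in A0; set Y1 := lc y1 y2 m n in A0.
pose B k := 2 * (X1 * lc x1 x2 (k * m - v) (k * n + u) + Y1 * lc y1 y2 (k * m - v) (k * n + u)).
have [k kB] : exists k, `|B k| <= A.
  pose k := Num.floor (B 0 / (2 * A) + 1 / 2); exists (- k).
  have -> : B (- k) = 2 * A * (B 0 / (2 * A) - k%:~R).
    rewrite mulrBr [2 * A * (_ / _)]mulrC divfK; last by rewrite mulf_neq0 // gt_eqF.
    by rewrite /B /A /X1 /Y1 /lc; ring.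
  have /andP[h1 h2] := floor_itv (B 0 / (2 * A) + 1 / 2); rewrite -/k in h1 h2.
  move: h1 h2; rewrite intrD; move: (B 0 / _) (k%:~R : R) => q K h1 h2.
  by clearbody A; clear -A0 h1 h2; rewrite ler_norml; apply/andP; split; nra.
have nz i j : (m * j - n * i) ^+ 2 = 1 -> (i, j) != (0, 0).
  by move=> e; apply/eqP => -[i0 j0]; move: e; rewrite i0 j0 !mulr0 subrr expr0n.
have res i j : m * j - n * i = 1 \/ m * j - n * i = -1 ->
    2 * (X1 * lc x1 x2 i j + Y1 * lc y1 y2 i j) <= 0 ->
    `|2 * (X1 * lc x1 x2 i j + Y1 * lc y1 y2 i j)| <= A ->
    exists m n m' n' : int,
  let X1 := lc x1 x2 m n in let Y1 := lc y1 y2 m n in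
  let X2 := lc x1 x2 m' n' in let Y2 := lc y1 y2 m' n' in
  let A := X1 ^+ 2 + Y1 ^+ 2 in
  [/\ `|m * n' - n * m'| = 1,
    forall k l, (k, l) != (0, 0) -> A <= lc x1 x2 k l ^+ 2 + lc y1 y2 k l ^+ 2,
    0 < A, - A <= 2 * (X1 * X2 + Y1 * Y2) <= 0 & A <= X2 ^+ 2 + Y2 ^+ 2].
  move=> dij le0 leA; exists m, n, i, j; split => //.
  - by case: dij => ->; rewrite ?normrN normr1.
  - by rewrite le0 andbT; move: leA; rewrite ler_norml => /andP[].
  - by apply: min; apply: nz; case: dij => ->; rewrite ?sqrrN expr1n.
have [Bk|Bk] := lerP (B k) 0.
  apply: (res (k * m - v) (k * n + u)) => //; left.
  by rewrite -uv; ring.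
apply: (res (- (k * m - v)) (- (k * n + u))); first by right; rewrite -uv; ring.
  rewrite (_ : 2 * _ = - B k); last by rewrite /B /lc; ring.
  by rewrite oppr_le0 ltW.
rewrite (_ : 2 * _ = - B k); last by rewrite /B /lc; ring.
by rewrite normrN.
Qed.

Lemma round_coef (R : archiRealFieldType) (W r : R) : W != 0 ->
  exists k : int, `|r + k%:~R * W| <= `|W| / 2.
Proof.
move=> W0; pose k := Num.floor (r / W + 1 / 2); exists (- k).
have -> : r + (- k)%:~R * W = W * (r / W - k%:~R).
  by rewrite mulrBr [W * (_ / _)]mulrC divfK // rmorphN /=; ring.
rewrite normrM ler_pM2l ?normr_gt0 //.
have /andP[h1 h2] := floor_itv (r / W + 1 / 2); rewrite -/k in h1 h2.
move: h1 h2; rewrite intrD; move: (r / W) (k%:~R : R) => q K; clear => h1 h2.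
by rewrite ler_norml; apply/andP; split; lra.
Qed.

(** In sup-norm coordinates [(U, W)] is a shortest vector and [(x, y)] completes it to a basis, with
    [y] reduced modulo [W]; so [|x| >= W]. If [y > 0], minimality of the difference gives
    [U (W - y) <= D - W ^ 2]. If [y <= 0], [U |y| <= D - W ^ 2], and the smaller of [U] and [|y|]
    has a small square. Either way one basis vector is near the midpoint of a side of the square. *)
Lemma l1_core_pos (R : realFieldType) (U W x y D : R) :
  0 <= U -> U <= W -> 0 < W -> `|y| <= W / 2 -> W * x - U * y = D -> 0 < D ->
  W <= `|x| \/ W <= `|y| -> W <= `|x - U| \/ W <= `|y - W| ->
  W ^+ 2 <= D /\ (D <= 2 * W ^+ 2 ->
    `|D - `|W ^+ 2 - U ^+ 2| | <= 3 * (D - W ^+ 2) \/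
    `|D - `|x ^+ 2 - y ^+ 2| | <= 3 * (D - W ^+ 2)).
Proof.
move=> U0 UW W0; rewrite ler_norml => /andP[y1 y2] DE D0 c1 c2.
have Wx : W <= `|x|.
  case: c1 => //; have : `|y| <= W / 2 by rewrite ler_norml y1 y2.
  by move=> h1 h2; clear -W0 h1 h2; lra.
have x0 : W <= x.
  case: (lerP 0 x) => xn; first by rewrite ger0_norm in Wx.
  exfalso; rewrite ltr0_norm // in Wx.
  have h1 : - (W * W / 2) <= U * y.
    have := ler_wpM2l U0 y1; have := ler_wpM2r (ltW W0) UW; clear; lra.
  have h2 : W * x <= - (W * W).
    by have := ler_wpM2l (ltW W0) Wx; rewrite mulrN lerNr.
  by have := mulr_gt0 W0 W0; clear -DE D0 h1 h2; lra.
have WU : U ^+ 2 <= W ^+ 2 by rewrite ler_pXn2r // nnegrE ltW.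
rewrite [`|W ^+ 2 - _|]ger0_norm ?subr_ge0 //.
case: (lerP y 0) => ys; last first.
  have {c2} : W <= x - U.
    case: c2; first by rewrite ger0_norm // subr_ge0 (le_trans UW).
    by rewrite ler0_norm; clear -ys y2 W0; lra.
  move=> h; have h1 : U * (W - y) <= D - W ^+ 2 by clear -h DE W0; nra.
  have h2 : U * W <= 2 * (D - W ^+ 2) by clear -h1 y2 U0; nra.
  have h3 : U ^+ 2 <= 2 * (D - W ^+ 2) by clear -h2 UW U0; nra.
  have h4 := sqr_ge0 U.
  split; first by clear -h3 h4; lra.
  by move=> _; left; rewrite ler_norml; apply/andP; split; clear -h3 h4; lra.
have h1 : U * - y <= D - W ^+ 2 by clear -x0 W0 DE; nra.
have eta0 : 0 <= D - W ^+ 2 by apply: le_trans h1; rewrite mulr_ge0 // oppr_ge0.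
split; first by clear -eta0; lra.
move=> D2; case: (lerP U (- y)) => Uy; [left|right].
  have : U ^+ 2 <= D - W ^+ 2 by clear -Uy U0 h1; nra.
  by have := sqr_ge0 U; rewrite ler_norml; clear -eta0 => a b; apply/andP; split; lra.
have h2 : y ^+ 2 <= D - W ^+ 2 by clear -Uy ys h1; nra.
have yx : y ^+ 2 <= x ^+ 2.
  rewrite -sqrrN ler_pXn2r // ?nnegrE; first by clear -y1 x0 W0; lra.
    by rewrite oppr_ge0.
  by clear -x0 W0; lra.
rewrite [`|x ^+ 2 - _|]ger0_norm ?subr_ge0 //.
have h3 : W ^+ 2 <= x ^+ 2 by rewrite ler_pXn2r // nnegrE; clear -x0 W0; lra.
have h4 : W * x <= D by clear -DE U0 ys; nra.
have h5 : x ^+ 2 - D <= 2 * (D - W ^+ 2).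
  have W2 : 0 < W ^+ 2 by rewrite exprn_gt0.
  rewrite -(ler_pM2l W2).
  have Wx0 : 0 <= W * x by rewrite mulr_ge0 ?(ltW W0) // (le_trans (ltW W0)).
  have : (W * x) ^+ 2 <= D ^+ 2 by rewrite ler_pXn2r // nnegrE ltW.
  by move: D2 eta0; rewrite exprMn; move: (W ^+ 2) (x ^+ 2) => w v; clear; nra.
have := sqr_ge0 y; rewrite ler_norml; clear -h2 h3 h5 eta0 => y0.
by apply/andP; split; lra.
Qed.

Lemma l1_core (R : realFieldType) (U W x y D : R) :
  `|U| <= `|W| -> W != 0 -> `|y| <= `|W| / 2 -> `|W * x - U * y| = D -> 0 < D ->
  `|W| <= `|x| \/ `|W| <= `|y| -> `|W| <= `|x - U| \/ `|W| <= `|y - W| ->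
  `|W| <= `|x + U| \/ `|W| <= `|y + W| ->
  W ^+ 2 <= D /\ (D <= 2 * W ^+ 2 ->
    `|D - `|W ^+ 2 - U ^+ 2| | <= 3 * (D - W ^+ 2) \/
    `|D - `|x ^+ 2 - y ^+ 2| | <= 3 * (D - W ^+ 2)).
Proof.
wlog W0 : U W / 0 < W => [h UW Wn0 yW DE D0 c1 c2 c3|].
  case: (ltrP 0 W) => [W0|W0]; first exact: h c3.
  have := h (- U) (- W); rewrite !normrN !sqrrN !opprK oppr_eq0; apply => //.
    by rewrite oppr_gt0 lt_neqAle Wn0.
  by rewrite -DE -normrN; congr `| _ |; ring.
rewrite (gtr0_norm W0).
wlog U0 : U x / 0 <= U => [h UW Wn0 yW DE D0 c1 c2 c3|].
  case: (lerP 0 U) => [U0|U0]; first exact: h c3.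
  have := h (- U) (- x); rewrite !normrN !sqrrN; apply => //.
  - by rewrite oppr_ge0 ltW.
  - by rewrite -DE -normrN; congr `| _ |; ring.
  - by rewrite (_ : - x - - U = - (x - U)) ?normrN //; ring.
  - by rewrite (_ : - x + - U = - (x + U)) ?normrN //; ring.
rewrite (ger0_norm U0).
wlog DD : x y / 0 <= W * x - U * y => [h UW Wn0 yW DE D0 c1 c2 c3|].
  case: (lerP 0 (W * x - U * y)) => [D1|D1]; first exact: h c3.
  have := h (- x) (- y); rewrite !normrN !sqrrN; apply => //.
  - by move: D1; clear; lra.
  - by rewrite -DE -normrN; congr `| _ |; ring.
  - rewrite (_ : - x - U = - (x + U)); last by ring.
    by rewrite (_ : - y - W = - (y + W)) ?normrN //; ring.
  - rewrite (_ : - x + U = - (x - U)); last by ring.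
    by rewrite (_ : - y + W = - (y - W)) ?normrN //; ring.
move=> UW _ yW; rewrite (ger0_norm DD) => DE D0 c1 c2 _.
exact: l1_core_pos.
Qed.

Lemma l1_max (R : realDomainType) (W a b : R) :
  W <= `|a| + `|b| -> W <= `|a + b| \/ W <= `|a - b|.
Proof.
case: (normr_or a) => ->; case: (normr_or b) => -> h; rewrite !ler_normr.
- by left; rewrite h.
- by right; rewrite h.
- by right; rewrite opprB [b - a]addrC h orbT.
- by left; rewrite opprD h orbT.
Qed.

Lemma l1_normE (R : realDomainType) (a b : R) : `|a - b| <= `|a + b| -> `|a| + `|b| = `|a + b|.
Proof.
move=> h; apply/eqP; rewrite eq_le ler_normD andbT.
by case: (l1_max (lexx (`|a| + `|b|))) => // h'; exact: le_trans h.
Qed.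

(** The coordinates [X - Y] and [X + Y] turn the taxicab norm into the sup norm, double the
    determinant, and turn the difference of squares into [4 X Y]. *)
Lemma l1_reduced_wlog (R : archiRealFieldType) (x1 y1 x2 y2 : R) (m n u v : int) :
  let D := `|x1 * y2 - x2 * y1| in
  let X := lc x1 x2 m n in let Y := lc y1 y2 m n in let W := `|X| + `|Y| in
  u * m + v * n = 1 -> 0 < D -> 0 < W -> `|X - Y| <= `|X + Y| ->
  (forall k l, (k, l) != (0, 0) -> W <= `|lc x1 x2 k l| + `|lc y1 y2 k l|) ->
  W ^+ 2 <= 2 * D /\
    (D <= W ^+ 2 -> exists k l : int, (exists u v, u * k + v * l = 1) /\
      `|D - 2 * `|lc x1 x2 k l * lc y1 y2 k l| | <= 3 / 2 * (2 * D - W ^+ 2)).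
Proof.
move=> D X Y W uv Dp W0 h min.
have WE : W = `|X + Y| := l1_normE h.
have s0 : X + Y != 0 by rewrite -normr_gt0 -WE.
have [k kP] := round_coef (lc x1 x2 (- v) u + lc y1 y2 (- v) u) s0.
pose i := k * m - v; pose j := k * n + u.
have ij : m * j - n * i = 1 by rewrite -uv /i /j; ring.
have nz (e i' j' : int) : i' = i + e * m -> j' = j + e * n -> (i', j') != (0, 0).
  move=> -> ->; apply/eqP => -[e1 e2].
  have : m * (j + e * n) - n * (i + e * m) = 1 by rewrite -ij; ring.
  by rewrite e1 e2 !mulr0 subrr.
set x' := lc x1 x2 i j; set y' := lc y1 y2 i j.
have yE : `|x' + y'| <= `|X + Y| / 2.
  rewrite (le_trans _ kP) // le_eqVlt; apply/orP; left; apply/eqP; congr `| _ |.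
  by rewrite /x' /y' /i /j /X /Y /lc; ring.
have detE : `|(X + Y) * (x' - y') - (X - Y) * (x' + y')| = 2 * D.
  have -> : (X + Y) * (x' - y') - (X - Y) * (x' + y') =
      - (2 * (m * j - n * i)%:~R * (x1 * y2 - x2 * y1)).
    by rewrite /X /Y /x' /y' /lc; ring.
  by rewrite ij mulr1 normrN normrM normr_nat.
have sym (a b : R) : W <= `|a| + `|b| -> `|X + Y| <= `|a - b| \/ `|X + Y| <= `|a + b|.
  by rewrite -WE => /l1_max[]; [right|left].
have c1 : `|X + Y| <= `|x' - y'| \/ `|X + Y| <= `|x' + y'|.
  by apply: sym; apply: min; apply: (nz 0); ring.
have c2 : `|X + Y| <= `|x' - y' - (X - Y)| \/ `|X + Y| <= `|x' + y' - (X + Y)|.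
  have := min (i - m) (j - n); rewrite (nz (-1)); [|ring|ring].
  move=> /(_ isT); have -> : lc x1 x2 (i - m) (j - n) = x' - X by rewrite /x' /X /lc; ring.
  have -> : lc y1 y2 (i - m) (j - n) = y' - Y by rewrite /y' /Y /lc; ring.
  move=> /sym; have -> : x' - X - (y' - Y) = x' - y' - (X - Y) by ring.
  by have -> : x' - X + (y' - Y) = x' + y' - (X + Y) by ring.
have c3 : `|X + Y| <= `|x' - y' + (X - Y)| \/ `|X + Y| <= `|x' + y' + (X + Y)|.
  have := min (i + m) (j + n); rewrite (nz 1); [|ring|ring].
  move=> /(_ isT); have -> : lc x1 x2 (i + m) (j + n) = x' + X by rewrite /x' /X /lc; ring.
  have -> : lc y1 y2 (i + m) (j + n) = y' + Y by rewrite /y' /Y /lc; ring.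
  move=> /sym; have -> : x' + X - (y' + Y) = x' - y' + (X - Y) by ring.
  by have -> : x' + X + (y' + Y) = x' + y' + (X + Y) by ring.
have [le2 near] := l1_core h s0 yE detE (mulr_gt0 (ltr0n _ 2) Dp) c1 c2 c3.
have WW : W ^+ 2 = (X + Y) ^+ 2 by rewrite WE real_normK ?num_real.
split; first by rewrite WW.
rewrite WW => /(ler_wpM2l (ler0n _ 2)) /near.
have four (a b c : R) : `|2 * D - `|c| | <= b ->
    c = 4 * a \/ c = - (4 * a) -> `|D - 2 * `|a| | <= b / 2.
  move=> hb cE; have e : `|c| = 4 * `|a|.
    by case: cE => ->; rewrite ?normrN normrM normr_nat.
  rewrite ler_pdivlMr // -[X in _ * X](gtr0_norm (ltr0n _ 2)) -normrM.
  by move: hb; rewrite e (_ : 2 * D - 4 * `|a| = (D - 2 * `|a|) * 2) //; ring.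
case=> /four {}near.
  exists m, n; split; first by exists u, v.
  rewrite (_ : 3 / 2 * _ = 3 * (2 * D - (X + Y) ^+ 2) / 2); last by ring.
  by rewrite -/X -/Y; apply: near; left; ring.
exists i, j; split; first by exists (- n), m; rewrite -ij; ring.
rewrite (_ : 3 / 2 * _ = 3 * (2 * D - (X + Y) ^+ 2) / 2); last by ring.
by rewrite -/x' -/y'; apply: near; right; ring.
Qed.

Lemma l1_reduced (R : archiRealFieldType) (x1 y1 x2 y2 : R) :
  let D := `|x1 * y2 - x2 * y1| in D != 0 ->
  exists W : R,
  [/\ exists m n : int, (m, n) != (0, 0) /\ W = `|lc x1 x2 m n| + `|lc y1 y2 m n|,
    forall k l, (k, l) != (0, 0) -> W <= `|lc x1 x2 k l| + `|lc y1 y2 k l|,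
    0 < W, W ^+ 2 <= 2 * D &
    D <= W ^+ 2 -> exists k l : int, (exists u v, u * k + v * l = 1) /\
      `|D - 2 * `|lc x1 x2 k l * lc y1 y2 k l| | <= 3 / 2 * (2 * D - W ^+ 2)].
Proof.
move=> D; rewrite normr_eq0 => D0.
have Dp : 0 < D by rewrite normr_gt0.
have pos k l : (k, l) != (0, 0) -> 0 < `|lc x1 x2 k l| + `|lc y1 y2 k l|.
  move=> kl; rewrite lt_neqAle addr_ge0 // andbT eq_sym paddr_eq0 // !normr_eq0.
  by apply: contra kl => /andP[/eqP h1 /eqP h2]; rewrite (lc_det_eq0 D0 h1 h2).
have [|m [n [[u [v uv]] min]]] := int2_min_prim (l1_bounded D0) _.
  move=> d m n d1 mn.
  have -> : lc x1 x2 (d * m) (d * n) = d%:~R * lc x1 x2 m n by rewrite /lc; ring.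
  have -> : lc y1 y2 (d * m) (d * n) = d%:~R * lc y1 y2 m n by rewrite /lc; ring.
  rewrite !normrM -mulrDr ltr_pMl ?pos //.
  by rewrite -intr_norm ltr1z; clear -d1; lia.
have mn : (m, n) != (0, 0).
  by apply/eqP => -[m0 n0]; move: uv; rewrite m0 n0 !mulr0.
have W0 := pos _ _ mn.
exists (`|lc x1 x2 m n| + `|lc y1 y2 m n|).
suff [h1 h2] : (`|lc x1 x2 m n| + `|lc y1 y2 m n|) ^+ 2 <= 2 * D /\
   (D <= (`|lc x1 x2 m n| + `|lc y1 y2 m n|) ^+ 2 ->
     exists k l : int, (exists u v, u * k + v * l = 1) /\
      `|D - 2 * `|lc x1 x2 k l * lc y1 y2 k l| | <=
         3 / 2 * (2 * D - (`|lc x1 x2 m n| + `|lc y1 y2 m n|) ^+ 2)).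
  by split => //; exists m, n.
case: (lerP `|lc x1 x2 m n - lc y1 y2 m n| `|lc x1 x2 m n + lc y1 y2 m n|) => h.
  exact: l1_reduced_wlog uv Dp W0 h min.
have lcN k l : lc (- y1) (- y2) k l = - lc y1 y2 k l by rewrite /lc; ring.
have := @l1_reduced_wlog R x1 (- y1) x2 (- y2) m n u v uv.
rewrite lcN normrN opprK (ltW h) (_ : `|x1 * - y2 - x2 * - y1| = D); last first.
  by rewrite /D -normrN; congr `| _ |; ring.
move=> /(_ Dp W0 isT)[].
  by move=> k l kl; rewrite lcN normrN; exact: min.
move=> h1 h2; split => // /h2[k [l [kl near]]]; exists k, l; split => //.
by move: near; rewrite lcN mulrN normrN.
Qed.

Local Open Scope classical_set_scope.
Local Open Scope ring_scope.

(** * Dirichlet improvability in terms of quadratic forms *)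

Lemma pnorm1E (R : realType) (z : R * R) : pnorm 1 z = `|z.1| + `|z.2|.
Proof. by rewrite /pnorm invr1 !powRr1 // addr_ge0. Qed.

Lemma pnorm2E (R : realType) (z : R * R) : pnorm 2 z = Num.sqrt (z.1 ^+ 2 + z.2 ^+ 2).
Proof.
rewrite /pnorm powR12_sqrt; last by rewrite addr_ge0 // powR_ge0.
by rewrite !powR_mulrn // !real_normK ?num_real.
Qed.

Lemma pnorm_ge0 (R : realType) (p : R) z : 0 <= pnorm p z.
Proof. exact: powR_ge0. Qed.

Lemma not_interior_pball (R : realType) (p : R) (z : R * R) :
  (forall (l : R), 0 <= l -> pnorm p (l * z.1, l * z.2) = l * pnorm p z) ->
  1 <= pnorm p z -> ~ interior (pball p) z.
Proof.
move=> hom z1 /nbhs_ballP[e /= e0 sub].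
pose d := e / (2 * (`|z.1| + `|z.2| + 1)).
have den : 0 < 2 * (`|z.1| + `|z.2| + 1) by rewrite mulr_gt0 // ltr_wpDl // addr_ge0.
have d0 : 0 < d by rewrite divr_gt0.
have small (x : R) : `|x| <= `|z.1| + `|z.2| -> `|x - (1 + d) * x| < e.
  move=> hx; have -> : x - (1 + d) * x = - (d * x) by ring.
  rewrite normrN normrM (gtr0_norm d0) /d mulrAC ltr_pdivrMr //.
  rewrite ltr_pM2l //; apply: (le_lt_trans hx).
  by have := normr_ge0 z.1; have := normr_ge0 z.2; lra.
have /sub : ball z e ((1 + d) * z.1, (1 + d) * z.2).
  by split; rewrite /= /ball /=; apply: small; rewrite ?lerDl ?lerDr.
rewrite /pball /= hom; last by rewrite addr_ge0 // ltW.
apply/negP; rewrite -ltNge; apply: lt_le_trans (_ : (1 + d) * 1 <= _).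
  by rewrite mulr1 ltrDl.
by rewrite ler_pM2l // addr_gt0.
Qed.

Lemma interior_pball (R : realType) (p : R) (z : R * R) :
  continuous (pnorm p) -> pnorm p z < 1 -> interior (pball p) z.
Proof.
move=> c z1.
have h : \forall y \near z, pnorm p y < 1 := cvgr_lt (pnorm p z) (c z) 1 z1.
suff : \forall y \near z, pball p y by [].
near=> y; rewrite /pball /=; apply: ltW; near: y; exact: h.
Unshelve. all: by end_near. Qed.

Lemma pnorm1_continuous (R : realType) : continuous (pnorm (1 : R)).
Proof.
have -> : pnorm (1 : R) = (fun z => `|z.1| + `|z.2|) by apply/funext => z; exact: pnorm1E.
move=> z; apply: cvgD.
  by apply: cvg_norm; exact: cvg_fst.
by apply: cvg_norm; exact: cvg_snd.
Qed.

Lemma pnorm2_continuous (R : realType) : continuous (pnorm (2 : R)).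
Proof.
have -> : pnorm (2 : R) = (fun z => Num.sqrt (z.1 * z.1 + z.2 * z.2)).
  by apply/funext => z; rewrite pnorm2E !expr2.
move=> z; apply: (@continuous_comp _ _ _ (fun z : R * R => z.1 * z.1 + z.2 * z.2) Num.sqrt);
  last exact: sqrt_continuous.
by apply: cvgD; apply: cvgM; (exact: cvg_fst || exact: cvg_snd).
Qed.

Lemma latticeE (R : realType) (u v : R * R) m n :
  u *~ m + v *~ n = (lc u.1 v.1 m n, lc u.2 v.2 m n).
Proof.
rewrite /lc !mulrzl; case: u v => [u1 u2] [v1 v2] /=.
have pairMz (x y : R) (k : int) : (x, y) *~ k = (x *~ k, y *~ k).
  by rewrite [LHS]surjective_pairing !raddfMz.
by rewrite !pairMz.
Qed.

Lemma admissible_norm (R : realType) (p : R) (L : set (R * R)) :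
  continuous (pnorm p) -> admissible p L -> forall z, L z -> z != 0 -> 1 <= pnorm p z.
Proof.
move=> c adm z Lz z0; rewrite leNgt; apply/negP => h.
exact: (adm z Lz z0 (interior_pball c h)).
Qed.

Lemma pnorm1_hom (R : realType) (z : R * R) l : 0 <= l ->
  pnorm 1 (l * z.1, l * z.2) = l * pnorm 1 z.
Proof. by move=> l0; rewrite !pnorm1E /= !normrM (ger0_norm l0) mulrDr. Qed.

Lemma pnorm2_hom (R : realType) (z : R * R) l : 0 <= l ->
  pnorm 2 (l * z.1, l * z.2) = l * pnorm 2 z.
Proof.
move=> l0; rewrite !pnorm2E /= !exprMn -mulrDr sqrtrM ?sqr_ge0 //.
by rewrite sqrtr_sqr (ger0_norm l0).
Qed.

Lemma inf_min (R : realType) (A : set R) d : A d -> (forall x, A x -> d <= x) -> inf A = d.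
Proof.
move=> Ad lb; apply/eqP; rewrite eq_le; apply/andP; split.
  by apply: ge_inf => //; exists d.
by apply: lb_le_inf => //; exists d.
Qed.

Lemma critical_det1 (R : realType) : critical_det (1 : R) = 1 / 2.
Proof.
apply: inf_min.
  exists (1 / 2, 1 / 2), (1 / 2, - (1 / 2)).
  have dE : det2 (1 / 2, 1 / 2) (1 / 2, - (1 / 2)) = - (1 / 2) :> R.
    by rewrite /det2 /=; lra.
  rewrite dE normrN ger0_norm; last by lra.
  split => //.
  move=> _ [m [n ->]] z0; apply: not_interior_pball; first by move=> l; exact: pnorm1_hom.
  rewrite pnorm1E latticeE /=.
  set x := lc _ _ _ _; set y := lc _ _ _ _.
  have xy1 : x + y = m%:~R by rewrite /x /y /lc; lra.
  have xy2 : x - y = n%:~R by rewrite /x /y /lc; lra.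
  have : 1 <= `|m%:~R : R| \/ 1 <= `|n%:~R : R|.
    have [m0|m0] := eqVneq m 0; [right|left]; rewrite -intr_norm ler1z -gtz0_ge1 normr_gt0 //.
    apply: contra z0 => /eqP n0; rewrite m0 n0 !mulr0z addr0 //.
  rewrite -xy1 -xy2 => -[|] /le_trans; apply; first exact: ler_normD.
  exact: ler_normB.
move=> _ [u [v [D0 adm ->]]].
have D0' : `|u.1 * v.2 - v.1 * u.2| != 0 by move: D0; rewrite normr_eq0 /det2 (mulrC v.1).
have [W [[m [n [mn WE]]] _ W0 W2 _]] := l1_reduced D0'.
have W1 : 1 <= W.
  rewrite WE; have := admissible_norm (@pnorm1_continuous R) adm (z := u *~ m + v *~ n).
  rewrite pnorm1E latticeE /=; apply; first by exists m, n; rewrite latticeE.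
  apply/eqP => -[h1 h2]; move: W0; rewrite WE h1 h2 !normr0 addr0 ltxx //.
rewrite /det2 (mulrC u.2); move: W2 W1; move: `|_| => d; clear; nra.
Qed.

Lemma critical_det2 (R : realType) : critical_det (2 : R) = Num.sqrt 3 / 2.
Proof.
have [r1 r2 r3] := sqrt3P R; set r := Num.sqrt 3 in r1 r2 r3 *.
apply: inf_min.
  exists (1, 0), (1 / 2, r / 2).
  have dE : det2 (1, 0) (1 / 2, r / 2) = r / 2 :> R.
    by rewrite /det2 /= mul1r mul0r subr0.
  have rp : 0 < r / 2 by lra.
  rewrite dE gtr0_norm //; split => //; first by rewrite gt_eqF.
  move=> _ [m [n ->]] z0; apply: not_interior_pball; first by move=> l; exact: pnorm2_hom.
  rewrite pnorm2E latticeE /=.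
  have -> : lc 1 (1 / 2) m n ^+ 2 + lc 0 (r / 2) m n ^+ 2 = (m ^+ 2 + m * n + n ^+ 2)%:~R :> R.
    by rewrite /lc; field: r3.
  rewrite -[leLHS]sqrtr1 ler_sqrt; last first.
    by rewrite ler0z; clear; nia.
  rewrite ler1z -gtz0_ge1.
  have : (m != 0) || (n != 0).
    by rewrite -negb_and; apply: contra z0 => /andP[/eqP -> /eqP ->]; rewrite !mulr0z addr0.
  by clear; nia.
move=> _ [u [v [D0 adm ->]]].
have D0' : u.1 * v.2 - v.1 * u.2 != 0 by move: D0; rewrite /det2 (mulrC v.1).
have [m [n [m' [n' [d1 min A0 /andP[B1 B2] AC]]]]] := l2_reduced D0'.
set X1 := lc u.1 v.1 m n in A0 B1 B2 AC; set Y1 := lc u.2 v.2 m n in A0 B1 B2 AC.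
set X2 := lc u.1 v.1 m' n' in B1 B2 AC; set Y2 := lc u.2 v.2 m' n' in B1 B2 AC.
have A1 : 1 <= X1 ^+ 2 + Y1 ^+ 2.
  have N1 : 1 <= pnorm 2 (u *~ m + v *~ n).
    apply: (admissible_norm (@pnorm2_continuous R) adm); first by exists m, n.
    rewrite latticeE; apply/eqP => -[h1 h2].
    by move: A0; rewrite /X1 /Y1 h1 h2 expr0n addr0 ltxx.
  move: N1; rewrite pnorm2E latticeE /= -/X1 -/Y1 => N1.
  by rewrite -(sqr_sqrtr (ltW A0)) exprn_ege1.
have det : (X1 * Y2 - X2 * Y1) ^+ 2 = `|det2 u v| ^+ 2.
  have -> : X1 * Y2 - X2 * Y1 = (m * n' - n * m')%:~R * det2 u v.
    by rewrite /X1 /X2 /Y1 /Y2 /lc /det2; ring.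
  by rewrite -real_normK ?num_real // normrM -intr_norm d1 mul1r.
have key : (X1 ^+ 2 + Y1 ^+ 2) * (X2 ^+ 2 + Y2 ^+ 2) =
    (X1 * X2 + Y1 * Y2) ^+ 2 + (X1 * Y2 - X2 * Y1) ^+ 2 by ring.
rewrite det in key.
move: (X1 ^+ 2 + Y1 ^+ 2) (X2 ^+ 2 + Y2 ^+ 2) (X1 * X2 + Y1 * Y2) A1 B1 B2 AC key => A C B.
have := normr_ge0 (det2 u v); move: (`|_|) => d d0.
move: r1 r3; clearbody r; clear -d0 => r1 r3 A1 B1 B2 AC key.
have : 3 / 4 <= d ^+ 2 by nra.
by nra.
Qed.

Lemma powR_neg_half (R : realType) (x : R) : 0 <= x -> x `^ (- 2^-1) = Num.sqrt x^-1.
Proof. by move=> x0; rewrite powRN powR12_sqrt // sqrtrV. Qed.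

Lemma lambda1_le (R : realType) (p al t : R) z :
  Lambda al t z -> z != 0 -> lambda1 p al t <= pnorm p z.
Proof.
move=> Lz z0; apply: ge_inf; last by exists z.
by exists 0 => _ [y _ <-]; exact: pnorm_ge0.
Qed.

Lemma lambda1_ge (R : realType) (p al t c : R) : 0 < t ->
  (forall z, Lambda al t z -> z != 0 -> c <= pnorm p z) -> c <= lambda1 p al t.
Proof.
move=> t0 h; apply: lb_le_inf; last by move=> _ [z [Lz z0] <-]; exact: h.
exists (pnorm p (0, t)), (0, t) => //; split.
  by exists 0, 1; rewrite mulr0 mul0r subr0 mulr1.
by apply/eqP => -[/eqP]; rewrite gt_eqF.
Qed.

Lemma DI_intro (R : realType) (p al k e : R) : critical_det p = k^-1 -> 0 < k -> 0 < e ->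
  (forall t, 0 < t -> exists z, [/\ Lambda al t z, z != 0 & pnorm p z ^+ 2 <= k - e]) -> DI p al.
Proof.
move=> cd k0 e0 h; rewrite /DI /= cd powR_neg_half ?invr_ge0 ?(ltW k0) // invrK.
apply: (@le_lt_trans _ _ (Num.sqrt (k - e))%:E); last first.
  by rewrite lte_fin ltr_sqrt // ltrBlDr ltrDl.
apply: ge_ereal_inf; exists (ereal_sup ((fun t => (lambda1 p al t)%:E) @` [set t | 0 < t])).
  by exists [set t | 0 < t] => //; exists 0; split.
apply: ge_ereal_sup => _ [t t0 <-]; rewrite lee_fin.
have [z [Lz z0 zk]] := h t t0; apply: le_trans (lambda1_le p Lz z0) _.
by rewrite -(ger0_norm (pnorm_ge0 p z)) -sqrtr_sqr ler_wsqrtr.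
Qed.

Lemma not_DI_intro (R : realType) (p al k : R) : critical_det p = k^-1 -> 0 < k ->
  (forall e B, 0 < e -> exists t, [/\ 0 < t, B < t &
    forall z, Lambda al t z -> z != 0 -> k - e <= pnorm p z ^+ 2]) -> ~ DI p al.
Proof.
move=> cd k0 h; rewrite /DI /= cd powR_neg_half ?invr_ge0 ?(ltW k0) // invrK.
move=> /ereal_inf_lt[_ [V [M [_ MV]] <-]] lt.
pose c := Num.sqrt k.
have c0 : 0 < c by rewrite sqrtr_gt0.
have sup_ge t : M < t ->
    ((lambda1 p al t)%:E <= ereal_sup ((fun t => (lambda1 p al t)%:E) @` V))%E.
  by move=> Mt; apply: ereal_sup_ubound; exists t => //; exact: MV.
move: (ereal_sup _) lt sup_ge => [r| |] lt sup_ge //; last first.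
  by have := sup_ge (M + 1); rewrite ltrDl ltr01 => /(_ isT).
rewrite lte_fin -/c in lt.
pose q := Num.max r 0; have q0 : 0 <= q by rewrite le_max lexx orbT.
have qc : q < c by rewrite gt_max lt c0.
have qk : q ^+ 2 < k by rewrite -(sqr_sqrtr (ltW k0)) ltr_pXn2r // nnegrE // ltW.
have [|t [t0 Mt ht]] := h ((k - q ^+ 2) / 2) M; first by rewrite divr_gt0 // subr_gt0.
have := sup_ge t Mt; rewrite lee_fin; apply/negP; rewrite -ltNge.
apply: (@lt_le_trans _ _ (Num.sqrt (k - (k - q ^+ 2) / 2))).
  apply: (@le_lt_trans _ _ q); first by rewrite le_max lexx.
  by rewrite -[ltLHS](ger0_norm q0) -sqrtr_sqr ltr_sqrt; move: qk (sqr_ge0 q); lra.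
apply: lambda1_ge => // z Lz z0.
by rewrite -(ger0_norm (pnorm_ge0 p z)) -sqrtr_sqr ler_wsqrtr // ht.
Qed.

Lemma Lambda_lc (R : realType) (al t : R) (k l : int) :
  Lambda al t (lc t^-1 0 k l, lc (- t * al) t k l).
Proof. by exists k, l; rewrite /lc; congr (_, _); ring. Qed.

Lemma Lambda_lc_neq0 (R : realType) (al t : R) (k l : int) : t != 0 -> (k, l) != (0, 0) ->
  (lc t^-1 0 k l, lc (- t * al) t k l) != (0, 0).
Proof.
move=> t0; apply: contra => /eqP -[h1 h2].
rewrite (@lc_det_eq0 R t^-1 (- t * al) 0 t k l) // mul0r subr0 mulVf // oner_neq0.
Qed.

Lemma square_form_prod (R : realType) (al t : R) (k l : int) : t != 0 ->
  psi (k ^+ 2) (- 2 * (k * l)) al = - 2 * (lc t^-1 0 k l * lc (- t * al) t k l).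
Proof. by move=> t0; rewrite /psi /lc; field. Qed.

(** A nearly extremal minimum yields a primitive vector with [2 |X Y|] near 1. The product [X Y]
    does not depend on [t]: up to sign [2 X Y] is the [psi] of a square form at [al]. *)
Lemma DI1_intro (R : realType) (al e : R) : 0 < e ->
  (forall a b c t, square_form a b c -> 0 < a -> `|t| = 1 -> e <= `|psi a b al - t%:~R|) ->
  DI 1 al.
Proof.
move=> e0 avoid.
have cd := critical_det1 R; rewrite mul1r in cd.
pose e' := Num.min e 1.
have e'0 : 0 < e' by rewrite lt_min e0 ltr01.
have e'1 : e' <= 1 by rewrite ge_min lexx orbT.
apply: (DI_intro (e := e' / 2) cd) => //; first by rewrite divr_gt0.
move=> t t0; have tn0 : t != 0 by rewrite gt_eqF.
have detE : t^-1 * t - 0 * (- t * al) = 1 by rewrite mul0r subr0 mulVf.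
have [|W [[m [n [mn WE]]] min W0 W2 near]] := @l1_reduced R t^-1 (- t * al) 0 t.
  by rewrite detE normr1 oner_neq0.
exists (lc t^-1 0 m n, lc (- t * al) t m n); split.
- exact: Lambda_lc.
- exact: Lambda_lc_neq0.
rewrite pnorm1E /= -WE leNgt; apply/negP => big.
move: near W2; rewrite detE normr1 mulr1 => near W2.
have [|k [l [kl]]] := near; first by move: big; lra.
(* A vertical vector has product 0 and no target; it is excluded because [e' <= 1]. *)
have [k0|k0] := eqVneq k 0.
  rewrite {1}/lc k0 mul0r mulr0 addr0 mul0r normr0 mulr0 subr0 normr1.
  by move: big; lra.
have key (t' : int) : `|t'| = 1 -> e' <= `|psi (k ^+ 2) (- 2 * (k * l)) al - t'%:~R|.
  move=> t1; apply: (le_trans (_ : e' <= e)); first by rewrite ge_min lexx.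
  apply: avoid t1; last by rewrite exprn_even_gt0.
  by exists k, l.
have := key 1 (normr1 _); have := key (- 1) (normrN1 _).
rewrite (square_form_prod _ _ _ tn0) mulrN1z mulr1z.
rewrite opprK; move: (lc _ _ _ _ * _) => P h1 h2.
have : e' <= `|1 - 2 * `|P| |.
  case: (normr_or P) => ->.
    by rewrite -normrN (_ : - (1 - 2 * P) = - (- 2 * P + 1)) ?normrN //; ring.
  by rewrite -normrN (_ : - (1 - 2 * - P) = - 2 * P - 1) //; ring.
by move: big; lra.
Qed.

Lemma not_DI1_intro (R : realType) (al : R) :
  (forall m : nat, exists a b c t, [/\ square_form a b c, m%:Z < a, `|t| = 1 &
    `|psi a b al - t%:~R| * m.+1%:R <= 1]) -> ~ DI 1 al.
Proof.
move=> near; have cd := critical_det1 R; rewrite mul1r in cd.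
apply: (not_DI_intro cd) => // e B e0.
pose m := (Num.truncn (`|2 / e| + B ^+ 2)).+1.
have mP : `|2 / e| + B ^+ 2 < m%:R by exact: truncnS_gt.
have [a [b [c [t0 [sf ma t01 close]]]]] := near m.
have a0 : 0 < a by apply: le_lt_trans ma.
have [q [p [q0 [u [v uv]] aE bE _]]] := square_form_pos sf a0.
have qR := intr_ge1 R q0; have qR0 : 0 < q%:~R :> R by apply: lt_le_trans qR.
set h := p%:~R - q%:~R * al.
have psiE : psi a b al = - 2 * (q%:~R * h) by rewrite /psi aE bE /h; ring.
pose s := q%:~R * `|h|.
have m0 : 0 < m.+1%:R :> R by [].
have eta : `|2 * s - 1| <= m.+1%:R^-1.
  rewrite -ler_pdivlMr // mul1r in close; apply: le_trans close.
  apply: le_trans (ler_dist_dist _ _); rewrite -intr_norm t01.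
  by rewrite psiE !normrM normrN normr_nat (gtr0_norm qR0).
have eta_e : m.+1%:R^-1 <= e / 2.
  rewrite -[leRHS]invrK lef_pV2 ?posrE ?invr_gt0 ?divr_gt0 // invf_div.
  rewrite -natr1; have := ler_norm (2 / e); have := sqr_ge0 B; lra.
have m2 : 2 <= m.+1%:R :> R by rewrite ler_nat.
have eta2 : m.+1%:R^-1 <= 1 / 2 :> R by rewrite mul1r lef_pV2 ?posrE.
move: (m.+1%:R^-1) eta eta_e eta2 => d; rewrite ler_norml => /andP[s1 s2] d1 d2.
have s0 : 0 < s by lra.
pose w := Num.sqrt s; have w0 : 0 < w by rewrite sqrtr_gt0.
have w2 : w ^+ 2 = s by rewrite sqr_sqrtr ?(ltW s0).
(* At this time both coordinates of the vector given by [(q, p)] have absolute value [w], so it lies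
   near the midpoint of a side. Its multiples have squared norm at least [4 s]; any other vector has
   determinant at least 1 with it, hence squared norm at least [1 / s]. Both are close to 2, as [s]
   is close to [1 / 2]. *)
pose t := q%:~R / w; have t0' : 0 < t by rewrite divr_gt0.
have tn0 : t != 0 by rewrite gt_eqF.
have XE : q%:~R / t = w by rewrite /t invf_div mulrCA divff ?mulr1 ?gt_eqF.
have YE : `|t * h| = w.
  rewrite normrM (gtr0_norm t0') /t mulrAC -/s -w2 expr2 mulfK //.
  by rewrite gt_eqF.
exists t; split => //.
- have w1 : w <= 1 by rewrite -sqrtr1 ler_wsqrtr //; lra.
  have qt : q%:~R <= t by rewrite ler_pdivlMr // ler_piMr // ltW.
  apply: lt_le_trans qt; have : B ^+ 2 < q%:~R ^+ 2.
    have : m%:R < a%:~R :> R by rewrite -[m%:R]/(m%:Z%:~R) ltr_int.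
    by rewrite aE rmorphXn /= => /(lt_trans mP); have := normr_ge0 (2 / e); lra.
  rewrite -[B ^+ 2]real_normK ?num_real // ltr_pXn2r ?nnegrE ?(ltW qR0) //.
  exact: le_lt_trans (ler_norm B).
move=> _ [k [l ->]] z0; rewrite pnorm1E /=.
set x := t^-1 * _; set y := t * _.
have jE : w * y - (t * h) * x = (q * l - p * k)%:~R.
  by rewrite -XE /x /y /h; field.
have [j0|j0] := eqVneq (q * l - p * k) 0.
  pose r := u * k + v * l.
  have kE : k = q * r.
    transitivity (k * (u * q + v * p) + v * (q * l - p * k)); first by rewrite uv j0; ring.
    by rewrite /r; ring.
  have lE : l = p * r.
    transitivity (l * (u * q + v * p) - u * (q * l - p * k)); first by rewrite uv j0; ring.
    by rewrite /r; ring.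
  have r1 : 1 <= `|r%:~R : R|.
    rewrite -intr_norm ler1z -gtz0_ge1 normr_gt0; apply: contra z0 => /eqP r0.
    by rewrite kE lE r0 !mulr0 mul0r subrr mulr0.
  have xE : `|x| = `|r%:~R| * w.
    by rewrite -(gtr0_norm w0) -normrM -XE /x kE; congr `| _ |; field.
  have yE : `|y| = `|r%:~R| * w.
    by rewrite -YE -normrM /y kE lE /h; congr `| _ |; ring.
  rewrite xE yE; have : (2 * w) ^+ 2 <= (`|r%:~R| * w + `|r%:~R| * w) ^+ 2.
    rewrite ler_pXn2r // ?nnegrE ?addr_ge0 ?mulr_ge0 ?(ltW w0) //.
    have := ler_wpM2r (ltW w0) r1; lra.
  by rewrite exprMn w2; lra.
have j1 : 1 <= `|w * y - t * h * x|.
  by rewrite jE -intr_norm ler1z -gtz0_ge1 normr_gt0.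
have j2 : 1 <= w * (`|x| + `|y|).
  apply: (le_trans j1); apply: le_trans (ler_normB _ _) _.
  by rewrite (normrM w) (normrM (t * h)) YE (gtr0_norm w0) mulrDr [leRHS]addrC.
have : 1 <= s * (`|x| + `|y|) ^+ 2 by rewrite -w2 -exprMn exprn_ege1.
move: (_ ^+ 2) (sqr_ge0 (`|x| + `|y|)) => Z Z0 h1.
by clear -s0 s1 s2 d1 d2 h1 Z0; nra.
Qed.

(* In a reduced basis close to the hexagonal one, the discriminant identity
   [C X1 Y1 - B / 2 (X1 Y2 + X2 Y1) + A X2 Y2 = 0] makes [M] small. *)
Lemma hex_defect (R : realFieldType) (X1 Y1 X2 Y2 A B C : R) :
  A = X1 ^+ 2 + Y1 ^+ 2 -> B = 2 * (X1 * X2 + Y1 * Y2) -> C = X2 ^+ 2 + Y2 ^+ 2 ->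
  (X1 * Y2 - X2 * Y1) ^+ 2 = 1 -> 1 <= A -> - A <= B -> B <= 0 -> A <= C ->
  `|2 * (X1 * Y1) + X1 * Y2 + X2 * Y1 + 2 * (X2 * Y2)| <= 2 * (4 - 3 * A ^+ 2).
Proof.
move=> AE BE CE d A1 B1 B2 AC.
have disc : 4 * A * C - B ^+ 2 = 4.
  transitivity (4 * (X1 * Y2 - X2 * Y1) ^+ 2); last by rewrite d mulr1.
  by rewrite AE BE CE; ring.
set M := _ + _ + _ + _.
have ME : M * A = 2 * (A - C) * (X1 * Y1) + (A + B) * (X1 * Y2 + X2 * Y1).
  by rewrite /M AE BE CE; ring.
set k := 4 - 3 * A ^+ 2.
have BA : B ^+ 2 <= A ^+ 2 by clear -B1 B2 A1; nra.
have kC : 4 * A * (C - A) <= k by rewrite /k; clear -disc BA; nra.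
have kB : (A + B) * (A - B) <= k by rewrite /k; clear -disc AC A1; nra.
have k0 : 0 <= k by apply: le_trans kB; rewrite mulr_ge0; clear -B1 B2 A1; lra.
have hB : (A + B) * A <= k.
  by apply: le_trans kB; rewrite ler_wpM2l //; clear -B1 B2; lra.
have xy : `|X1 * Y1| <= A / 2.
  rewrite AE ler_norml; have := sqr_ge0 (X1 + Y1); have := sqr_ge0 (X1 - Y1).
  by clear => h1 h2; apply/andP; split; nra.
have xy2 : `|X1 * Y2 + X2 * Y1| <= (A + C) / 2.
  rewrite AE CE ler_norml; have := sqr_ge0 (X1 + Y2); have := sqr_ge0 (X1 - Y2).
  have := sqr_ge0 (X2 + Y1); have := sqr_ge0 (X2 - Y1).
  by clear => h1 h2 h3 h4; apply/andP; split; nra.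
have CA : C <= A + k / 4 by clear -kC A1 AC k0; nra.
have k1 : k <= 1 by rewrite /k; clear -A1; nra.
have h1 : `|M| * A <= 2 * (C - A) * (A / 2) + (A + B) * ((A + C) / 2).
  rewrite -{1}(ger0_norm (le_trans ler01 A1)) -normrM ME.
  apply: le_trans (ler_normD _ _) _; rewrite lerD // normrM.
    rewrite normrM distrC (ger0_norm (_ : 0 <= C - A)) ?subr_ge0 // normr_nat.
    by rewrite ler_wpM2l // mulr_ge0 // subr_ge0.
  have AB0 : 0 <= A + B by clear -B1; lra.
  by rewrite (ger0_norm AB0) ler_wpM2l.
have h2 : 2 * (C - A) * (A / 2) <= k / 4 by clear -kC; nra.
have h3 : (A + B) * ((A + C) / 2) <= k * 9 / 8.
  have AB0 : 0 <= A + B by clear -B1; lra.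
  have c1 : (A + C) / 2 <= A * (9 / 8) by clear -CA k1 A1; lra.
  have := ler_wpM2l AB0 c1; move: hB; clear; nra.
move: (normr_ge0 M) h1; move: (`|M|) => N N0 h1.
by clear -A1 N0 h1 h2 h3 k0; nra.
Qed.

Lemma DI2_intro (R : realType) (al e : R) : 0 < e ->
  (forall a b c, hex_form a b c -> e <= `|psi a b al|) -> DI 2 al.
Proof.
move=> e0 avoid.
have [r1 r2 r3] := sqrt3P R; set r := Num.sqrt 3 in r1 r2 r3 *.
have cd : critical_det (2 : R) = (2 / r)^-1 by rewrite critical_det2 invf_div.
have r0 : 0 < r by lra.
pose k := 2 / r; have k0 : 0 < k by rewrite divr_gt0.
have k2 : 3 * k ^+ 2 = 4 by rewrite /k expr_div_n r3; field.
have kb : k <= 12 / 10 by rewrite /k ler_pdivrMr //; lra.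
have kb' : 11 / 10 <= k by rewrite /k ler_pdivlMr //; lra.
pose e' := Num.min e 1.
have e'0 : 0 < e' by rewrite lt_min e0 ltr01.
have e'1 : e' <= 1 by rewrite ge_min lexx orbT.
have e'e : e' <= e by rewrite ge_min lexx.
(* As [3 k ^ 2 = 4], a squared minimum above [k - e' / 100] makes the bound [2 (4 - 3 A ^ 2)] on the
   defect less than [e']. *)
apply: (DI_intro (e := e' / 100) cd k0); first by rewrite divr_gt0.
move=> t t0; have tn0 : t != 0 by rewrite gt_eqF.
have detE : t^-1 * t - 0 * (- t * al) = 1 by rewrite mul0r subr0 mulVf.
have [|m [n [m' [n' [d1 min A0 /andP[B1 B2] AC]]]]] := @l2_reduced R t^-1 (- t * al) 0 t.
  by rewrite detE oner_neq0.
exists (lc t^-1 0 m n, lc (- t * al) t m n).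
have mn : (m, n) != (0, 0).
  by apply/eqP => -[m0 n0]; move: d1; rewrite m0 n0 !mul0r subrr normr0.
split; [exact: Lambda_lc|exact: Lambda_lc_neq0|].
rewrite pnorm2E /= sqr_sqrtr ?(ltW A0) // leNgt; apply/negP => big.
set X1 := lc t^-1 0 m n in A0 B1 B2 AC big; set Y1 := lc (- t * al) t m n in A0 B1 B2 AC big.
set X2 := lc t^-1 0 m' n' in B1 B2 AC; set Y2 := lc (- t * al) t m' n' in B1 B2 AC.
have A1 : 1 <= X1 ^+ 2 + Y1 ^+ 2 by move: big kb' e'1; rewrite -/k; lra.
have d2 : (m * n' - n * m') ^+ 2 = 1 by rewrite -[LHS]real_normK ?num_real // d1 expr1n.
have dXY : (X1 * Y2 - X2 * Y1) ^+ 2 = 1.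
  have -> : X1 * Y2 - X2 * Y1 = (m * n' - n * m')%:~R.
    by rewrite /X1 /X2 /Y1 /Y2 /lc; field.
  by rewrite -rmorphXn /= d2.
have := hex_defect erefl erefl erefl dXY A1 B1 B2 AC.
(* The form whose critical point corresponds to the hexagonal lattice with this basis. Its [psi] at
   [al] is minus the defect, as products of a first and a second coordinate do not depend on [t]. *)
pose a := m ^+ 2 + m * m' + m' ^+ 2.
pose b := - (2 * (m * n) + m * n' + m' * n + 2 * (m' * n')).
pose c := n ^+ 2 + n * n' + n' ^+ 2.
have hf : hex_form a b c.
  split; last first.
    by transitivity (- 3 * (m * n' - n * m') ^+ 2); [rewrite /a /b /c; ring|rewrite d2 mulr1].
  have mm : (m != 0) || (m' != 0).
    rewrite -negb_and; apply/negP => /andP[/eqP m0 /eqP m0'].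
    by move: d2; rewrite m0 m0' mul0r mulr0 subrr expr0n.
  by rewrite /a; move: mm; clear; nia.
have := avoid _ _ _ hf.
have -> : psi a b al = - (2 * (X1 * Y1) + X1 * Y2 + X2 * Y1 + 2 * (X2 * Y2)).
  by rewrite /psi /a /b /X1 /X2 /Y1 /Y2 /lc; field.
rewrite normrN => h1 h2; have {h1 h2} h := le_trans h1 h2.
move: big h; rewrite -/k; move: (_ + _) A1 => A A1 big h.
have : k * (2 * (e' / 100)) <= 3 / 100 * e' by move: kb; clear -e'0; nra.
by clear -e'0 e'1 e'e kb kb' k2 A1 big h; nra.
Qed.

Lemma perturbed_norm_bound (R : realFieldType) (r g d x y : R) :
  r ^+ 2 = 3 -> 0 < r -> r <= 2 -> `|g| <= d ->
  (r * y + g * x) ^+ 2 + 3 * x ^+ 2 <= (x ^+ 2 + y ^+ 2) * (3 + 2 * d + d ^+ 2).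
Proof.
move=> r2 r0 r2' gd.
have d0 : 0 <= d := le_trans (normr_ge0 g) gd.
have g2 : g ^+ 2 <= d ^+ 2.
  by rewrite -[g ^+ 2]real_normK ?num_real // ler_pXn2r // nnegrE.
have h1 : g ^+ 2 * x ^+ 2 <= (x ^+ 2 + y ^+ 2) * d ^+ 2.
  rewrite mulrC; apply: ler_pM; rewrite ?sqr_ge0 //.
  by rewrite lerDl sqr_ge0.
have xy : `|2 * (x * y)| <= x ^+ 2 + y ^+ 2.
  rewrite ler_norml; have := sqr_ge0 (x + y); have := sqr_ge0 (x - y).
  by clear => h2 h3; apply/andP; split; nra.
have h2 : r * g * (2 * (x * y)) <= 2 * d * (x ^+ 2 + y ^+ 2).
  apply: (le_trans (ler_norm _)); rewrite normrM; apply: ler_pM => //.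
  by rewrite normrM (gtr0_norm r0); apply: ler_pM => //; exact: ltW.
have -> : (r * y + g * x) ^+ 2 + 3 * x ^+ 2 =
   3 * (x ^+ 2 + y ^+ 2) + r * g * (2 * (x * y)) + g ^+ 2 * x ^+ 2 by ring: r2.
by move: h1 h2; move: (x ^+ 2 + y ^+ 2) (d ^+ 2) (g ^+ 2 * _) (r * g * _); clear => *; nra.
Qed.

Lemma not_DI2_intro (R : realType) (al : R) :
  (forall m : nat, exists a b c, [/\ hex_form a b c, m%:Z < a &
    `|psi a b al| * m.+1%:R <= 1]) -> ~ DI 2 al.
Proof.
move=> near.
have [r1 r2 r3] := sqrt3P R; set r := Num.sqrt 3 in r1 r2 r3 *.
have cd : critical_det (2 : R) = (2 / r)^-1 by rewrite critical_det2 invf_div.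
have r0 : 0 < r by lra.
pose k := 2 / r; have k0 : 0 < k by rewrite divr_gt0.
have kr : k * r = 2 by rewrite /k divfK ?gt_eqF.
have kb : k <= 12 / 10 by rewrite /k ler_pdivrMr //; lra.
have kb' : 11 / 10 <= k by rewrite /k ler_pdivlMr //; lra.
apply: (not_DI_intro cd k0) => e B e0.
pose m := (Num.truncn (`|4 / e| + B ^+ 2)).+1.
have mP : `|4 / e| + B ^+ 2 < m%:R by exact: truncnS_gt.
have [a [b [c [[a0 disc] ma close]]]] := near m.
have aR := intr_ge1 R a0.
have m0 : 0 < m.+1%:R :> R by [].
have eta_e : m.+1%:R^-1 <= e / 4.
  rewrite -[leRHS]invrK lef_pV2 ?posrE ?invr_gt0 ?divr_gt0 // invf_div.
  rewrite -natr1; have := ler_norm (4 / e); have := sqr_ge0 B; lra.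
have m2 : 2 <= m.+1%:R :> R by rewrite ler_nat.
have eta2 : m.+1%:R^-1 <= 1 / 2 :> R by rewrite mul1r lef_pV2 ?posrE.
rewrite -ler_pdivlMr // mul1r in close.
move: (m.+1%:R^-1) close eta_e eta2 => d close d1 d2.
(* With this [t], if [psi] were 0 the squared norm of a lattice vector would be exactly [2 / sqrt 3]
   times the value of the form, an integer at least 1. *)
pose t := Num.sqrt (a%:~R * k).
have ak0 : 0 < a%:~R * k by rewrite mulr_gt0 // (lt_le_trans ltr01).
have t0 : 0 < t by rewrite sqrtr_gt0.
have tn0 : t != 0 by rewrite gt_eqF.
have t2 : t ^+ 2 = a%:~R * k by rewrite sqr_sqrtr ?(ltW ak0).
exists t; split => //.
  have : B ^+ 2 < t ^+ 2.
    have : m%:R < a%:~R :> R by rewrite -[m%:R]/(m%:Z%:~R) ltr_int.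
    by rewrite t2 => /(lt_trans mP); have := normr_ge0 (4 / e); move: aR kb'; clear; nra.
  rewrite -[B ^+ 2]real_normK ?num_real // ltr_pXn2r ?nnegrE ?(ltW t0) //.
  exact: le_lt_trans (ler_norm B).
move=> _ [q [p ->]] z0; rewrite pnorm2E /=.
set x := t^-1 * _; set y := t * _.
rewrite sqr_sqrtr ?addr_ge0 ?sqr_ge0 //.
pose f := a * p ^+ 2 + b * p * q + c * q ^+ 2.
have f4 : 4 * a * f = (2 * a * p + b * q) ^+ 2 + 3 * q ^+ 2.
  transitivity ((2 * a * p + b * q) ^+ 2 - (b ^+ 2 - 4 * a * c) * q ^+ 2); first by rewrite /f; ring.
  by rewrite disc; ring.
have f1 : 1 <= f%:~R :> R.
  apply: intr_ge1; rewrite -(pmulr_rgt0 _ (_ : 0 < 4 * a)); last by clear -a0; lia.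
  rewrite f4; have : (p != 0) || (q != 0).
    rewrite -negb_and; apply: contra z0 => /andP[/eqP p0 /eqP q0].
    by rewrite /x /y p0 q0 mul0r subrr !mulr0.
  have [q0|q0] := eqVneq q 0.
    rewrite orbF => p0.
    have -> : (2 * a * p + b * q) ^+ 2 + 3 * q ^+ 2 = (2 * a * p) ^+ 2 by rewrite q0; ring.
    rewrite exprn_even_gt0 //=.
    by rewrite !mulf_neq0 // gt_eqF.
  by rewrite ltr_wpDl ?sqr_ge0 // mulr_gt0 // exprn_even_gt0.
have qE : q%:~R = t * x by rewrite /x mulVKf.
have key : 2 * r * f%:~R = (r * y + psi a b al * x) ^+ 2 + 3 * x ^+ 2.
  have e1 : (2 * a * p + b * q)%:~R = t * (r * y + psi a b al * x).
    have -> : t * (r * y + psi a b al * x) =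
      r * t ^+ 2 * (p%:~R - q%:~R * al) + psi a b al * (t * x) by rewrite /y; ring.
    rewrite -qE t2 /psi (_ : r * (a%:~R * k) = 2 * a%:~R); first by ring.
    by rewrite mulrC -mulrA kr mulrC.
  apply: (mulfI (_ : t ^+ 2 != 0)); first by rewrite sqrf_eq0.
  transitivity ((4 * a * f)%:~R : R).
    rewrite t2 !intrM; move: (f%:~R : R) => F.
    transitivity (2 * (k * r) * a%:~R * F); first by clearbody k; ring.
    by rewrite kr; ring.
  rewrite f4 rmorphD rmorphXn /= e1 rmorphM rmorphXn /= qE; ring.
have bd : 2 * r <= (x ^+ 2 + y ^+ 2) * (3 + 2 * d + d ^+ 2).
  have h1 : 2 * r <= 2 * r * f%:~R by rewrite ler_peMr // mulr_ge0 // ltW.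
  apply: (le_trans h1); rewrite key.
  by apply: perturbed_norm_bound r3 r0 _ close; clear -r2; lra.
have S0 : 0 <= x ^+ 2 + y ^+ 2 by rewrite addr_ge0 ?sqr_ge0.
have rk : 2 * r = 3 * k.
  by apply: (mulfI (_ : r != 0)); rewrite ?gt_eqF // mulrCA -expr2 r3 mulrCA (mulrC r) kr mulrC.
have d0 : 0 <= d by apply: le_trans close.
rewrite rk in bd; move: (x ^+ 2 + y ^+ 2) S0 bd => S S0 bd.
rewrite leNgt; apply/negP => small.
have Sk : S <= k by apply: ltW; apply: lt_trans small _; rewrite ltrBlDr ltrDl.
have dd : 2 * d + d ^+ 2 <= 5 / 2 * d by clear -d0 d2; nra.
have dd0 : 0 <= 2 * d + d ^+ 2 by rewrite addr_ge0 ?sqr_ge0 // mulr_ge0.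
have e1 := ler_pM S0 dd0 Sk dd.
have kd : k * (5 / 2 * d) <= 12 / 10 * (5 / 2 * d) by rewrite ler_wpM2r // mulr_ge0.
rewrite (_ : S * _ = 3 * S + S * (2 * d + d ^+ 2)) in bd; last by ring.
move: bd e1 kd; move: (S * (2 * d + d ^+ 2)) (k * (5 / 2 * d)) => P Q bd e1 kd.
rewrite -/k in small; clearbody k; clear -bd e1 small d1 kd e0; lra.
Qed.

(** * A Cantor construction against a cover of small mass *)

Lemma powR_expNn (R : realType) (a s : R) k : 0 <= a -> (a ^- k) `^ s = (a `^ (- s)) ^+ k.
Proof.
move=> a0; have e : a ^- k = a `^ (- k%:R) by rewrite powR_invn.
rewrite e -powRrM.
have := powR_mulrn k (powR_ge0 a (- s)).
move=> <-.
rewrite -powRrM.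
by rewrite mulNr mulrC mulNr.
Qed.

Lemma far_intervals (R : realDomainType) (l p q a b : R) :
  2 * l <= `|p - q| -> p <= a -> a <= p + l -> q <= b -> b <= q + l -> l <= `|a - b|.
Proof.
have := ler_norm (a - b); have := ler_norm (- (a - b)); rewrite normrN.
by case: (normr_or (p - q)) => ->; lra.
Qed.

Lemma scale_ge (R : realFieldType) (v r m : R) :
  0 <= v -> 2 <= m * r -> v <= v * (r / 2) * m.
Proof. by move=> v0 mr; have -> : v * (r / 2) * m = v * (m * r / 2); [ring|nra]. Qed.

Lemma expr_small (R : realType) (z e : R) : 0 <= z -> z < 1 -> 0 < e ->
  exists n : nat, z ^+ n < e.
Proof.
move=> z0 z1 e0; have /cvg_expr/cvgr0Pnorm_lt/(_ _ e0)[n _ h] : `|z| < 1 by rewrite ger0_norm.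
by exists n; have := h n (leqnn n); rewrite ger0_norm // exprn_ge0.
Qed.

Section Game.
Context {R : realType}.
Context (N M : nat) (s : R) (P G : nat -> R -> Prop).
Context (U : nat -> set R) (w : nat -> R).
Context (N_gt1 : (1 < N)%N) (s_gt0 : 0 < s).

Let len (k : nat) : R := N%:R ^- k.
Let rho : R := N%:R `^ (- s).
Let inI (k : nat) (x a : R) := x <= a <= x + len k.
Let meets (i k : nat) (x : R) := exists2 a, U i a & inI k x a.
(** The mass of the members of the cover that meet the interval, bounded through all finite partial
    sums. *)
Let light (v : R) (k : nat) (x : R) :=
  forall n, \sum_(i < n | `[< meets i k x >]) w i <= v.

Context (M_rho : 2 <= M%:R * rho).
Context (normal : forall k x, P k x -> exists (n : nat) (y : 'I_n -> R) (B : {set 'I_n}),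
  [/\ (M <= #|B|)%N, forall j, j \in B -> P k.+1 (y j),
   forall j, j \in B -> x <= y j /\ y j + len k.+1 <= x + len k
   & forall i j, i != j -> 2 * len k.+1 <= `|y i - y j|]).
(** [J] depends on [m] but not on the level: the loss is known before the generic descent that must
    compensate for it. *)
Context (special : forall m, exists J : nat, forall k x, P k x -> exists x',
  [/\ P (k + J).+1 x', x <= x', x' + len (k + J).+1 <= x + len k
    & forall a, inI (k + J).+1 x' a -> G m a]).
Context (w_gt0 : forall i, 0 < w i).
Context (w_diam : forall i a b, U i a -> U i b -> `|a - b| `^ s <= w i).

Let N0 : 0 < N%:R :> R. Proof. by rewrite ltr0n ltnW. Qed.
Let len_gt0 k : 0 < len k. Proof. by rewrite invr_gt0 exprn_gt0. Qed.
Let rho_gt0 : 0 < rho. Proof. exact: powR_gt0. Qed.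
Let half_lt1 : rho < 1 -> rho / 2 < 1.
Proof. by have := rho_gt0; lra. Qed.
Let rho_lt1 : rho < 1.
Proof.
rewrite /rho powRN invf_lt1 ?powR_gt0 //.
have := @gt0_ltr_powR R s s_gt0 1 N%:R; rewrite powR1 /=; apply.
- by rewrite nnegrE.
- by rewrite nnegrE ltW.
- by rewrite ltr1n.
Qed.
Let len_rho k : len k `^ s = rho ^+ k.
Proof.
by rewrite /len /rho powR_expNn // ltW.
Qed.

Let light_sub v k x k' x' :
  x <= x' -> x' + len k' <= x + len k -> light v k x -> light v k' x'.
Proof.
move=> h1 h2 lt n; apply: le_trans (lt n).
rewrite big_mkcond [leRHS]big_mkcond /=; apply: ler_sum => i _.
case: asboolP => [[a Ua /andP[a1 a2]]|_]; last by case: ifP => // _; exact: ltW.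
rewrite ifT //; apply/asboolP; exists a => //.
by rewrite /inI (le_trans h1) //= (le_trans a2).
Qed.

Let light_term v k x i : light v k x -> meets i k x -> w i <= v.
Proof.
move=> lt mi; apply: le_trans (lt i.+1).
rewrite big_mkcond big_ord_recr /= ifT; last exact/asboolP.
by rewrite lerDr sumr_ge0 // => j _; case: ifP => // _; exact: ltW.
Qed.

(** Pigeonhole. A member of the cover that meets the interval has weight below [rho ^+ k.+1], hence
    diameter less than a child, and the spacing lets it meet one child only. Some child therefore
    receives at most the fraction [1 / M <= rho / 2] of the mass. *)
Let child v k x : P k x -> light v k x -> 0 <= v -> v < rho ^+ k.+1 ->
  exists y, [/\ P k.+1 y, x <= y, y + len k.+1 <= x + len k & light (v * (rho / 2)) k.+1 y].
Proof.
move=> Px lt v0 vr; have [n [y [B [MB PB yB ysep]]]] := normal Px.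
have M0 : 0 < M%:R :> R.
  by rewrite -(pmulr_lgt0 _ rho_gt0); apply: lt_le_trans M_rho.
apply: contrapT => none.
have bad j : j \in B -> exists n', v * (rho / 2) < \sum_(i < n' | `[< meets i k.+1 (y j) >]) w i.
  move=> jB; apply: contrapT => h; apply: none; exists (y j).
  have [h1 h2] := yB _ jB; split => //; first exact: PB.
  by move=> n'; rewrite leNgt; apply/negP => h'; apply: h; exists n'.
have /choice[nn nnP] : forall j, exists n', j \in B ->
    v * (rho / 2) < \sum_(i < n' | `[< meets i k.+1 (y j) >]) w i.
  by move=> j; case: (boolP (j \in B)) => [/bad[n' h]|_]; [exists n'|exists 0%N].
pose nm := (\max_(j in B) nn j)%N.
have low j : j \in B -> v * (rho / 2) < \sum_(i < nm | `[< meets i k.+1 (y j) >]) w i.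
  move=> jB; apply: (lt_le_trans (nnP _ jB)).
  have le : (nn j <= nm)%N by apply: leq_bigmax_cond.
  rewrite !(big_mkcond (fun i => `[< _ >])) /= (big_ord_widen _ (fun i : nat => if `[< meets i k.+1 (y j) >] then w i else 0) le).
  rewrite [leRHS](bigID (fun i : 'I_nm => (i < nn j)%N)) /= lerDl sumr_ge0 // => i _.
  by case: ifP => // _; exact: ltW.
have tot : \sum_(j in B) \sum_(i < nm | `[< meets i k.+1 (y j) >]) w i <= v.
  apply: le_trans (lt nm).
  under eq_bigr do rewrite big_mkcond /=.
  rewrite exchange_big /= [leRHS]big_mkcond /=; apply: ler_sum => i _.
  case: (pselect (exists2 j, j \in B & meets i k.+1 (y j))) => [[j jB mj]|nj]; last first.
    rewrite big1; first by case: ifP => // _; exact: ltW.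
    by move=> j jB; case: asboolP => // mj; case: nj; exists j.
  have mi : meets i k x.
    case: mj => a Ua /andP[a1 a2]; exists a => //; have [h1 h2] := yB _ jB.
    by rewrite /inI (le_trans h1) //= (le_trans a2).
  rewrite ifT; last exact/asboolP.
  rewrite (bigD1 j) //= ifT; last exact/asboolP.
  rewrite big1 ?addr0 // => j' /andP[jB' jj']; case: asboolP => // mj'.
  exfalso; case: mj => a Ua /andP[a1 a2]; case: mj' => b Ub /andP[b1 b2].
  have wv := light_term lt mi.
  have sep := ysep _ _ jj'.
  have ab : len k.+1 <= `|a - b|.
    rewrite distrC; exact: (far_intervals sep b1 b2 a1 a2).
  have := w_diam Ua Ub; apply/negP; rewrite -ltNge.
  apply: (le_lt_trans wv); apply: (lt_le_trans vr); rewrite -len_rho.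
  by rewrite ge0_ler_powR ?nnegrE ?(ltW s_gt0) ?(ltW (len_gt0 _)).
have B_gt0 : (0 < #|B|)%N by apply: leq_trans MB; rewrite -(ltr0n R).
have : \sum_(j in B) (v * (rho / 2)) < v.
  apply: lt_le_trans tot; apply: ltr_sum => //.
  by have /card_gt0P[j jB] := B_gt0; apply/hasP; exists j => //; exact: mem_index_enum.
rewrite sumr_const; apply/negP; rewrite -leNgt -[leRHS]mulr_natr.
have MB' : M%:R <= #|B|%:R :> R by rewrite ler_nat.
apply: scale_ge => //; apply: (le_trans M_rho).
by rewrite ler_wpM2r // ltW.
Qed.

Let children v k x L : P k x -> light v k x -> 0 <= v -> v < rho ^+ k.+1 ->
  exists y, [/\ P (k + L)%N y, x <= y, y + len (k + L) <= x + len k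
    & light (v * (rho / 2) ^+ L) (k + L) y].
Proof.
move=> Px lt v0 vr; elim: L => [|L [y [Py y1 y2 lty]]].
  by exists x; rewrite addn0 expr0 mulr1; split.
have [||y' [Py' y1' y2' lty']] := child Py lty.
- by rewrite mulr_ge0 // exprn_ge0 // divr_ge0 // ltW.
- rewrite -addSn exprD; apply: (@le_lt_trans _ _ (v * rho ^+ L)).
    by rewrite ler_wpM2l // lerXn2r ?nnegrE; have := rho_gt0; lra.
  by rewrite ltr_pM2r // exprn_gt0.
exists y'; rewrite addnS; split => //.
- exact: le_trans y1'.
- exact: le_trans y2.
- by rewrite exprS (mulrC (rho / 2)) mulrA.
Qed.

(* Generic levels divide the relative mass of the cover by 2; enough of them are
   inserted to pay for the [J] uncontrolled levels of the special step. *)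
Let stage (m k : nat) (x : R) : P k x -> light (rho / 2 * rho ^+ k) k x ->
  exists k' x', [/\ (k < k')%N, P k' x', light (rho / 2 * rho ^+ k') k' x',
    x <= x' /\ x' + len k' <= x + len k & forall a, inI k' x' a -> G m a].
Proof.
move=> Px lt; have [J HJ] := special m.
have [L HL] : exists L : nat, (1 / 2) ^+ L <= rho ^+ J.+1.
  have [||L HL] := @expr_small R (1 / 2) _ _ _ (exprn_gt0 J.+1 rho_gt0); [lra|lra|].
  by exists L; exact: ltW.
have [||y [Py y1 y2 lty]] := children L Px lt.
- by rewrite !mulr_ge0 // ?exprn_ge0 // ?invr_ge0 // ltW.
- rewrite exprS ltr_pM2r ?exprn_gt0 //; have := rho_gt0; lra.
have [x' [Px' x1 x2 Gx]] := HJ _ _ Py.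
exists (k + L + J).+1, x'; split => //.
- by rewrite ltnS -addnA leq_addr.
- have := light_sub x1 x2 lty.
  move=> h n; apply: (le_trans (h n)).
  have -> : ((k + L + J).+1 = k + L + J.+1)%N by rewrite addnS.
  rewrite !exprD (mulrA (rho / 2)) (mulrA (rho / 2)) -(mulrA _ _ (rho ^+ J.+1)) ler_wpM2l //.
    by rewrite !mulr_ge0 // ?exprn_ge0 // ?invr_ge0 // ltW.
  by rewrite exprMn ler_wpM2l ?exprn_ge0 ?(ltW rho_gt0) //; move: HL; rewrite mul1r.
- by split; [exact: le_trans x1|exact: le_trans y2].
Qed.

Lemma game_win (x0 : R) : P 0 x0 -> (forall n, \sum_(i < n) w i <= rho / 2) ->
  exists a, [/\ forall m, G m a,
    forall m, exists k x, [/\ (m <= k)%N, P k x & x <= a <= x + N%:R ^- k]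
    & forall i, ~ U i a].
Proof.
move=> P0 tot.
pose St := {z : nat * R | P z.1 z.2 /\ light (rho / 2 * rho ^+ z.1) z.1 z.2}.
have lt0 : light (rho / 2 * rho ^+ 0) 0 x0.
  move=> n; rewrite expr0 mulr1; apply: le_trans (tot n).
  by rewrite big_mkcond /=; apply: ler_sum => i _; case: ifP => // _; exact: ltW.
have /choice[nxt nxtP] : forall mz : nat * St, exists z' : St,
   [/\ ((sval mz.2).1 < (sval z').1)%N, (sval mz.2).2 <= (sval z').2,
      (sval z').2 + len (sval z').1 <= (sval mz.2).2 + len (sval mz.2).1
    & forall a, inI (sval z').1 (sval z').2 a -> G mz.1 a].
  move=> [m [[k x] /= [Px ltx]]].
  have [k' [x' [kk' Px' lt' [h1 h2] Gx]]] := stage m Px ltx.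
  by exists (exist _ (k', x') (conj Px' lt')).
pose z := fix z (m : nat) : St := if m is m'.+1 then nxt (m', z m')
  else exist _ (0%N, x0) (conj P0 lt0).
pose kk m := (sval (z m)).1; pose xx m := (sval (z m)).2.
have kP m : (m <= kk m)%N.
  elim: m => // m IH; have [h _ _ _] := nxtP (m, z m).
  exact: leq_ltn_trans h.
have nest m n : (m <= n)%N -> xx m <= xx n /\ xx n + len (kk n) <= xx m + len (kk m).
  elim: n => [|n IH]; first by rewrite leqn0 => /eqP ->.
  rewrite leq_eqVlt => /orP[/eqP -> //|]; rewrite ltnS => /IH[h1 h2].
  have [_ h3 h4 _] := nxtP (n, z n); split; first exact: le_trans h3.
  exact: le_trans h2.
have ub m n : xx n <= xx m + len (kk m).
  have := len_gt0 (kk m); have := len_gt0 (kk n).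
  by case: (leqP m n) => [/nest[]|/ltnW/nest[]]; lra.
have hs : has_sup (range xx).
  split; first by exists (xx 0%N); exists 0%N.
  by exists (xx 0%N + len (kk 0%N)) => _ [n _ <-]; exact: ub.
pose a := sup (range xx).
have aP m : inI (kk m) (xx m) a.
  apply/andP; split; first by apply: (ub_le_sup hs.2); exists m.
  by apply: ge_sup => [|_ [n _ <-]]; [exact: hs.1|exact: ub].
exists a; split.
- move=> m; have [_ _ _] := nxtP (m, z m); apply; exact: (aP m.+1).
- move=> m; exists (kk m), (xx m); split => //; [exact: (svalP (z m)).1|exact: aP].
- move=> i Ua.
  have small m : w i <= rho ^+ m.
    have lt := (svalP (z m)).2; have := light_term lt (ex_intro2 _ _ a Ua (aP m)).
    move=> h; apply: (le_trans h); apply: (@le_trans _ _ (rho ^+ kk m)).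
      by rewrite ler_piMl ?exprn_ge0 ?(ltW rho_gt0) // ltW // half_lt1.
    by rewrite ler_wiXn2l ?(ltW rho_gt0) ?(ltW rho_lt1).
  have [L HL] := expr_small (ltW rho_gt0) rho_lt1 (w_gt0 i).
  by have := small L; rewrite leNgt HL.
Qed.
End Game.

(** * Hausdorff dimension *)

Lemma sum_geo_half (R : realFieldType) (e : R) n : 0 <= e ->
  \sum_(i < n) e * (1 / 2) ^+ i.+1 <= e.
Proof.
move=> e0; have -> : \sum_(i < n) e * (1 / 2) ^+ i.+1 = e - e * (1 / 2) ^+ n.
  elim: n => [|n IH]; first by rewrite big_ord0 expr0 mulr1 subrr.
  by rewrite big_ord_recr /= IH exprS; move: (_ ^+ n) => y; field.
by rewrite lerBlDr lerDl mulr_ge0 // exprn_ge0.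
Qed.

(** A positive exponent [s'] is needed even when [s = 0]; diameters are at most 1, so raising the
    exponent only lowers the costs. A geometric term makes every weight positive. *)
Lemma measure0_cover (R : realType) (s s' e : R) (A : set R) :
  0 <= s -> s <= s' -> 0 < s' -> 0 < e -> hausdorff_measure s A = 0%E ->
  exists (U : nat -> set R) (w : nat -> R),
  [/\ A `<=` \bigcup_i U i, forall i, 0 < w i,
    forall i a b, U i a -> U i b -> `|a - b| `^ s' <= w i
    & forall n, \sum_(i < n) w i <= e].
Proof.
move=> s0 ss' s'0 e0 mA.
have : (hausdorff_content s 1 A < (e / 2)%:E)%E.
  apply: (@le_lt_trans _ _ (hausdorff_measure s A)).
    by apply: ereal_sup_ubound; exists 1 => //=.
  by rewrite mA lte_fin divr_gt0.
move=> /ereal_inf_lt[_ [U /= [AU U1] <-]] lt.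
pose d i := fine (diam (U i)).
have dE i : U i !=set0 -> diam (U i) = (d i)%:E /\ 0 <= d i <= 1.
  move=> [x Ux]; have h0 : (0 <= diam (U i))%E.
    by apply: ereal_sup_ubound; exists x => //; exists x => //; rewrite subrr normr0.
  have fn : diam (U i) \is a fin_num.
    by rewrite ge0_fin_numE //; apply: le_lt_trans (U1 i) _; rewrite ltry.
  have e1 : diam (U i) = (d i)%:E by rewrite fineK.
  by split => //; move: h0 (U1 i); rewrite e1 !lee_fin => -> ->.
pose v i := if `[< U i !=set0 >] then d i `^ s else 0.
have v0 i : 0 <= v i by rewrite /v; case: ifP => // _; exact: powR_ge0.
exists U, (fun i => v i + e / 2 * (1 / 2) ^+ i.+1); split => //.
- by move=> i; rewrite ltr_wpDl // mulr_gt0 ?divr_gt0 // exprn_gt0 // divr_gt0.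
- move=> i a b Ua Ub; have Ui : U i !=set0 by exists a.
  have [dEi /andP[d0 d1]] := dE i Ui.
  have abd : `|a - b| <= d i.
    by rewrite -lee_fin -dEi; apply: ereal_sup_ubound; exists a => //; exists b.
  apply: (@le_trans _ _ (v i)); last first.
    by rewrite lerDl mulr_ge0 ?exprn_ge0 ?divr_ge0 // ltW.
  rewrite /v ifT; last exact/asboolP.
  apply: (@le_trans _ _ (`|a - b| `^ s)).
    have [->|ab0] := eqVneq a b.
      by rewrite subrr normr0 powR0 ?gt_eqF // powR_ge0.
    apply: ger_powR => //; rewrite normr_gt0 subr_eq0 ab0 /=; exact: le_trans d1.
  by rewrite ge0_ler_powR // nnegrE.
- move=> n; rewrite big_split /=.
  have h1 : \sum_(i < n) v i <= e / 2.
    rewrite -lee_fin; apply: le_trans (ltW lt).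
    apply: le_trans (@nneseries_lim_ge _ _ _ 0 n _); last first.
      by move=> k _ _; exact: poweR_ge0.
    rewrite big_mkord -sumEFin [leRHS]big_mkcond /=; apply: lee_sum => i _.
    rewrite /v; case: asboolP => [Ui|nUi].
      have [-> _] := dE i Ui; rewrite poweR_EFin.
      by rewrite ifT //; apply/set0P.
    by case: ifP => // /set0P.
  have := @sum_geo_half R (e / 2) n (ltW _); move/(_ (divr_gt0 e0 _)) => h2.
  by have := h2 (ltr0n _ 2); move: h1; lra.
Qed.

(** Exactly [2 ^ K] indices have logarithm [K], so the sum over complete blocks is geometric of
    ratio [2 q]. *)
Lemma sum_trunc_log (R : realFieldType) (q : R) n : 0 <= q -> q < 1 / 2 ->
  \sum_(i < n) q ^+ trunc_log 2 i.+1 <= 1 / (1 - 2 * q).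
Proof.
move=> q0 q1.
have step K : \sum_(0 <= i < (2 ^ K).-1) q ^+ trunc_log 2 i.+1 = \sum_(k < K) (2 * q) ^+ k.
  elim: K => [|K IH]; first by rewrite big_nil big_ord0.
  rewrite big_ord_recr /= -IH (@big_cat_nat _ _ _ (2 ^ K).-1) //=; last first.
    by rewrite -!subn1 leq_sub2r // leq_exp2l.
  congr (_ + _); rewrite big_nat.
  rewrite (eq_bigr (fun=> q ^+ K)); last first.
    move=> i /andP[i1 i2]; congr (_ ^+ _); apply: trunc_log_eq => //.
    have := expn_gt0 2 K; have := expn_gt0 2 K.+1; rewrite /= => h1 h2.
    apply/andP; split; clear -i1 i2 h1 h2; lia.
  rewrite -big_nat sumr_const_nat -[LHS]mulr_natl exprMn -natrX; congr (_%:R * _).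
  by rewrite expnS; have := expn_gt0 2 K; clear; lia.
rewrite -(big_mkord xpredT (fun i => q ^+ trunc_log 2 i.+1)).
apply: (@le_trans _ _ (\sum_(0 <= i < (2 ^ n).-1) q ^+ trunc_log 2 i.+1)).
  rewrite (@big_cat_nat _ _ _ n 0 (2 ^ n).-1) //=.
    by rewrite lerDl sumr_ge0 // => i _; exact: exprn_ge0.
  by rewrite -ltnS prednK ?expn_gt0 // ltn_expl.
rewrite step ler_pdivlMr; last by lra.
have -> : (\sum_(k < n) (2 * q) ^+ k) * (1 - 2 * q) = 1 - (2 * q) ^+ n.
  elim: n => [|m IH]; first by rewrite big_ord0 mul0r expr0 subrr.
  by rewrite big_ord_recr /= mulrDl IH exprSr; ring.
by rewrite lerBlDr lerDl exprn_ge0 // mulr_ge0.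
Qed.

Section UpperBound.
Context (R : realType) (s : R).
Context (s1 : 1 < s).

Let beta : R := 2^-1 `^ s^-1.
Let bs : beta `^ s = 2^-1.
Proof. by rewrite /beta -powRrM mulVf ?powRr1 ?gt_eqF // (lt_trans _ s1). Qed.
Let beta_gt : 1 / 2 < beta.
Proof.
have s0 : 0 < s by exact: lt_trans s1.
have e12 : 1 / 2 = 2^-1 :> R by rewrite mul1r.
rewrite lt_neqAle; apply/andP; split; last first.
  rewrite e12 -[leLHS]powRr1 ?invr_ge0 //; apply: ger_powR; last by rewrite invf_le1 // ltW.
  by rewrite invr_gt0 ltr0n invf_le1 // ler1n.
apply/eqP => h; have h0 : 0 <= (1 / 2 : R) by lra.
have := mulr_powRB1 h0 s0; rewrite [X in _ = X `^ _]h bs e12 => h2.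
have /eqP : 2^-1 `^ (s - 1) = 1 :> R.
  by apply: (mulfI (_ : 2^-1 != 0)); rewrite ?invr_eq0 // h2 mulr1.
rewrite powR_eq1 subr_eq0 (gt_eqF s1) orbF => /orP[/eqP|]; last by rewrite invr_lt0 ltrn0.
lra.
Qed.

(** A single sequence covers the whole line: block [k] consists of [2 ^ k] adjacent intervals of
    length [eta b ^ k]. As [b > 1 / 2], the blocks exhaust the line; as [b ^ s < 1 / 2], the total
    cost converges, and [eta] makes it small. *)
Lemma hausdorff_measure_gt1 (A : set R) : hausdorff_measure s A = 0%E.
Proof.
have [b [b1 b2]] : exists b, 1 / 2 < b /\ b < beta.
  by exists ((1 / 2 + beta) / 2); have := beta_gt; split; lra.
have b0 : 0 < b by lra.
have s0 : 0 < s by exact: lt_trans s1.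
have beta1 : beta <= 1.
  have h := @powR1 R; have : beta <= 1 `^ s^-1; last by rewrite h.
  by rewrite ge0_ler_powR ?nnegrE ?invr_ge0 ?(ltW s0) ?invf_le1 ?ler1n.
pose q := b `^ s.
have q0 : 0 < q by exact: powR_gt0.
have q1 : q < 1 / 2.
  rewrite mul1r -bs; apply: gt0_ltr_powR => //; rewrite nnegrE ?powR_ge0 //; exact: ltW.
apply/eqP; rewrite eq_le; apply/andP; split; last first.
  apply: le_ereal_sup_tmp; exists (hausdorff_content s 1 A); first by exists 1 => //=.
  apply: le_ereal_inf_tmp => _ [V _ <-].
  by apply: nneseries_ge0 => n _ _; exact: poweR_ge0.
apply: ge_ereal_sup => _ [delta /= delta0 <-].
apply/lee_addgt0Pr => e e0; rewrite add0e.
pose eta := Num.min (Num.min delta 1) (e * (1 - 2 * q)).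
have eta0 : 0 < eta by rewrite !lt_min delta0 ltr01 mulr_gt0 //; lra.
have eta_d : eta <= delta by rewrite !ge_min lexx.
have eta_1 : eta <= 1 by rewrite !ge_min lexx !orbT.
have eta_e : eta <= e * (1 - 2 * q) by rewrite ge_min lexx orbT.
pose L k := eta * b ^+ k.
have L0 k : 0 < L k by rewrite mulr_gt0 // exprn_gt0.
(* Writing [i.+1 = 2 ^ k + j] with [j < 2 ^ k], [U i] is the [j]-th interval of block [k], which is
   centred at 0. *)
pose lv i := trunc_log 2 i.+1; pose ix i := (i.+1 - 2 ^ lv i)%N.
pose lo i := (ix i)%:R * L (lv i) - 2 ^+ (lv i) * L (lv i) / 2.
pose U i : set R := [set x | lo i <= x <= lo i + L (lv i)].
have dU i : (diam (U i) <= (L (lv i))%:E)%E.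
  apply: ge_ereal_sup => _ [x /= /andP[x1 x2] [y /andP[y1 y2] <-]].
  by rewrite lee_fin ler_norml; apply/andP; split; lra.
apply: (@le_trans _ _ (\sum_(i <oo | U i != set0) (diam (U i) `^ s))%E).
  apply: ereal_inf_lbound; exists U => //; split.
    move=> x _.
    have [k Hk] : exists k : nat, `|x| < eta * (2 * b) ^+ k / 2.
      have b20 : 0 < 2 * b by lra.
      have [|||k hk] := @expr_small R (1 / (2 * b)) (eta / (2 * (`|x| + 1))).
      - by rewrite divr_ge0 // ltW.
      - by rewrite ltr_pdivrMr // mul1r; lra.
      - by rewrite divr_gt0 // mulr_gt0 // ltr_wpDl.
      exists k; move: hk; rewrite expr_div_n expr1n ltr_pdivrMr ?exprn_gt0 //.
      rewrite mulrAC ltr_pdivlMr; last by rewrite mulr_gt0 // ltr_wpDl.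
      by lra.
    have e2 : 2 ^+ k * L k = eta * (2 * b) ^+ k by rewrite /L exprMn mulrCA.
    have xlo : - x <= `|x| by rewrite -normrN ler_norm.
    have xhi := ler_norm x.
    pose y := (x + 2 ^+ k * L k / 2) / L k.
    have y0 : 0 <= y by rewrite divr_ge0 ?(ltW (L0 _)) // e2; lra.
    have y2 : y < 2 ^+ k by rewrite ltr_pdivrMr // e2; lra.
    pose j := Num.truncn y.
    have /andP[j1 j2] : j%:R <= y < j.+1%:R by exact: truncn_itv.
    have jk : (j < 2 ^ k)%N by rewrite -(ltr_nat R) natrX; exact: le_lt_trans y2.
    have ik : ((2 ^ k + j).-1.+1 = 2 ^ k + j)%N by rewrite prednK // addn_gt0 expn_gt0.
    exists (2 ^ k + j).-1%N => //.
    have lvk : lv (2 ^ k + j).-1%N = k.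
      rewrite /lv ik; apply: trunc_log_eq => //.
      by rewrite leq_addr expnS mul2n -addnn ltn_add2l.
    rewrite /U /= /lo /ix lvk ik addKn.
    have yL : y * L k = x + 2 ^+ k * L k / 2 by rewrite /y divfK // gt_eqF.
    have h1 := ler_wpM2r (ltW (L0 k)) j1.
    have := ler_wpM2r (ltW (L0 k)) (ltW j2).
    rewrite -natr1 mulrDl mul1r yL; move: h1; rewrite yL => h1 h2.
    by apply/andP; split; lra.
  move=> i; apply: (le_trans (dU i)); rewrite lee_fin; apply: le_trans eta_d.
  by rewrite ler_piMr ?(ltW eta0) // exprn_ile1 ?(ltW b0) // (le_trans (ltW b2)).
apply: lime_le.
  by apply: is_cvg_nneseries => n _ _; exact: poweR_ge0.
near=> n.
rewrite big_mkord.
apply: (@le_trans _ _ (\sum_(i < n) (eta * q ^+ lv i)%:E)%E).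
  rewrite big_mkcond /=; apply: lee_sum => i _.
  case: ifP => [/set0P[x Ux]|_]; last by rewrite lee_fin mulr_ge0 ?exprn_ge0 // ltW.
  apply: (@le_trans _ _ ((L (lv i))%:E `^ s)%E).
    apply: gt0_ler_poweR; [exact: ltW| | |exact: dU].
      rewrite in_itv /= leey andbT; apply: ereal_sup_ubound.
      by exists x => //; exists x => //; rewrite subrr normr0.
    by rewrite in_itv /= leey andbT lee_fin ltW.
  rewrite poweR_EFin lee_fin /L powRM ?exprn_ge0 ?(ltW eta0) ?(ltW b0) //.
  apply: ler_pM; rewrite ?powR_ge0 //.
    by apply: ge1r_powR; rewrite ?eta0 //= ltW.
  by rewrite /q -!powR_mulrn ?powR_ge0 ?(ltW b0) // -!powRrM mulrC.
rewrite sumEFin lee_fin -mulr_sumr.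
have S0 : 0 <= \sum_(i < n) q ^+ lv i by apply: sumr_ge0 => i _; rewrite exprn_ge0 // ltW.
have := @sum_trunc_log R q n (ltW q0) q1; rewrite -/lv; move: (\sum_(i < n) _) S0 => S S0.
rewrite ler_pdivlMr; last by lra.
move=> h; apply: (@le_trans _ _ (e * (1 - 2 * q) * S)).
  exact: ler_wpM2r.
by rewrite -mulrA ler_piMr ?(ltW e0) // mulrC.
Unshelve. all: by end_near.
Qed.
End UpperBound.

Lemma hausdorff_dim_eq1 (R : realType) (A : set R) :
  (forall s, 0 <= s -> s < 1 -> hausdorff_measure s A <> 0%E) -> hausdorff_dim A = 1%E.
Proof.
move=> h; apply/eqP; rewrite eq_le; apply/andP; split.
  apply/lee_addgt0Pr => e e0; rewrite -EFinD.
  apply: ereal_inf_lbound; exists (1 + e) => //; split; first by rewrite addr_ge0 // ltW.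
  by apply: hausdorff_measure_gt1; rewrite ltrDl.
apply: le_ereal_inf_tmp => _ [s [s0 ms] <-]; rewrite lee_fin leNgt; apply/negP => s1.
exact: h ms.
Qed.

(** * Generic and special steps of the construction *)

Lemma packing (R : realType) (T : finType) (B : {set T}) (u : T -> R) (d lo hi : R) :
  0 < d -> (forall i, i \in B -> lo <= u i <= hi) ->
  (forall i j, i \in B -> j \in B -> i != j -> d <= `|u i - u j|) ->
  lo <= hi -> #|B|%:R <= (hi - lo) / d + 1.
Proof.
move=> d0 uB sep lohi.
pose f i := Num.truncn ((u i - lo) / d).
pose m := Num.truncn ((hi - lo) / d).
have fP i : i \in B -> (f i)%:R <= (u i - lo) / d < (f i).+1%:R.
  by move=> /uB/andP[h _]; apply: truncn_itv; rewrite divr_ge0 ?subr_ge0 ?(ltW d0).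
have mP : m%:R <= (hi - lo) / d < m.+1%:R.
  by apply: truncn_itv; rewrite divr_ge0 ?subr_ge0 ?(ltW d0).
have fm i : i \in B -> (f i < m.+1)%N.
  move=> iB; rewrite -(ltr_nat R); have /andP[h1 _] := fP _ iB; have /andP[_ h2] := mP.
  apply: le_lt_trans h1 _; apply: le_lt_trans h2.
  by rewrite ler_pM2r ?invr_gt0 // lerD2r; have /andP[] := uB _ iB.
have inj : {in B &, injective (fun i => inord (f i) : 'I_m.+1)}.
  move=> i j iB jB /(congr1 val) /=; rewrite !inordK ?fm // => e.
  apply/eqP/negPn/negP => ij; have := sep _ _ iB jB ij.
  apply/negP; rewrite -ltNge.
  have /andP[h1 h2] := fP _ iB; have /andP[h3 h4] := fP _ jB.
  rewrite e in h1 h2; rewrite -natr1 in h2 h4.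
  have -> : u i - u j = ((u i - lo) / d - (u j - lo) / d) * d.
    by rewrite -mulrBl divfK ?gt_eqF //; ring.
  rewrite normrM (gtr0_norm d0) -[ltRHS]mul1r ltr_pM2r //.
  rewrite ltr_norml; move: h1 h2 h3 h4; clear; move: (_ / d) (_ / d) => y z.
  by move=> *; apply/andP; split; lra.
have le : (#|B| <= m.+1)%N.
  by rewrite -(card_in_imset inj) (leq_trans (max_card _)) ?card_ord.
apply: (@le_trans _ _ m.+1%:R); first by rewrite ler_nat.
by rewrite -natr1 lerD2r; have /andP[] := mP.
Qed.

Definition separated (R : realType) (S : set (R * R)) := forall A z z', 0 < A ->
  S z -> S z' -> A < z.1 -> z.1 <= 2 * A -> A < z'.1 -> z'.1 <= 2 * A ->
  z = z' \/ 1 / (4 * A) <= `|z.2 - z'.2|.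

Definition bad (R : realType) (S : set (R * R)) (A e y w : R) :=
  exists a z, [/\ y <= a <= y + w, S z, A < z.1 <= 2 * A & z.1 * `|a - z.2| < e].

(** The intervals are so far apart that no target spoils two of them; the targets involved are then
    counted by packing. *)
Lemma bad_card (R : realType) (S : set (R * R)) n (y : 'I_n -> R) (A e w lo hi : R) :
  separated S -> 0 < A -> 0 <= e -> 0 <= w -> lo <= hi ->
  (forall i, lo <= y i /\ y i + w <= hi) ->
  (forall i j, i != j -> w + 2 * (e / A) <= `|y i - y j|) ->
  #|[set i | `[< bad S A e (y i) w >]]%SET|%:R <= 4 * A * (hi - lo + 2 * (e / A)) + 1.
Proof.
move=> sepS A0 e0 w0 lohi yr ysep.
have /choice[z zP] : forall i, exists z, bad S A e (y i) w ->
   exists a, [/\ y i <= a <= y i + w, S z, A < z.1 <= 2 * A & z.1 * `|a - z.2| < e].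
  move=> i; case: (pselect (bad S A e (y i) w)) => [[a [z h]]|nb].
    by exists z => _; exists a.
  by exists (0, 0).
have eA0 : 0 <= e / A by rewrite divr_ge0 // ltW.
have close i : bad S A e (y i) w -> exists a, [/\ y i <= a, a <= y i + w & `|a - (z i).2| < e / A].
  move=> /zP[a [/andP[a1 a2] _ /andP[z1 _] h]]; exists a; split => //.
  rewrite ltr_pdivlMr // mulrC; apply: le_lt_trans h.
  by rewrite ler_wpM2r // ltW.
have e4 : 4 * A * (hi - lo + 2 * (e / A)) = (hi + e / A - (lo - e / A)) / (1 / (4 * A)).
  by field; rewrite gt_eqF.
rewrite e4; apply: (@packing _ _ _ (fun i => (z i).2)).
- by rewrite divr_gt0 // mulr_gt0.
- move=> i; rewrite !inE => /close [a []].
  have [] := yr i; move: (y i) (z i).2 (e / A) => p q r; rewrite ltr_norml; clear.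
  by move=> h1 h2 h3 h4 /andP[h5 h6]; apply/andP; split; lra.
- move=> i j; rewrite !inE => bi bj ij.
  have [_ [_ Szi /andP[zi1 zi2] _]] := zP _ bi; have [_ [_ Szj /andP[zj1 zj2] _]] := zP _ bj.
  have [ez|] // := sepS A _ _ A0 Szi Szj zi1 zi2 zj1 zj2.
  exfalso; have [a [a1 a2 a3]] := close _ bi; have [b [b1 b2 b3]] := close _ bj.
  move: a3 b3 (ysep _ _ ij); rewrite ez; move: a1 a2 b1 b2.
  move: (y i) (y j) (z j).2 (e / A) => p q u r; clear.
  rewrite !ltr_norml => h1 h2 h3 h4 /andP[h5 h6] /andP[h7 h8].
  by case: (normr_or (p - q)) => ->; lra.
- by move: lohi eA0; move: (e / A) => r; clear; lra.
Qed.

Lemma card_bigcup_le (T I : finType) (B : I -> {set T}) :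
  (#|\bigcup_i B i|%SET <= \sum_i #|B i|)%N.
Proof.
elim/big_rec2: _ => [|i m U _ h]; first by rewrite cards0.
by apply: leq_trans (leq_card_setU _ _) _; rewrite leq_add2l.
Qed.

Lemma natr_dist_ge1 (R : realDomainType) (i j : nat) : i != j -> 1 <= `|i%:R - j%:R| :> R.
Proof.
wlog ij : i j / (i < j)%N => [h|_].
  rewrite neq_ltn => /orP[] ij; last rewrite distrC.
    by apply: h => //; rewrite ltn_eqF.
  by apply: h => //; rewrite ltn_eqF.
by rewrite distrC -natrB 1?ltnW // normr_nat ler1n subn_gt0.
Qed.

Lemma expr_cancel (R : fieldType) (c N t : R) k : N != 0 ->
  N ^- k.+1 * (c * N ^+ k * t) * N = c * t.
Proof. by move=> N0; rewrite exprS; field; rewrite N0 expf_neq0. Qed.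

Lemma r_le (R : realDomainType) r : (9 <= r)%N -> 48 * r%:R <= (2 ^ r)%:R :> R.
Proof.
move=> r9; rewrite -natrM ler_nat -(subnK r9); elim: (r - 9)%N => // m IH.
by rewrite addSn expnS; move: IH; lia.
Qed.

Lemma scale_span (R : realDomainType) (a N l c t : R) :
  l * a * N = c * t -> 4 * a * (2 * (N * l)) <= 8 * c * t.
Proof.
by move=> h; have -> : 4 * a * (2 * (N * l)) = 8 * (l * a * N); [ring|rewrite h mulrA].
Qed.

Lemma count_bound (R : realDomainType) (c N r : R) : 0 < c ->
  (8 * c * (N - 1) + r) * 3 <= 24 * c * N + 3 * r.
Proof. by lra. Qed.

Lemma dyadic (R : realFieldType) (A a : R) r : A < a -> a <= A * 2 ^+ r ->
  exists2 i, (i < r)%N & A * 2 ^+ i < a <= 2 * (A * 2 ^+ i).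
Proof.
elim: r => [|r IH] h1 h2; first by move: h2; rewrite expr0 mulr1 leNgt h1.
case: (lerP a (A * 2 ^+ r)) => h; last first.
  by exists r => //; rewrite h /= (le_trans h2) // exprS mulrCA.
by have [i ir hi] := IH h1 h; exists i => //; rewrite ltnS ltnW.
Qed.

Section Normal.
Context {R : realType}.
Context (S : 'I_3 -> set (R * R)) (e : 'I_3 -> R) (c : R) (r : nat).

Definition safe (k : nat) (x : R) := forall a i z,
  x <= a <= x + (2 ^ r)%N%:R ^- k -> S i z -> z.1 <= c * (2 ^ r)%N%:R ^+ k ->
  e i <= z.1 * `|a - z.2|.

Context (sepS : forall i, separated (S i)).
Context (c0 : 0 < c).
Context (c1 : c <= 1 / 1024).
Context (r9 : (9 <= r)%N).
Context (e0 : forall i, 0 <= e i <= c / (2 ^ r)%N%:R).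

(** There are [N / 4] candidate children, at spacing four times their length. The newly tested
    heights fill [r] dyadic ranges for each of three target sets, and range [q] spoils at most
    [8 c 2 ^ q + 1] children. The total [24 c N + 3 r] is below [N / 8]. *)
Lemma normal_step k x : safe k x -> exists (n : nat) (y : 'I_n -> R) (B : {set 'I_n}),
  [/\ (2 ^ (r - 3) <= #|B|)%N, forall j, j \in B -> safe k.+1 (y j),
   forall j, j \in B -> x <= y j /\ y j + (2 ^ r)%N%:R ^- k.+1 <= x + (2 ^ r)%N%:R ^- k
   & forall i j, i != j -> 2 * (2 ^ r)%N%:R ^- k.+1 <= `|y i - y j|].
Proof.
move=> sx; pose N : R := (2 ^ r)%N%:R; pose n := (2 ^ (r - 2))%N.
have n4 : (n * 4 = 2 ^ r)%N by rewrite /n -[4%N]/(2 ^ 2)%N -expnD subnK // (leq_trans _ r9).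
have N4 : N = n%:R * 4 by rewrite /N -n4 natrM.
have N512 : 512 <= N.
  by rewrite /N (_ : 512 = (2 ^ 9)%N%:R) ?ler_nat ?leq_exp2l //; rewrite natrX; ring.
have N0 : 0 < N by lra.
pose l := N ^- k.+1; have l0 : 0 < l by rewrite invr_gt0 exprn_gt0.
have lN : N ^- k = N * l by rewrite /l exprS invfM mulVKf ?gt_eqF.
pose y (j : 'I_n) := x + 4 * j%:R * l.
have jn (j : 'I_n) : 4 * j%:R + 4 <= N :> R.
  by rewrite N4; have : j%:R + 1 <= n%:R :> R; [rewrite natr1 ler_nat|lra].
have yB (j : 'I_n) : x <= y j /\ y j + l <= x + N ^- k.
  rewrite lN /y; have := jn j; have : 0 <= j%:R :> R by []; move: (j%:R : R) => J J0 J1.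
  have := mulr_ge0 J0 (ltW l0); have := ler_wpM2r (ltW l0) J1; clear -l0; split; lra.
have ysep (i j : 'I_n) : i != j -> 4 * l <= `|y i - y j|.
  move=> ij; have -> : y i - y j = 4 * l * (i%:R - j%:R) by rewrite /y; ring.
  have l4 : 0 < 4 * l by rewrite mulr_gt0.
  rewrite normrM (gtr0_norm l4) ler_peMr ?(ltW l4) //.
  exact: natr_dist_ge1.
pose A (q : 'I_r) := c * N ^+ k * 2 ^+ q.
have A0 q : 0 < A q by rewrite !mulr_gt0 // exprn_gt0.
have eA i q : e i / A q <= l.
  have [e1 e2] := andP (e0 i).
  rewrite ler_pdivrMr // (le_trans e2) // ler_pdivrMr //.
  have -> : l * A q * N = c * 2 ^+ q.
    by apply: expr_cancel; rewrite gt_eqF.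
  by rewrite ler_peMr ?(ltW c0) // exprn_ege1 // ler1n.
pose Bd (iq : 'I_3 * 'I_r) := [set j | `[< bad (S iq.1) (A iq.2) (e iq.1) (y j) l >]]%SET.
have cardB iq : #|Bd iq|%:R <= 8 * c * 2 ^+ iq.2 + 1 :> R.
  have := @bad_card R (S iq.1) n y (A iq.2) (e iq.1) l x (x + N ^- k) (@sepS iq.1) (A0 _) _ (ltW l0) _ yB.
  have [-> _] := andP (e0 iq.1); rewrite lerDl lN mulr_ge0 ?(ltW N0) ?(ltW l0) //.
  have sep' (i j : 'I_n) : i != j -> l + 2 * (e iq.1 / A iq.2) <= `|y i - y j|.
    by move=> /ysep; apply: le_trans; have := eA iq.1 iq.2; lra.
  move=> /(_ isT isT sep') h; apply: (le_trans h); rewrite lerD2r.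
  apply: (@le_trans _ _ (4 * A iq.2 * (2 * (N * l)))).
    have A4 : 0 < 4 * A iq.2 by rewrite pmulr_rgt0.
    rewrite (ler_pM2l A4); have := eA iq.1 iq.2.
    have : 4 * l <= N * l by rewrite ler_pM2r //; lra.
    lra.
  have N_neq0 : N != 0 by rewrite gt_eqF.
  exact: scale_span (@expr_cancel _ c N (2 ^+ iq.2) k N_neq0).
have cardU : #|(\bigcup_iq Bd iq)%SET|%:R <= 24 * c * N + 3 * r%:R :> R.
  apply: (@le_trans _ _ (\sum_iq #|Bd iq|)%N%:R); first by rewrite ler_nat card_bigcup_le.
  rewrite natr_sum; apply: (@le_trans _ _ (\sum_(iq : 'I_3 * 'I_r) (8 * c * 2 ^+ iq.2 + 1))).
    by apply: ler_sum => iq _; exact: cardB.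
  rewrite -(pair_bigA _ (fun (i : 'I_3) (q : 'I_r) => 8 * c * 2 ^+ q + 1)) /= sumr_const card_ord.
  rewrite big_split /= sumr_const card_ord -mulr_sumr.
  have -> : \sum_(q < r) 2 ^+ q = N - 1.
    rewrite /N natrX; elim: (r) => [|m IH]; first by rewrite big_ord0 expr0 subrr.
    by rewrite big_ord_recr /= IH exprS; ring.
  by rewrite -[leLHS]mulr_natr; exact: count_bound.
exists n, y, (~: \bigcup_iq Bd iq)%SET; split => //.
- have h : #|(\bigcup_iq Bd iq)%SET|%:R + #|(~: \bigcup_iq Bd iq)%SET|%:R = n%:R :> R.
    by rewrite -natrD cardsC card_ord.
  have rN : 3 * r%:R <= N / 16.
    by have := @r_le R _ r9; rewrite /N; lra.
  rewrite -(ler_nat R); have e8 : (2 ^ (r - 3))%N%:R = N / 8 :> R.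
    rewrite /N; have -> : (2 ^ r = 2 ^ (r - 3) * 8)%N.
      by rewrite -[8%N]/(2 ^ 3)%N -expnD subnK // (leq_trans _ r9).
    by rewrite natrM mulfK.
  rewrite e8; have cN : c * N <= N / 1024.
    by rewrite mulrC ler_pM2l // (le_trans c1) // mul1r.
  lra.
- move=> j; rewrite !inE => jB a i z aj Sz z1.
  case: (lerP z.1 (c * N ^+ k)) => zk.
    apply: (sx a i z) => //; have [h1 h2] := yB j; case/andP: aj => a1 a2.
    by rewrite (le_trans h1) //= (le_trans a2).
  rewrite leNgt; apply/negP => small; move/negP: jB; apply.
  have [q qr /andP[q1 q2]] : exists2 q, (q < r)%N &
     c * N ^+ k * 2 ^+ q < z.1 <= 2 * (c * N ^+ k * 2 ^+ q).
    apply: dyadic => //; apply: (le_trans z1).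
    by rewrite -[2 ^+ r]natrX exprSr mulrA.
  apply/bigcupP; exists (i, Ordinal qr) => //; rewrite inE; apply/asboolP.
  by exists a, z; split => //; apply/andP.
- by move=> i j ij; apply: le_trans (ysep _ _ ij); rewrite ler_pM2r // ler_nat.
Qed.
End Normal.

(** * Insertion of a seed near a cusp *)

Lemma exists_avoiding (T I : finType) (B : I -> {set T}) :
  (forall i, (#|B i| <= 1)%N) -> (#|I| < #|T|)%N -> exists x, forall i, x \notin B i.
Proof.
move=> B1 IT; have : (0 < #|~: \bigcup_i B i|%SET)%N.
  rewrite -[X in (_ < X)%N](addKn #|\bigcup_i B i|%SET) cardsC subn_gt0; apply: leq_ltn_trans IT.
  by rewrite (leq_trans (card_bigcup_le B)) // -sum1_card leq_sum.
case/card_gt0P=> x; rewrite inE => xB; exists x => i.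
by apply: contra xB => xi; apply/bigcupP; exists i.
Qed.

(* Each of the [2 n] dyadic ranges of heights excludes at most one shift [i]. *)
Lemma choose_point (R : realType) (S : bool -> set (R * R)) (p W z e A0 : R) (n : nat) :
  (forall k, separated (S k)) -> 0 < A0 -> 0 < W -> 64 * W <= A0 * 2 ^+ n ->
  2 ^+ 14 <= z -> 0 <= e -> e <= 1 / 64 ->
  2 * e * (W * (z + (2 * n)%N%:R) ^+ 2) <= A0 ->
  exists2 i : nat, (i <= 2 * n)%N & forall k u, S k u -> A0 < u.1 -> u.1 <= 64 * W ->
    e <= u.1 * `|p - 1 / (W * (z + i%:R)) - u.2|.
Proof.
move=> sepS A0_gt0 W0 Wn z14 e0 e1 small.
have z0 : 0 < z by apply: lt_le_trans z14; rewrite exprn_gt0.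
pose y (i : 'I_(2 * n).+1) := p - 1 / (W * (z + i%:R)).
have zi0 (i : 'I_(2 * n).+1) : 0 < z + i%:R by rewrite ltr_pwDl.
pose A (j : 'I_n) := A0 * 2 ^+ j.
have A_gt0 j : 0 < A j by rewrite mulr_gt0 // exprn_gt0.
have A_ge j : A0 <= A j by rewrite ler_peMr ?(ltW A0_gt0) // exprn_ege1 // ler1n.
have yr (i : 'I_(2 * n).+1) : p - 1 / (W * z) <= y i /\ y i + 0 <= p.
  rewrite /y; split; last by rewrite addr0 gerBl divr_ge0 // mulr_ge0 // ltW.
  rewrite lerD2l lerN2 ler_pM2l // lef_pV2 ?posrE ?mulr_gt0 //.
  by rewrite ler_pM2l // lerDl.
have ysep (i j : 'I_(2 * n).+1) : i != j -> 1 / (W * (z + (2 * n)%N%:R) ^+ 2) <= `|y i - y j|.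
  move=> ij; have -> : y i - y j = (i%:R - j%:R) / (W * ((z + i%:R) * (z + j%:R))).
    by rewrite /y; field; rewrite !gt_eqF.
  have Wij : 0 < W * ((z + i%:R) * (z + j%:R)) by rewrite !mulr_gt0.
  rewrite normrM (gtr0_norm (_ : 0 < _^-1)) ?invr_gt0 //.
  have h : (W * (z + (2 * n)%N%:R) ^+ 2)^-1 <= (W * ((z + i%:R) * (z + j%:R)))^-1.
    rewrite lef_pV2 ?posrE // ?mulr_gt0 // ?exprn_gt0 ?ltr_pwDl // ler_pM2l //.
    by rewrite expr2; apply: ler_pM; rewrite ?(ltW (zi0 _)) ?lerD2l ?ler_nat ?leq_ord //.
  apply: ler_pM => //; last exact: natr_dist_ge1.
  by rewrite invr_ge0 mulr_ge0 ?(ltW W0) // sqr_ge0.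
pose Bd (kj : bool * 'I_n) := if A kj.2 < 64 * W then
  [set i | `[< bad (S kj.1) (A kj.2) e (y i) 0 >]]%SET else finset.set0.
have [kj||i iB] := @exists_avoiding _ _ Bd.
- rewrite /Bd; case: ifP => [AW|_]; last by rewrite cards0.
  have lohi : p - 1 / (W * z) <= p by rewrite gerBl divr_ge0 // mulr_ge0 ?ltW.
  have h1 := @bad_card R (S kj.1) _ y (A kj.2) e 0 _ p (sepS _) (A_gt0 _) e0 (lexx 0) lohi yr.
  rewrite -ltnS -(ltr_nat R).
  apply: le_lt_trans (h1 _) _ => [i j /ysep h|].
    rewrite add0r; apply: le_trans h; rewrite mulrA ler_pdivrMr //.
    rewrite mulrAC ler_pdivlMr ?mulr_gt0 ?exprn_gt0 ?ltr_pwDl // mul1r.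
    exact: le_trans (A_ge _).
  have -> : 4 * A kj.2 * (p - (p - 1 / (W * z)) + 2 * (e / A kj.2)) = 4 * A kj.2 / (W * z) + 8 * e.
    by field; rewrite !gt_eqF.
  have : 4 * A kj.2 / (W * z) <= 1 / 2.
    rewrite ler_pdivrMr ?mulr_gt0 //; have : 2 ^+ 14 * W <= W * z by rewrite mulrC ler_pM2l.
    have -> : 2 ^+ 14 = 16384 :> R by ring.
    by move: AW; move: (A kj.2) (W * z) => a wz; clear -W0; lra.
  by move: (4 * A kj.2 / _) => q; move: e1; clear; rewrite -[1.+1%:R]/(2 : R); lra.
- by rewrite card_prod card_bool !card_ord.
exists i; first by rewrite -ltnS.
move=> k u Su u1 u2; rewrite leNgt; apply/negP => ult.
have [j jn /andP[j1 j2]] := dyadic u1 (le_trans u2 Wn).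
move: (iB (k, Ordinal jn)); rewrite /Bd /= (lt_le_trans j1 u2) inE; apply/negP/negPn.
by apply/asboolP; exists (y i), u; rewrite addr0 lexx /A /= j1 j2.
Qed.

Lemma small_vector (R : realType) (al T : R) : 0 < T ->
  exists q p : int, (exists u v : int, u * q + v * p = 1) /\
    q%:~R ^+ 2 + T ^+ 2 * (p%:~R - q%:~R * al) ^+ 2 <= 2 * T.
Proof.
move=> T0; pose t := Num.sqrt T; have t0 : 0 < t by rewrite sqrtr_gt0.
have tT : t ^+ 2 = T by rewrite sqr_sqrtr // ltW.
have det : t^-1 * t - 0 * (- t * al) = 1 by rewrite mul0r subr0 mulVf ?gt_eqF.
have [|q [p [q' [p' /= [dt _ A0 /andP[B1 B2] AC]]]]] := @l2_reduced R t^-1 (- t * al) 0 t.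
  by rewrite det oner_eq0.
exists q, p; split.
  have [h|h] : q * p' - p * q' = 1 \/ q * p' - p * q' = -1 by move: dt; clear; lia.
    by exists p', (- q'); rewrite -h; ring.
  by exists (- p'), q'; rewrite -[1]opprK -h; ring.
move: A0 B1 B2 AC; rewrite /lc.
set X1 := q%:~R * t^-1 + _; set Y1 := q%:~R * (- t * al) + _.
set X2 := q'%:~R * t^-1 + _; set Y2 := q'%:~R * (- t * al) + _.
move=> A0 B1 B2 AC.
have D : (X1 * Y2 - X2 * Y1) ^+ 2 = 1.
  have -> : X1 * Y2 - X2 * Y1 = (q * p' - p * q')%:~R.
    by rewrite /X1 /Y1 /X2 /Y2 rmorphB !rmorphM /=; field; rewrite gt_eqF.
  by rewrite -rmorphXn /= -[_ ^+ 2]real_normK ?num_real ?dt.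
have key : (X1 ^+ 2 + Y1 ^+ 2) * (X2 ^+ 2 + Y2 ^+ 2) = 1 + (X1 * X2 + Y1 * Y2) ^+ 2.
  by rewrite -D; ring.
have A2 : X1 ^+ 2 + Y1 ^+ 2 <= 2.
  move: (X1 ^+ 2 + _) (X2 ^+ 2 + _) (X1 * X2 + _) A0 B1 B2 AC key => A C B.
  by clear => A0 B1 B2 AC key; nra.
have -> : q%:~R ^+ 2 + T ^+ 2 * (p%:~R - q%:~R * al) ^+ 2 = T * (X1 ^+ 2 + Y1 ^+ 2).
  by rewrite /X1 /Y1 -tT; field; rewrite gt_eqF.
by rewrite mulrC ler_pM2r.
Qed.

Definition pts (R : realType) (F : int -> int -> int -> Prop) (t : int) : set (R * R) :=
  [set z | exists a b c, [/\ F a b c, 0 < a &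
    z = (a%:~R, (t%:~R - b%:~R) / (2 * a%:~R))]].
Arguments pts : clear implicits.

Lemma pts_dist (R : realType) (a b t : int) (x : R) : 0 < a ->
  a%:~R * `|x - (t%:~R - b%:~R) / (2 * a%:~R)| = `|psi a b x - t%:~R| / 2.
Proof.
move=> a0; have aR : 0 < a%:~R :> R by rewrite ltr0z.
rewrite -{1}(gtr0_norm aR) -normrM.
have -> : a%:~R * (x - (t%:~R - b%:~R) / (2 * a%:~R)) = (psi a b x - t%:~R) / 2.
  by rewrite /psi; field; rewrite gt_eqF.
by rewrite normrM [X in _ * X]gtr0_norm.
Qed.

Lemma pts_separated (R : realType) F t : separated_family R F t -> separated (pts R F t).
Proof.
move=> sep A z z' A0 [a [b [c [hf a0 ->]]]] [a' [b' [c' [hf' a0' ->]]]] /= h1 h2 h3 h4.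
have [[-> ->]|h] := sep A a b c a' b' c' A0 hf hf' h1 h2 h3 h4; first by left.
by right.
Qed.

Lemma coprime_square_form (q p u v : int) : u * q + v * p = 1 ->
  square_form (q ^+ 2) (- 2 * (q * p)) (p ^+ 2).
Proof. by move=> uv; exists q, p; split => //; exists u, v. Qed.

Lemma pts_square (R : realType) (q p u v : int) : 0 < q -> u * q + v * p = 1 ->
  pts R square_form 0 (q%:~R ^+ 2, p%:~R / q%:~R).
Proof.
move=> q0 uv; exists (q ^+ 2), (- 2 * (q * p)), (p ^+ 2); split.
- exact: coprime_square_form uv.
- by rewrite exprn_gt0.
have qR : q%:~R != 0 :> R by rewrite intr_eq0 gt_eqF.
by congr (_, _); rewrite !rmorphM ?rmorphXn //= rmorphN /=; field.
Qed.

(** A short lattice vector at the midpoint gives [p / q] with [q ^ 2 <= 2 T]. Safety from the cusps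
    forces [q ^ 2 >= 4 e L], since a smaller denominator would approximate the midpoint too well;
    this puts [p / q] within [l / 4] of the midpoint. Being in a safe interval, [p / q] must itself
    have height above [c L]. *)
Lemma cusp_center (R : realType) (x L l c e : R) : 0 < l -> l <= 1 -> L * l = 1 -> 0 < c -> 0 < e ->
  4 * e <= c -> e <= 1 ->
  (forall al z, x <= al <= x + l -> pts R square_form 0 z -> z.1 <= c * L ->
     e <= z.1 * `|al - z.2|) ->
  exists p q p' q' : int, [/\ 0 < q, 0 <= q' < q, p * q' - p' * q = 1,
    `|x + l / 2 - p%:~R / q%:~R| <= l / 4 & c * L < q%:~R ^+ 2 <= 16 * (L / e)].
Proof.
move=> l0 l1 Ll c0 e0 ec e1 safe.
have L0 : 0 < L by rewrite -(pmulr_lgt0 _ l0) Ll.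
pose T := 8 * (L / e); have T0 : 0 < T by rewrite mulr_gt0 // divr_gt0.
have Te : T * e = 8 * L by rewrite /T -mulrA divfK // gt_eqF.
have [q0 [p0 [[u0 [v0 uv0]] h0]]] := small_vector (x + l / 2) T0.
have [q [p [u [v [q_ge0 uv h]]]]] : exists q p u v : int, [/\ 0 <= q, u * q + v * p = 1 &
   q%:~R ^+ 2 + T ^+ 2 * (p%:~R - q%:~R * (x + l / 2)) ^+ 2 <= 2 * T].
  case: (lerP 0 q0) => q0s; first by exists q0, p0, u0, v0.
  exists (- q0), (- p0), (- u0), (- v0); split; first by rewrite oppr_ge0 ltW.
    by rewrite !mulrNN.
  by apply: le_trans h0; rewrite !rmorphN /= le_eqVlt; apply/orP; left; apply/eqP; ring.
clear q0 p0 u0 v0 uv0 h0.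
have D : q%:~R ^+ 2 <= 2 * T /\ T ^+ 2 * (p%:~R - q%:~R * (x + l / 2)) ^+ 2 <= 2 * T.
  have := sqr_ge0 (q%:~R : R); have := mulr_ge0 (sqr_ge0 T) (sqr_ge0 (p%:~R - q%:~R * (x + l / 2))).
  by move: h; move: (T ^+ 2 * _) (q%:~R ^+ 2) => a b; clear; split; lra.
case: D => {h} qT D.
have T8 : 8 <= T * l.
  rewrite -(ler_pM2r e0) mulrAC Te -mulrA Ll mulr1; clear -e1; lra.
have T8' : 8 <= T by apply: le_trans T8 _; rewrite ler_piMr // ltW.
have q0 : 0 < q.
  rewrite lt_neqAle q_ge0 andbT; apply/eqP => q0; move: D; rewrite -q0 mul0r subr0.
  have p1 : (p%:~R : R) ^+ 2 = 1.
    rewrite -rmorphXn /=.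
    have /(congr1 absz) : v * p = 1 by rewrite -uv -q0 mulr0 add0r.
    rewrite abszM => /eqP; rewrite muln_eq1 => /andP[_ /eqP p1].
    have -> : p ^+ 2 = 1 by clear -p1; nia.
    by [].
  by rewrite p1 mulr1 expr2 ler_pM2r //; move: T8'; clear; lra.
have qR : 0 < q%:~R :> R by rewrite ltr0z.
pose d := x + l / 2 - p%:~R / q%:~R.
have {}D : T * q%:~R ^+ 2 * d ^+ 2 <= 2.
  rewrite -(ler_pM2l T0) (mulrC T 2); apply: le_trans D; rewrite le_eqVlt; apply/orP; left; apply/eqP.
  by rewrite /d; field; rewrite gt_eqF.
have zP := pts_square R q0 uv.
have inl : x <= x + l / 2 <= x + l by rewrite lerDl lerD2l; apply/andP; split; clear -l0; lra.
have W0 : 0 < q%:~R ^+ 2 :> R by rewrite exprn_gt0.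
have big : 4 * e * L <= q%:~R ^+ 2.
  case: (lerP (q%:~R ^+ 2) (c * L)) => h; last first.
    by apply: le_trans (ltW h); rewrite ler_pM2r.
  have := safe _ _ inl zP h; rewrite /= -/d => ed.
  have {}ed : e ^+ 2 <= (q%:~R ^+ 2 * `|d|) ^+ 2.
    by rewrite ler_pXn2r ?nnegrE ?mulr_ge0 ?(ltW e0) // ltW.
  rewrite exprMn real_normK ?num_real // in ed.
  have h1 : T * e ^+ 2 <= 2 * q%:~R ^+ 2.
    apply: le_trans (_ : T * ((q%:~R ^+ 2) ^+ 2 * d ^+ 2) <= _); first by rewrite ler_pM2l.
    have -> : T * ((q%:~R ^+ 2) ^+ 2 * d ^+ 2) = (T * q%:~R ^+ 2 * d ^+ 2) * q%:~R ^+ 2 by ring.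
    by rewrite ler_pM2r.
  have h2 : T * e ^+ 2 = 8 * (e * L) by rewrite expr2 mulrA Te; ring.
  by move: h1; rewrite h2; move: (q%:~R ^+ 2); clear => w; rewrite -mulrA; lra.
have dl : `|d| <= l / 4.
  rewrite -(ler_pXn2r (_ : (0 < 2)%N)) ?nnegrE // ?divr_ge0 ?(ltW l0) // real_normK ?num_real //.
  have h1 : 32 * L ^+ 2 <= T * q%:~R ^+ 2.
    have -> : 32 * L ^+ 2 = T * (4 * e * L) by rewrite -[X in T * (X * _)]mulrC !mulrA Te; ring.
    by rewrite ler_pM2l.
  have h2 : 32 * L ^+ 2 * d ^+ 2 <= 2.
    by apply: le_trans D; rewrite ler_wpM2r // sqr_ge0.
  have -> : d ^+ 2 = (32 * L ^+ 2 * d ^+ 2) * (l ^+ 2 / 32).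
    by transitivity ((L * l) ^+ 2 * d ^+ 2); [rewrite Ll; ring|field].
  apply: le_trans (_ : 2 * (l ^+ 2 / 32) <= _); first by rewrite ler_wpM2r // divr_ge0 // sqr_ge0.
  by rewrite le_eqVlt; apply/orP; left; apply/eqP; field.
have cW : c * L < q%:~R ^+ 2.
  rewrite ltNge; apply/negP => h.
  have := safe (p%:~R / q%:~R) _ _ zP h; rewrite /= subrr normr0 mulr0.
  move: dl; rewrite /d ler_norml => /andP[d1 d2].
  have -> : x <= p%:~R / q%:~R <= x + l.
    by move: d1 d2; move: (_ / q%:~R) => w; clear -l0 => *; apply/andP; split; lra.
  by move=> /(_ isT); rewrite leNgt e0.
have q'0 := modz_ge0 v (lt0r_neq0 q0); have q'1 := ltz_pmod v q0.
exists p, q, (- u - (v %/ q)%Z * p), (v %% q)%Z; rewrite q'0 q'1 cW; split => //.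
  transitivity (u * q + p * ((v %/ q)%Z * q + (v %% q)%Z)); first by ring.
  by rewrite -divz_eq -uv; ring.
by apply: le_trans qT _; rewrite /T mulrA -natrM.
Qed.

(** The chosen cusp is at distance [1 / (q0 ^ 2 z)] by construction. Any other fraction is at least
    [1 / (q q0)] from the cusp, and the displacement removes at most half of this. *)
Lemma cusp_zone (R : realType) (z : R) (p0 q0 p q u0 v0 u v : int) :
  0 < q0 -> 0 < q -> u0 * q0 + v0 * p0 = 1 -> u * q + v * p = 1 -> 16 <= z ->
  q%:~R <= 8 * q0%:~R :> R ->
  Num.min (1 / z) (q%:~R / q0%:~R / 2) <=
    q%:~R ^+ 2 * `|p0%:~R / q0%:~R - 1 / (q0%:~R ^+ 2 * z) - p%:~R / q%:~R|.
Proof.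
move=> q0_gt0 q_gt0 uv0 uv z16 q8.
have qR0 : 0 < q0%:~R :> R by rewrite ltr0z.
have qR : 0 < q%:~R :> R by rewrite ltr0z.
have z0 : 0 < z by rewrite (lt_le_trans _ z16).
rewrite ge_min; have [e|ne] := eqVneq (p * q0) (p0 * q).
  apply/orP; left.
  have qq : (q0 <= q)%R.
    have qE : q = q0 * (u0 * q + v0 * p).
      transitivity (q * (u0 * q0 + v0 * p0)); first by rewrite uv0 mulr1.
      by transitivity (q0 * (u0 * q) + v0 * (p0 * q)); [ring|rewrite -e; ring].
    rewrite [leRHS]qE ler_peMr ?(ltW q0_gt0) // -gtz0_ge1 -(pmulr_rgt0 _ q0_gt0) -qE //.
  have -> : p%:~R / q%:~R = p0%:~R / q0%:~R :> R.
    by apply/eqP; rewrite eqr_div ?lt0r_neq0 // -!intrM e.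
  rewrite addrAC subrr add0r normrN gtr0_norm; last by rewrite divr_gt0 // mulr_gt0 // exprn_gt0.
  rewrite mulrA mulr1 invfM mulrA ler_pM2r ?invr_gt0 //.
  rewrite ler_pdivlMr ?exprn_gt0 // mul1r ler_pXn2r ?nnegrE ?(ltW qR) ?(ltW qR0) //.
  by rewrite ler_int.
apply/orP; right.
have n1 : 1 <= `|(p0 * q - p * q0)%:~R : R|.
  by rewrite -intr_norm intr_ge1 // normr_gt0 subr_eq0 eq_sym.
have -> : p0%:~R / q0%:~R - 1 / (q0%:~R ^+ 2 * z) - p%:~R / q%:~R =
    ((p0 * q - p * q0)%:~R - q%:~R / (q0%:~R * z)) / (q0%:~R * q%:~R) :> R.
  by rewrite rmorphB !rmorphM /=; field; rewrite !gt_eqF.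
rewrite normrM [X in _ * (_ * X)]gtr0_norm ?invr_gt0 ?mulr_gt0 //.
have -> (w : R) : q%:~R ^+ 2 * (w / (q0%:~R * q%:~R)) = q%:~R / q0%:~R * w.
  by field; rewrite !gt_eqF.
rewrite ler_pM2l ?divr_gt0 //.
have h : q%:~R / (q0%:~R * z) <= 1 / 2.
  rewrite ler_pdivrMr ?mulr_gt0 //; have : q0%:~R * 16 <= q0%:~R * z by rewrite ler_pM2l.
  by move: q8; move: (q0%:~R * z) => w; clear; lra.
have h0 : 0 <= q%:~R / (q0%:~R * z) by rewrite divr_ge0 ?ltW // mulr_gt0.
have := lerB_dist (p0 * q - p * q0)%:~R (q%:~R / (q0%:~R * z)); rewrite (ger0_norm h0).
by move: n1 h; clear; lra.
Qed.

(** Cusps are always among the points to avoid. Both signs of [t] occur because a substitution may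
    change the sign of [psi]; for [t = 0] the last two sets coincide. *)
Definition targets (R : realType) (F : int -> int -> int -> Prop) (t : int) (i : 'I_3) : set (R * R) :=
  match val i with 0%N => pts R square_form 0 | 1%N => pts R F t | _ => pts R F (- t) end.

Definition margin (R : realType) (e eh : R) (i : 'I_3) : R := if val i == 0%N then e else eh.

Lemma pts_far (R : realType) (F : int -> int -> int -> Prop) (t t0 : int) (y B d : R) :
  0 <= B -> `|t| = `|t0| ->
  (forall a b c t', F a b c -> B < a%:~R :> R -> `|t'| = `|t0| -> d <= `|psi a b y - t'%:~R|) ->
  forall u, pts R F t u -> B < u.1 -> d / 2 <= u.1 * `|y - u.2|.
Proof.
move=> B0 tt0 far _ [a [b [c [hf a0 ->]]]] /= Ba.
by rewrite pts_dist // ler_pM2r //; apply: far hf Ba tt0.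
Qed.

Definition avoids (R : realType) (F : int -> int -> int -> Prop) (t : int) (th : R) :=
  [/\ 0 <= th, th <= 2,
     forall a b c' t', square_form a b c' -> 0 < a -> `|t'| = `|(0 : int)| -> 1 / 20 <= `|psi a b th - t'%:~R|
   & forall a b c' t', F a b c' -> 0 < a -> `|t'| = `|t| -> 1 / 20 <= `|psi a b th - t'%:~R|].

(* [c]: height of the points tested at scale [1]; [e], [eh]: distances kept from
   the cusps and from the targets; [n]: number of dyadic ranges that the new
   cusp can reach; [Z]: the largest shift of the seed. *)
Definition step_constants (R : realType) (c e eh Z : R) (n : nat) :=
  c = 1 / 1024 /\
  [/\ 0 < e, 256 * e <= c, 2 ^+ 20 <= e * 2 ^+ n, Z = 2 ^+ 14 + (2 * n)%N%:R + 4
    & [/\ 2 * e * Z <= 1, 0 < eh & 2 ^+ 16 * Z ^+ 2 * eh <= e * c]].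

(** Up to height [64 Q ^ 2] the targets of [F] are missed by the choice of the shift, and the cusps
    by [cusp_zone]; above, the seed is seen through [transfer_avoid]. The margins are doubled so
    that a whole interval at the image can inherit them; [1 / 80] is the margin [1 / 20] of the
    seed, halved by the transfer and again by the passage from [psi] to height times distance. *)
Lemma local_point (R : realType) (F : int -> int -> int -> Prop) (t : int) (c e eh Z : R) (n : nat)
    (x L l th : R) :
  form_family F -> `|t| <= 1 -> separated_family R F t -> separated_family R F (- t) ->
  step_constants c e eh Z n -> 0 < l -> l <= 1 -> L * l = 1 -> avoids F t th ->
  (forall al z, x <= al <= x + l -> pts R square_form 0 z -> z.1 <= c * L ->
     e <= z.1 * `|al - z.2|) ->
  exists P P' Q Q' : int,
    let z := th + Q'%:~R / Q%:~R in let y := (P%:~R * th + P'%:~R) / (Q%:~R * th + Q'%:~R) in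
    [/\ 0 < Q, P * Q' - P' * Q = 1, 2 ^+ 14 <= z <= Z, Q%:~R ^+ 2 <= 16 * (L / e)
     & x <= y <= x + 7 / 8 * l /\
      forall i u, targets F t i u -> c * L < u.1 ->
        (if u.1 <= 64 * Q%:~R ^+ 2 then 2 * margin e eh i else 1 / 80) <= u.1 * `|y - u.2|].
Proof.
move=> FF t1 sep1 sep2 [c_eq [e_gt0 ec en Z_eq [eZ eh_gt0 ehZ]]] l0 l1 Ll [th0 th2 av0 avF] safe.
have L0 : 0 < L by rewrite -(pmulr_lgt0 _ l0) Ll.
have c0 : 0 < c by move: ec e_gt0; clear; lra.
have Z0 : 2 ^+ 14 <= Z by rewrite Z_eq -addrA lerDl addr_ge0.
have e1 : 4 * e <= c by move: ec e_gt0; clear; lra.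
have e2 : e <= 1 by move: ec e_gt0; rewrite c_eq; clear; lra.
have [p [q [p' [q' [q0 /andP[q'0 q'q] det dist /andP[qc qe]]]]]] :=
  cusp_center l0 l1 Ll c0 e_gt0 e1 e2 safe.
have qR : 0 < q%:~R :> R by rewrite ltr0z.
have W0 : 0 < q%:~R ^+ 2 :> R by rewrite exprn_gt0.
have qq0 : 0 <= q'%:~R / q%:~R :> R by rewrite divr_ge0 ?(ltW qR) ?ler0z.
have qq1 : q'%:~R / q%:~R < 1 :> R by rewrite ltr_pdivrMr // mul1r ltr_int.
have cL : 0 < c * L by rewrite mulr_gt0.
pose ze := th + 2 ^+ 14 + q'%:~R / q%:~R.
have ze14 : 2 ^+ 14 <= ze by rewrite /ze; move: (2 ^+ 14) (_ / _) qq0 => a b; move: th0; clear; lra.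
have zeZ : ze + (2 * n)%N%:R <= Z.
  by rewrite Z_eq /ze; move: (2 ^+ 14) (2 * n)%N%:R (_ / _) qq1 => a b d; move: th2; clear; lra.
(* Since [q ^ 2 <= 16 L / e] and [c = 1 / 1024], the heights from [c L] to [64 q ^ 2] span a ratio
   of at most [2 ^ 20 / e]. *)
have W64 : 64 * q%:~R ^+ 2 <= c * L * 2 ^+ n.
  have h : 64 * (16 * (L / e)) <= c * L * 2 ^+ n.
    rewrite !mulrA ler_pdivrMr //.
    have := ler_wpM2l (ltW cL) en.
    have -> : c * L * 2 ^+ 20 = 1024 * L.
      rewrite -[20%N]/(10 + 10)%N exprD (_ : 2 ^+ 10 = 1024); last by ring.
      by rewrite c_eq; field.
    have -> : 64 * 16 * L = 1024 * L by ring.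
    by have -> : c * L * 2 ^+ n * e = c * L * (e * 2 ^+ n) by ring.
  by apply: le_trans h; rewrite ler_pM2l.
have W2 : 2 * (2 * eh) * (q%:~R ^+ 2 * (ze + (2 * n)%N%:R) ^+ 2) <= c * L.
  have h1 : (ze + (2 * n)%N%:R) ^+ 2 <= Z ^+ 2.
    rewrite ler_pXn2r ?nnegrE // ?addr_ge0 ?(le_trans _ Z0) ?(le_trans _ ze14) ?exprn_ge0 //.
  apply: le_trans (_ : 2 * (2 * eh) * (16 * (L / e) * Z ^+ 2) <= _).
    rewrite ler_pM2l ?mulr_gt0 //; apply: ler_pM; rewrite ?sqr_ge0 //.
  rewrite -(ler_pM2r e_gt0).
  have -> : 2 * (2 * eh) * (16 * (L / e) * Z ^+ 2) * e = 64 * (Z ^+ 2 * eh) * L.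
    by field; rewrite gt_eqF.
  have -> : c * L * e = e * c * L by ring.
  rewrite ler_pM2r //; apply: le_trans ehZ.
  rewrite -(mulrA (2 ^+ 16)) ler_pM2r ?mulr_gt0 ?exprn_gt0 ?(lt_le_trans _ Z0) ?exprn_gt0 //.
  by rewrite -natrX ler_nat.
have eh1 : 2 * eh <= 1 / 64.
  have Z2 : 1 <= Z ^+ 2 by rewrite exprn_ege1 // (le_trans _ Z0) // exprn_ege1 // ler1n.
  have h2 : eh <= e * c.
    apply: le_trans ehZ; rewrite ler_peMl ?(ltW eh_gt0) //.
    by rewrite -[leLHS]mulr1 ler_pM // exprn_ege1 // ler1n.
  by move: h2 e1 e2 e_gt0; rewrite c_eq; clear; nra.
have sepS (b : bool) : separated (pts R F (if b then t else - t)).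
  by apply: pts_separated; case: b.
have eh0 : 0 <= 2 * eh by rewrite mulr_ge0 // ltW.
have [i i2 iP] := choose_point (p%:~R / q%:~R) sepS cL W0 W64 ze14 eh0 eh1 W2.
(* Adding [d] times the first column of the matrix to the second translates the seed by [d]. The
   part [2 ^ 14] keeps the image within [l / 16] of the cusp, and makes [z] large enough for the
   transfer. *)
have [d dE] : exists d : nat, d%:R = 2 ^+ 14 + i%:R :> R.
  by exists (2 ^ 14 + i)%N; rewrite natrD natrX.
have detd : p * (q' + d%:Z * q) - (p' + d%:Z * p) * q = 1 by rewrite -det; ring.
exists p, (p' + d%:Z * p), q, (q' + d%:Z * q).
have zE : th + (q' + d%:Z * q)%:~R / q%:~R = ze + i%:R.
  rewrite /ze rmorphD rmorphM /= -pmulrn dE; move: (2 ^+ 14) => w.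
  by field; rewrite gt_eqF.
have z0 : 0 < ze + i%:R.
  by rewrite ltr_pwDl // (lt_le_trans _ ze14) // exprn_gt0.
have z14 : 2 ^+ 14 <= ze + i%:R by apply: le_trans ze14 _; rewrite lerDl.
have zZ : ze + i%:R <= Z by apply: le_trans zeZ; rewrite lerD2l ler_nat.
have sE : q%:~R * th + (q' + d%:Z * q)%:~R = q%:~R * (ze + i%:R).
  by rewrite -zE; field; rewrite gt_eqF.
have yE : (p%:~R * th + (p' + d%:Z * p)%:~R) / (q%:~R * th + (q' + d%:Z * q)%:~R) =
    p%:~R / q%:~R - 1 / (q%:~R ^+ 2 * (ze + i%:R)).
  have e3 : p%:~R * th + (p' + d%:Z * p)%:~R =
      (p%:~R * (q%:~R * (ze + i%:R)) - (p * (q' + d%:Z * q) - (p' + d%:Z * p) * q)%:~R) / q%:~R.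
    by rewrite -sE !(rmorphB, rmorphD, rmorphM) /=; field; rewrite gt_eqF.
  by rewrite e3 detd sE; field; rewrite !gt_eqF.
rewrite /= zE yE; split => //; first by rewrite z14.
set y := p%:~R / q%:~R - _.
have z16 : 320 <= ze + i%:R.
  apply: le_trans z14; rewrite -[14%N]/(9 + 5)%N exprD (_ : 2 ^+ 9 = 512); last by ring.
  by rewrite (_ : 2 ^+ 5 = 32); [clear; lra|ring].
split.
  have h : c * L * 2 ^+ 14 <= q%:~R ^+ 2 * (ze + i%:R).
    by apply: ler_pM; rewrite ?exprn_ge0 // ltW.
  have cL16 : c * L * 2 ^+ 14 = 16 * L.
    rewrite -[14%N]/(10 + 4)%N exprD (_ : 2 ^+ 10 = 1024); last by ring.
    by rewrite c_eq; field.
  have h0 : 0 <= 1 / (q%:~R ^+ 2 * (ze + i%:R)).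
    by rewrite divr_ge0 // mulr_ge0 ?(ltW W0) ?(ltW z0).
  have h1 : 1 / (q%:~R ^+ 2 * (ze + i%:R)) <= l / 16.
    rewrite ler_pdivrMr ?mulr_gt0 //; apply: le_trans (_ : l / 16 * (16 * L) <= _).
      have -> : l / 16 * (16 * L) = L * l by field.
      by rewrite Ll.
    by rewrite -cL16 ler_pM2l // divr_gt0.
  move: dist; rewrite ler_norml /y; move: (_ / q%:~R) (1 / _) h0 h1 => a b.
  by clear -l0 => b0 b1 /andP[a1 a2]; apply/andP; split; lra.
have det2 : (p * (q' + d%:Z * q) - (p' + d%:Z * p) * q) ^+ 2 = 1 by rewrite detd expr1n.
have d20 : 0 < 1 / 20 :> R by rewrite divr_gt0.
have d20' : 1 / 20 <= 1 :> R by clear; lra.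
have zd : 16 / (1 / 20) <= th + (q' + d%:Z * q)%:~R / q%:~R :> R.
  by rewrite zE; apply: le_trans z16; clear; lra.
have farF := transfer_avoid FF t1 d20 d20' avF q0 det2 zd.
have far0 := transfer_avoid square_form_family (isT : `|0 : int| <= 1) d20 d20' av0 q0 det2 zd.
rewrite /= yE -/y in farF far0.
have q64 : 0 <= 64 * q%:~R ^+ 2 :> R by rewrite mulr_ge0 // ltW.
have d80 : 1 / 80 = 1 / 20 / 2 / 2 :> R by field.
have bothF b u : pts R F (if b then t else - t) u -> c * L < u.1 ->
    (if u.1 <= 64 * q%:~R ^+ 2 then 2 * eh else 1 / 80) <= u.1 * `|y - u.2|.
  move=> Fu u1; case: (lerP u.1) => u2; first exact: iP _ _ Fu u1 u2.
  rewrite d80; apply: (pts_far (t0 := t) q64 _ farF Fu u2).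
  by case: (b); rewrite ?normrN.
case=> [[|[|[|//]]] i3] u; rewrite /targets /margin /=.
- move=> Su u1; case: (lerP u.1) => u2; last first.
    by rewrite d80; apply: (pts_far q64 _ far0 Su u2).
  case: Su u1 u2 => [a [b [c' [sf a0 ->]]]] /= {u}.
  have [q1 [p1 [q10 [u1 [v1 uv1]] -> -> _]]] := square_form_pos sf a0.
  have q1R : 0 < q1%:~R :> R by rewrite ltr0z.
  rewrite rmorphXn /= => cq1 q1q.
  have -> : (0%:~R - (- 2 * (q1 * p1))%:~R) / (2 * q1%:~R ^+ 2) = p1%:~R / q1%:~R :> R.
    by rewrite !rmorphM /= rmorphN /=; field; rewrite gt_eqF.
  have uv0 : - p' * q + q' * p = 1 by rewrite -det; ring.
  have z16' : 16 <= ze + i%:R by apply: le_trans z16; clear; lra.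
  have q8 : q1%:~R <= 8 * q%:~R :> R.
    rewrite -(ler_pXn2r (_ : (0 < 2)%N)) ?nnegrE ?(ltW q1R) ?mulr_ge0 ?(ltW qR) //.
    by rewrite exprMn; apply: le_trans q1q _; rewrite ler_pM2r //; clear; lra.
  have := cusp_zone q0 q10 uv0 uv1 z16' q8; apply: le_trans.
  rewrite le_min; apply/andP; split.
    rewrite ler_pdivlMr //; apply: le_trans eZ; rewrite ler_pM2l // mulr_gt0 //.
  have w0 : 0 < q1%:~R / q%:~R :> R by rewrite divr_gt0.
  have w2 : c * e <= 16 * (q1%:~R / q%:~R) ^+ 2.
    rewrite expr_div_n mulrA ler_pdivlMr //.
    apply: le_trans (_ : c * e * (16 * (L / e)) <= _).
      by rewrite ler_pM2l // mulr_gt0.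
    have -> : c * e * (16 * (L / e)) = 16 * (c * L) by field; rewrite gt_eqF.
    by rewrite ler_pM2l // ltW.
  move: w0 w2 e_gt0 ec; move: (q1%:~R / q%:~R) => w; clear => w0 w2 e0 ec.
  rewrite leNgt; apply/negP => small; nra.
- exact: (bothF true).
- exact: (bothF false).
Qed.

Definition close (R : realType) (F : int -> int -> int -> Prop) (t : int) (m : nat) (x : R) :=
  exists a b c t', [/\ F a b c, m%:Z < a, `|t'| = `|t| & `|psi a b x - t'%:~R| * m.+1%:R <= 1].

Lemma safe_shift (R : realFieldType) (y a v w l' M X : R) : 0 <= w -> y <= a <= y + l' ->
  M + X <= w * `|y - v| -> w * l' <= X -> M <= w * `|a - v|.
Proof.
move=> w0 /andP[ya al] far small.
have h1 : `|y - v| <= `|a - v| + l'.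
  rewrite -[y - v](subrKA a) addrC; apply: le_trans (ler_normD _ _) _.
  by rewrite lerD2l distrC ger0_norm; move: ya al; clear; lra.
have := ler_wpM2l w0 h1; rewrite mulrDr; move: far small.
by move: (w * `|y - v|) (w * `|a - v|) (w * l'); clear => p q s; lra.
Qed.

Lemma psi_shift (R : realFieldType) (a b : int) (x y l : R) : 0 < a -> y <= x <= y + l ->
  `|psi a b x - psi a b y| <= 2 * a%:~R * l.
Proof.
move=> a0 /andP[yx xl]; have aR := intr_ge1 R a0.
have -> : psi a b x - psi a b y = 2 * a%:~R * (x - y) by rewrite /psi; ring.
have a2 : 0 <= 2 * a%:~R :> R by rewrite mulr_ge0 // (le_trans ler01).
rewrite normrM (ger0_norm a2) ler_wpM2l // ger0_norm; move: yx xl; clear; lra.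
Qed.

Lemma special_step (R : realType) (F F' : int -> int -> int -> Prop) (t t' : int)
    (c e eh Z : R) (n r : nat) :
  form_family F -> `|t| <= 1 -> separated_family R F t -> separated_family R F (- t) ->
  form_family F' -> `|t'| <= 1 -> (forall a b c, F' a b c -> b ^+ 2 - 4 * a * c = - 3) \/ `|t'| = 1 ->
  (0 < r)%N -> step_constants c e eh Z n -> eh <= e ->
  (forall m, exists2 th : R, avoids F t th & close F' t' m th) ->
  forall m, exists J : nat, forall k x, safe (targets F t) (margin e eh) c r k x ->
    exists x', [/\ safe (targets F t) (margin e eh) c r (k + J).+1 x', x <= x',
      x' + (2 ^ r)%N%:R ^- (k + J).+1 <= x + (2 ^ r)%N%:R ^- k
    & forall a, x' <= a <= x' + (2 ^ r)%N%:R ^- (k + J).+1 -> close F' t' m a].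
Proof.
move=> FF t1 sep1 sep2 FF' t'1 disc r0 SC ehe seeds m.
have [c_eq [e_gt0 ec en Z_eq [eZ eh_gt0 ehZ]]] := SC.
(* Multiplied by [m.+1], the errors of the seed, of the transfer and of the displacement are at most
   [1 / 4], [1 / 16] and [1 / 2]. *)
have [th avth [a' [b' [c' [t'' [hf' a'm t''t close']]]]]] := seeds (4 * m.+1)%N.
have a'0 : 0 < a' by apply: lt_trans a'm; rewrite ltz_nat.
have aR' := intr_ge1 R a'0.
have m0 : 0 < m.+1%:R :> R by rewrite ltr0n.
have Z1 : 2 ^+ 14 <= Z by rewrite Z_eq -addrA lerDl addr_ge0.
have Z0 : 0 < Z by apply: lt_le_trans Z1; rewrite exprn_gt0.
pose N : R := (2 ^ r)%N%:R.
have N2 : 2 <= N by rewrite /N -[X in X <= _]/(2%:R) ler_nat -[X in (X <= _)%N]expn1 leq_exp2l.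
have N0 : 0 < N by apply: lt_le_trans N2.
pose K2 := 32 * (64 * (Z ^+ 2 * (a'%:~R * m.+1%:R))).
have K20 : 0 < K2 by rewrite !mulr_gt0 ?exprn_gt0 // (lt_le_trans ltr01).
(* Three demands on the new interval: to fit inside the old one, to keep the margins up to height
   [64 Q ^ 2], and to keep all its points close to the approached target. None involves the level
   [k], so neither does [J]. *)
pose tol := Num.min (1 / 8) (Num.min (eh * e / (32 * 32)) (e / K2)).
have tol0 : 0 < tol.
  rewrite !lt_min divr_gt0 //= (divr_gt0 e_gt0 K20) andbT.
  by rewrite divr_gt0 // mulr_gt0.
have Ni0 : 0 <= N^-1 by rewrite invr_ge0 ltW.
have Ni1 : N^-1 < 1 by rewrite invf_lt1 //; apply: lt_le_trans N2; rewrite ltr1n.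
have [J HJ] := expr_small Ni0 Ni1 tol0.
exists J => k x sx.
pose l := N ^- k; pose L := N ^+ k.
have l0 : 0 < l by rewrite invr_gt0 exprn_gt0.
have L0 : 0 < L by rewrite exprn_gt0.
have Ll : L * l = 1 by rewrite divff // gt_eqF.
have l1 : l <= 1.
  by rewrite invf_le1 ?exprn_gt0 // exprn_ege1 // (le_trans _ N2) // ler1n.
pose eta := N ^- J.+1; pose l' := N ^- (k + J).+1.
have eta0 : 0 < eta by rewrite invr_gt0 exprn_gt0.
have l'E : l' = l * eta by rewrite /l' -addnS exprD invfM.
have etatol : eta <= tol.
  apply: le_trans (ltW HJ); rewrite exprVn /eta lef_pV2 ?posrE ?exprn_gt0 //.
  by rewrite exprS ler_peMl ?exprn_ge0 ?(ltW N0) // (le_trans _ N2) // ler1n.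
move: etatol; rewrite !le_min => /andP[eta8 /andP[eta_eh eta_K]].
have safe0 al z : x <= al <= x + l -> pts R square_form 0 z -> z.1 <= c * L -> e <= z.1 * `|al - z.2|.
  by move=> al1 Sz z1; apply: (sx al ord0 z).
have [P [P' [Q [Q' /= [Q0 det /andP[z14 zZ] QL [/andP[xy yx] far]]]]]] :=
  local_point FF t1 sep1 sep2 SC l0 l1 Ll avth safe0.
set z := th + _ in z14 zZ; set y := (_ / (Q%:~R * th + Q'%:~R)) in xy yx far.
have L'l' : N ^+ (k + J).+1 * l' = 1 by rewrite /l' divff // expf_neq0 // gt_eqF.
have l'0 : 0 < l' by rewrite l'E mulr_gt0.
have l'8 : l' <= l / 8.
  by rewrite l'E ler_pM2l //; apply: le_trans eta8 _; rewrite mul1r.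
have inside : y + l' <= x + l by move: yx l'8; clear; lra.
have c_gt0 : 0 < c by move: ec e_gt0; clear; lra.
have cL0 : 0 < c * L by rewrite mulr_gt0.
exists y; rewrite -/l' -/l; split => //.
- move=> a i u; rewrite -/N -/l' => ay Tu u1.
  have ax : x <= a <= x + l.
    by case/andP: ay => a1 a2; rewrite (le_trans xy a1) (le_trans a2 inside).
  case: (lerP u.1 (c * L)) => uL; first exact: sx ax Tu uL.
  have := far i u Tu uL.
  have u0 : 0 <= u.1 by apply: ltW; apply: lt_trans uL.
  have M1 : margin e eh i <= e by rewrite /margin; case: ifP.
  have M2 : eh <= margin e eh i by rewrite /margin; case: ifP.
  case: (lerP u.1 _) => u64 big.
    apply: (safe_shift (X := margin e eh i) u0 ay).
      by rewrite -mulr2n -mulr_natl.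
    apply: le_trans M2; apply: (@le_trans _ _ (64 * (16 * (L / e)) * l')).
      rewrite ler_pM2r //; apply: le_trans u64 _; rewrite ler_pM2l //.
    have -> : 64 * (16 * (L / e)) * l' = 32 * 32 * (L * l) * eta / e.
      by rewrite l'E; field; rewrite gt_eqF.
    by rewrite Ll mulr1 ler_pdivrMr // mulrC -ler_pdivlMr.
  apply: (safe_shift (X := c) u0 ay).
    by apply: le_trans big; move: M1 ec e_gt0; rewrite c_eq; clear; lra.
  apply: (@le_trans _ _ (c * N ^+ (k + J).+1 * l')); first by rewrite ler_pM2r.
  by rewrite -mulrA L'l' mulr1.
move=> a ay.
have z16 : 16 <= z.
  apply: le_trans z14; rewrite -[14%N]/(4 + 10)%N exprD (_ : 2 ^+ 4 = 16); last by ring.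
  by rewrite ler_peMr // exprn_ege1 // ler1n.
pose e1 : R := (4 * m.+1).+1%:R^-1.
have e10 : 0 < e1 by rewrite invr_gt0.
have e1m : e1 * m.+1%:R <= 1 / 4.
  rewrite /e1 mulrC ler_pdivrMr ?ltr0n // -[X in _ <= _ * X]natr1 natrM; move: m0; move: (m.+1%:R) => w; clear; lra.
have e14 : e1 <= 1 / 4.
  by apply: le_trans e1m; rewrite ler_peMr ?(ltW e10) // ler1n.
have close1 : `|psi a' b' th - t''%:~R| <= e1 by rewrite /e1 -[leRHS]mul1r ler_pdivlMr ?ltr0n.
have t''1 : `|t''| <= 1 by rewrite t''t.
have disc' : (forall a b c, F' a b c -> b ^+ 2 - 4 * a * c = - 3) \/ `|t''| = 1 by rewrite t''t.
have det2 : (P * Q' - P' * Q) ^+ 2 = 1 by rewrite det expr1n.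
have [a0 [b0 [c0 [t0 [hf aa' a28 t0t cl]]]]] :=
  transfer_approach FF' t''1 (ltW e10) e14 hf' a'0 close1 disc' Q0 det2 z16.
rewrite -/z -/y in a28 cl.
have a0a' : a' <= a0 by rewrite ler_int in aa'.
have a0_gt0 : 0 < a0 by apply: lt_le_trans a0a'.
exists a0, b0, c0, t0; split => //.
- by apply: lt_le_trans a0a'; apply: lt_trans a'm; rewrite ltz_nat; clear; lia.
- by rewrite t0t.
have a'm' : 1 / (4 * a'%:~R) * m.+1%:R <= 1 / 16 :> R.
  have : (4 * m.+1)%N%:R <= a'%:~R :> R.
    by rewrite -[leLHS]/((4 * m.+1)%N%:Z%:~R) ler_int ltW.
  have a4 : 0 < 4 * a'%:~R :> R by rewrite mulr_gt0 // ltr0z.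
  rewrite natrM mulrAC mul1r ler_pdivrMr //.
  by move: (m.+1%:R) (a'%:~R) => w v; clear; lra.
have sh := psi_shift b0 a0_gt0 ay.
have l'm : 2 * a0%:~R * l' * m.+1%:R <= 1 / 2.
  have h : a0%:~R <= 28 * (16 * (L / e) * Z ^+ 2) * a'%:~R.
    apply: le_trans a28 _; rewrite ler_wpM2r ?(le_trans ler01) // ler_pM2l //.
    rewrite exprMn; apply: ler_pM; rewrite ?sqr_ge0 // ler_pXn2r ?nnegrE ?(ltW Z0) //.
    by apply: le_trans z14; rewrite exprn_ge0.
  apply: (@le_trans _ _ (2 * (28 * (16 * (L / e) * Z ^+ 2) * a'%:~R) * l' * m.+1%:R)).
    by rewrite ler_pM2r // ler_pM2r // ler_pM2l.
  have -> : 2 * (28 * (16 * (L / e) * Z ^+ 2) * a'%:~R) * l' * m.+1%:R =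
     7 / 16 * (L * l) * (K2 * eta / e) by rewrite l'E /K2; field; rewrite gt_eqF.
  rewrite Ll mulr1; have : K2 * eta / e <= 1.
    by rewrite ler_pdivrMr // mul1r mulrC -ler_pdivlMr.
  by move: (K2 * eta / e) => w; clear; lra.
have tri := le_trans (ler_distD (psi a0 b0 y) (psi a0 b0 a) t0%:~R) (lerD sh cl).
apply: le_trans (ler_wpM2r (ltW m0) tri) _; rewrite mulrDl [X in _ + X]mulrDl.
move: l'm a'm' e1m; move: (2 * a0%:~R * l' * _) (1 / (4 * _) * _) (e1 * _) => p q s.
by clear; lra.
Qed.

(** * Dimension of the two differences *)

Lemma exists_step_constants (R : realType) r : (9 <= r)%N -> exists (e eh Z : R) (n : nat),
  [/\ step_constants (1 / 1024) e eh Z n, eh <= e & e <= 1 / 1024 / (2 ^ r)%N%:R].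
Proof.
(* Then [e 2 ^ n = 2 ^ 20] exactly, while [Z] grows only linearly in [r], so that [e Z] stays
   small. *)
move=> r9; pose e : R := 2 ^- (r + 20)%N; have [n nE] : exists n, n = (40 + r)%N by exists (40 + r)%N.
have n0 : 0 <= (2 * n)%N%:R :> R by exact: ler0n.
pose Z : R := 2 ^+ 14 + (2 * n)%N%:R + 4.
pose eh := e * (1 / 1024) / (2 ^+ 16 * Z ^+ 2).
have p10 : 1024 = 2 ^+ 10 :> R by ring.
have e0 : 0 < e by rewrite invr_gt0 exprn_gt0.
have p14 : 1 <= 2 ^+ 14 :> R by rewrite exprn_ege1 // ler1n.
have Z1 : 1 <= Z by rewrite /Z; move: p14 n0; clear; lra.
have Z0 : 0 < Z by apply: lt_le_trans Z1.
have ZZ : 0 < 2 ^+ 16 * Z ^+ 2 by rewrite mulr_gt0 ?exprn_gt0.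
have c0 : 0 < 1 / 1024 :> R by rewrite p10 divr_gt0 ?exprn_gt0.
have Z2 : 1 <= 2 ^+ 16 * Z ^+ 2.
  rewrite -[leLHS]mulr1; apply: ler_pM => //; first by rewrite exprn_ege1 // ler1n.
  exact: exprn_ege1.
have eE : e * 2 ^+ (r + 20) = 1 by rewrite mulVf // expf_neq0.
exists e, eh, Z, n; split.
- rewrite /step_constants; split; first by []; split; [exact: e0| | |by []|].
  + rewrite (_ : 256 = 2 ^+ 8); last by ring.
    rewrite p10 ler_pdivlMr ?exprn_gt0 //; apply: le_trans (_ : e * 2 ^+ (r + 20) <= _); last by rewrite eE.
    rewrite mulrAC -exprD mulrC ler_pM2l //.
    by rewrite ler_eXn2l ?ltr1n //; move: r9; clear; lia.
  + have -> : (n = (r + 20) + 20)%N by rewrite nE; clear; lia.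
    by rewrite exprD mulrA eE mul1r.
  + split.
    * apply: le_trans (_ : e * 2 ^+ (r + 20) <= _); last by rewrite eE.
      rewrite -mulrA mulrCA (ler_pM2l e0) /Z nE.
      have a1 : 1 <= 2 ^+ r :> R by rewrite exprn_ege1 // ler1n.
      have ra : r%:R <= 2 ^+ r :> R by rewrite -natrX ler_nat ltnW // ltn_expl.
      have b1 : 100 <= 2 ^+ 14 :> R.
        rewrite -[14%N]/(7 + 7)%N exprD (_ : 2 ^+ 7 = 128); last by ring.
        by clear; lra.
      have -> : 2 ^+ (r + 20) = 64 * (2 ^+ r * 2 ^+ 14) :> R.
        rewrite (_ : (r + 20 = r + 14 + 6)%N); last by rewrite -!addnA.
        by rewrite !exprD; ring.
      have -> : (2 * (40 + r))%N%:R = 2 * (40 + r%:R) :> R by rewrite natrM natrD.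
      move: a1 ra b1; move: (2 ^+ r) (2 ^+ 14) (r%:R) => a b d; clear => *; nra.
    * exact: divr_gt0 (mulr_gt0 e0 c0) ZZ.
    * by rewrite /eh mulrC divfK ?(gt_eqF ZZ).
- rewrite /eh (ler_pdivrMr _ _ ZZ) (ler_pM2l e0); apply: le_trans Z2.
  by rewrite p10 ler_pdivrMr ?exprn_gt0 // mul1r exprn_ege1 // ler1n.
rewrite p10 mul1r -invfM natrX -exprD lef_pV2 ?posrE ?exprn_gt0 //.
by rewrite ler_eXn2l ?ltr1n // addnC leq_add2l.
Qed.

(** The proportion of children kept is [1 / 8] whatever [r], so the quantity is [N ^ (1 - s) / 8]
    with [N = 2 ^ r], at least 2 once [r (1 - s) >= 4]. *)
Lemma branching_ratio (R : realType) (s : R) : s < 1 -> exists2 r : nat, (9 <= r)%N &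
  2 <= (2 ^ (r - 3))%N%:R * (2 ^ r)%N%:R `^ (- s).
Proof.
move=> s1; have s0 : 0 < 1 - s by rewrite subr_gt0.
pose r := (9 + (Num.truncn (4 / (1 - s))).+1)%N.
have r9 : (9 <= r)%N by rewrite leq_addr.
exists r => //.
have r3 : (3 <= r)%N by apply: leq_trans r9.
have rs : 4 <= r%:R * (1 - s).
  rewrite -ler_pdivrMr //; apply: le_trans (ltW (truncnS_gt _)) _.
  by rewrite ler_nat leq_addl.
have -> : (2 ^ (r - 3))%N%:R = 2 `^ (r%:R - 3) :> R.
  by rewrite natrX -powR_mulrn // natrB.
have -> : (2 ^ r)%N%:R `^ (- s) = 2 `^ (- (r%:R * s)) :> R.
  by rewrite natrX -powR_mulrn // -powRrM mulrN.
rewrite -powRD; last by rewrite pnatr_eq0 implybT.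
rewrite -[leLHS](powRr1 (ler0n _ 2)) ler_powR ?ler1n //.
by move: rs; rewrite mulrBr mulr1; move: (r%:R * s) => u; clear; lra.
Qed.

Lemma measure_neq0 (R : realType) (F F' : int -> int -> int -> Prop) (t t' : int) (A : set R) :
  form_family F -> `|t| <= 1 -> separated_family R F t -> separated_family R F (- t) ->
  form_family F' -> `|t'| <= 1 -> (forall a b c, F' a b c -> b ^+ 2 - 4 * a * c = - 3) \/ `|t'| = 1 ->
  (forall m, exists2 th : R, avoids F t th & close F' t' m th) ->
  (forall al e, 0 < e ->
    (forall a b c t0, F a b c -> 0 < a -> `|t0| = `|t| -> e <= `|psi a b al - t0%:~R|) ->
    (forall m, close F' t' m al) -> A al) ->
  forall s, 0 <= s -> s < 1 -> hausdorff_measure s A <> 0%E.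
Proof.
move=> FF t1 sep1 sep2 FF' t'1 disc seeds inA s s0 s1 mA.
(* The game needs an exponent that is positive, even for [s = 0], and still below 1. *)
pose s' := (1 + s) / 2.
have s's : s <= s' by rewrite /s'; move: s1; clear; lra.
have s'1 : s' < 1 by rewrite /s'; move: s1; clear; lra.
have s'0 : 0 < s' by rewrite /s'; move: s0; clear; lra.
have [r r9 Mr] := branching_ratio s'1.
have [e [eh [Z [n [SC ehe er]]]]] := exists_step_constants R r9.
have [_ [e0 ec _ _ [_ eh0 _]]] := SC.
pose N := (2 ^ r)%N; have N1 : (1 < N)%N by rewrite -[1%N]/(2 ^ 0)%N ltn_exp2l // (leq_trans _ r9).
pose c : R := 1 / 1024.
have c0 : 0 < c by move: ec e0; rewrite -/c; clear; lra.
have c1 : c < 1 by rewrite /c; clear; lra.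
have rho0 : 0 < N%:R `^ (- s') / 2 :> R by rewrite divr_gt0 // powR_gt0 // ltr0n (ltn_trans _ N1).
have [U [w [AU w0 wU wsum]]] := measure0_cover s0 s's s'0 rho0 mA.
have sepS i : separated (@targets R F t i).
  by case: i => [[|[|i]] ?]; apply: pts_separated => //; apply: square_form_separated.
have eb i : 0 <= margin e eh i <= c / (2 ^ r)%N%:R.
  by rewrite /margin; case: ifP => _; rewrite ?(ltW e0) ?(ltW eh0) //= (le_trans ehe).
have normal := normal_step sepS c0 (lexx c) r9 eb.
have special := special_step FF t1 sep1 sep2 FF' t'1 disc (leq_trans _ r9) SC ehe seeds.
have targets_ge1 i (u : R * R) : targets F t i u -> 1 <= u.1.
  have pts_ge1 G k : pts R G k u -> 1 <= u.1.
    by case=> [a [b [c' [_ a0 ->]]]]; apply: intr_ge1.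
  by case: i => [[|[|i]] ?]; apply: pts_ge1.
(* All heights are at least 1, above [c], so nothing is tested at level 0. *)
have P0 : safe (targets F t) (margin e eh) c r 0 0.
  move=> a i u _ /targets_ge1 u1; rewrite expr0 mulr1 => u2.
  by have := le_lt_trans (le_trans u1 u2) c1; rewrite ltxx.
have [al [Gal Pal nU]] := game_win N1 s'0 Mr normal (special isT) w0 wU P0 wsum.
have [i _ Ui] : (\bigcup_i U i) al; last exact: nU Ui.
apply/AU/(inA al (2 * eh)) => //; first by rewrite mulr_gt0.
move=> a b c' t0 hf a0 t0t.
have aR : 0 < a%:~R :> R by rewrite ltr0z.
have N0 : 0 < N%:R :> R by rewrite ltr0n (ltn_trans _ N1).
have Ni0 : 0 <= N%:R^-1 :> R by rewrite invr_ge0 ltW.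
have Ni1 : N%:R^-1 < 1 :> R by rewrite invf_lt1 // ltr1n.
have [m Hm] := expr_small Ni0 Ni1 (divr_gt0 c0 aR).
have [k [x [mk Px xal]]] := Pal m.
(* A given form is tested at every sufficiently deep level, and safe intervals around [al] occur at
   arbitrarily deep ones. *)
have ak : a%:~R <= c * N%:R ^+ k.
  apply: (@le_trans _ _ (c * N%:R ^+ m)); last first.
    by rewrite ler_pM2l // ler_weXn2l // ler1n ltnW.
  move: Hm; rewrite ltr_pdivlMr // exprVn mulrC ltr_pdivrMr ?exprn_gt0 // => /ltW.
  by rewrite mulrC.
have [i' Mi Tu] : exists2 i : 'I_3, margin e eh i = eh & @targets R F t i (a%:~R, (t0%:~R - b%:~R) / (2 * a%:~R)).
  have [-> | ->] : t0 = t \/ t0 = - t by clear -t0t; lia.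
    by exists (@Ordinal 3 1 isT) => //=; exists a, b, c'.
  by exists (@Ordinal 3 2 isT) => //=; exists a, b, c'.
have := Px al i' _ xal Tu ak; rewrite Mi /= pts_dist // ler_pdivlMr // mulrC.
by [].
Qed.

Lemma sqrt3_seed (R : realType) (m : nat) :
  exists2 th : R, avoids square_form 1 th & close hex_form 0 m th.
Proof.
have [r1 r2 _] := sqrt3P R; exists (Num.sqrt 3).
  split; [by move: r1; clear; lra|by move: r2; clear; lra| |] => a b c t sf a0 t1;
    by apply: sqrt3_square_form sf a0 _; rewrite t1.
have [a [b [c [hf ma cl]]]] := sqrt3_hex_form R m.
by exists a, b, c, 0; rewrite subr0.
Qed.

Lemma sqrt2_seed (R : realType) (m : nat) :
  exists2 th : R, avoids hex_form 0 th & close square_form 1 m th.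
Proof.
have [th [/andP[h1 h2] hexfar sqfar [a [b [c [t [sf ma t1 cl]]]]]]] := sqrt2_theta R m.
exists th; last by exists a, b, c, t.
have far (u : R) (t' : int) : `|t'| = `|(0 : int)| -> 1 / 10 <= `|u| -> 1 / 20 <= `|u - t'%:~R|.
  by rewrite normr0 => /normr0_eq0 ->; rewrite subr0; clear; lra.
split; [by move: h1; clear; lra|by move: h2; clear; lra| |].
  by move=> a' b' c' t' sf' a0 t0; apply: far t0 (sqfar _ _ _ sf' a0).
by move=> a' b' c' t' hf' a0 t0; apply: far t0 (hexfar _ _ _ hf').
Qed.

Theorem theorem1p2 (R : realType) :
  hausdorff_dim (DI (2 : R) `\` DI (1 : R)) = 1%E /\
  hausdorff_dim (DI (1 : R) `\` DI (2 : R)) = 1%E.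
Proof.
have sq1 := @square_form_separated R 1 isT.
have sq1' := @square_form_separated R (- 1) isT.
have hex0 := @hex_form_separated R.
have hex0' : separated_family R hex_form (- 0) by rewrite oppr0.
split; apply: hausdorff_dim_eq1.
  have disc : (forall a b c, square_form a b c -> b ^+ 2 - 4 * a * c = - 3) \/ `|1 : int| = 1 by right.
  apply: (measure_neq0 hex_form_family _ hex0 hex0' square_form_family _ disc (sqrt2_seed R)) => //.
  move=> al e e0 far near; split.
    apply: (DI2_intro e0) => a b c hf; have [a0 _] := hf.
    by have := far a b c 0 hf a0 erefl; rewrite subr0.
  by apply: not_DI1_intro => m; exact: near.
have disc : (forall a b c, hex_form a b c -> b ^+ 2 - 4 * a * c = - 3) \/ `|0 : int| = 1.
  by left=> a b c [].
apply: (measure_neq0 square_form_family _ sq1 sq1' hex_form_family _ disc (sqrt3_seed R)) => //.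
move=> al e e0 far near; split; first exact: (DI1_intro e0).
apply: not_DI2_intro => m; have [a [b [c [t [hf ma t0 cl]]]]] := near m.
exists a, b, c; split => //; move: cl.
by have -> : t = 0; [apply/normr0_eq0; rewrite t0 normr0|rewrite subr0].
Qed.
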